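(* Let $I=[a,b]$, let $v,w\in L^\infty(\mathbb{R}^+;C(I))$, with $v(x,\cdot),w(x,\cdot)$ Lipschitz for each $x\in I$, and set $v_\Phi=S_\Phi v$, $w_\Phi=S_\Phi w$. Suppose that $\bar v_\Phi=\mathcal{L}[v_\Phi]$ and $\bar w_\Phi=\mathcal{L}[w_\Phi]$ are both solutions of the same Cauchy problem (with the same data $f,g_1,g_2$) $$\begin{cases}\Phi(\lambda)\bar u(x,\lambda)-\frac{\Phi(\lambda)}{\lambda}u(x,0)=\frac{\Phi(\lambda)}{2\lambda}\frac{\partial^2}{\partial x^2}\widehat{L}_{H,\Phi}\bar u(x,\lambda), & (x,\lambda)\in I\times(0,+\infty),\\ u(x,0)=f(x), & x\in I,\\ \widehat{L}_{H,\Phi}\bar u(a,\lambda)=g_1(\lambda), & \lambda>0,\\ \frac{\partial}{\partial x}\widehat{L}_{H,\Phi}\bar u(a,\lambda)=g_2(\lambda), & \lambda>0,\end{cases}$$ that is, the system holds with $u=v_\Phi$, $\bar u=\bar v_\Phi$ and with $u=w_\Phi$, $\bar u=\bar w_\Phi$. If $w_\Phi\preceq v_\Phi$, then $w_\Phi=v_\Phi$.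
   Context: **Subordinator.** $\Phi(\lambda)=\int_0^{+\infty}(1-e^{-s\lambda})\,\nu_\Phi(ds)$ is a Bernstein function (no killing, no drift), with Lévy measure $\nu_\Phi$ on $(0,\infty)$ satisfying $\int_0^\infty(t\wedge1)\nu_\Phi(dt)<\infty$ and $\nu_\Phi(0,\infty)=\infty$; it extends holomorphically to $\Phi:\mathbb{H}\to\mathbb{H}$, $\mathbb{H}=\{\lambda\in\mathbb{C}:\Re\lambda>0\}$. $\sigma_\Phi$ is the subordinator with $\mathbb{E}[e^{-\lambda\sigma_\Phi(t)}]=e^{-t\Phi(\lambda)}$, $E_\Phi(t)=\inf\{y>0:\sigma_\Phi(y)>t\}$ its inverse, and $f_\Phi(s,t)$ the probability density (in $s>0$) of $E_\Phi(t)$, $t>0$; one has $\int_0^\infty e^{-\lambda t}f_\Phi(s,t)dt=\frac{\Phi(\lambda)}{\lambda}e^{-s\Phi(\lambda)}$. **Variance function.** $H\in(1/2,1)$, $\theta>0$, $B^H$ is a fractional Brownian motion with Hurst index $H$, $U_H(t)=e^{-t/\theta}\int_0^te^{s/\theta}dB^H(s)$, and $V_{2,H}(t)=\mathbb{E}[U_H(t)^2]=H(2H-1)e^{-2t/\theta}\int_0^t\int_0^te^{(u+v)/\theta}|u-v|^{2H-2}du\,dv$. $V'_{2,H}$ is its derivative. **Operators.** $L^\infty(\mathbb{R}^+;X)$, for a real Banach space $X$, is the space of measurable essentially bounded $v:[0,\infty)\to X$; $C(I)$ carries the sup norm; one writes $v(x,t)=v(t)(x)$. $S_\Phi v(t)=\int_0^{\infty}v(s)f_\Phi(s,t)ds$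 (Bochner integral), with $S_\Phi v(x,0)=v(x,0)$; $S_\Phi$ is injective. $\mathcal{L}$ is the Laplace transform in $t$. Fix $c_1<0<c_2$ with $c_1-c_2>-1/\theta$ such that the inverse of $\Phi$ is well defined on the line $r_{c_2}=\{c_2+iz:z\in\mathbb{R}\}$. Define $$\widehat{L}_{H,\Phi}\bar v(x,\lambda)=\frac{1}{4\pi^2}\int_0^{\infty}e^{-\Phi(\lambda)t}\lim_{R\to\infty}\int_{-\infty}^{\infty}e^{(c_1+iw)t}\int_{-R}^{R}\mathcal{L}[V'_{2,H}](c_1-c_2+i(w-z))\frac{\Phi^{-1}(c_2+iz)}{c_2+iz}\bar v(x,\Phi^{-1}(c_2+iz))\,dz\,dw\,dt,$$ whose domain consists of those $\bar v$ for which this is well defined and $z\mapsto\frac{\Phi^{-1}(c_2+iz)}{c_2+iz}\bar v(x,\Phi^{-1}(c_2+iz))$ does not depend on the choice of local inverse of $\Phi$ on $r_{c_2}$. **Partial order.** Let $\mathcal{S}_\Phi$ be the range of $S_\Phi:L^\infty(\mathbb{R}^+;C(I))\to L^\infty(\mathbb{R}^+;C(I))$, $I=[a,b]$. For $p_\Phi=S_\Phi p$ and $q_\Phi=S_\Phi q$ in $\mathcal{S}_\Phi$, write $p_\Phi\preceq q_\Phi$ if and only if: (i) $p\le q$ in $I\times\mathbb{R}^+$; (ii) there exist constants $0<\varepsilon\le M$ such that for every $x\in I$ the function $(q-p)(x,\cdot)$ is increasing (in the wide sense) in $[0,\varepsilon]$ and decreasing (in the wide sense) in $[M,+\infty)$.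 *)

(* Defs.v *)
From HB Require Import structures.
From mathcomp Require Import all_boot all_order all_algebra.
From mathcomp Require Import complex ring lra.
From mathcomp Require Import all_classical all_reals all_analysis.

Set Implicit Arguments.
Unset Strict Implicit.
Unset Printing Implicit Defensive.

Import Order.TTheory GRing.Theory Num.Def Num.Theory.
Import numFieldNormedType.Exports.

Local Open Scope classical_set_scope.
Local Open Scope complex_scope.
Local Open Scope ring_scope.

(* The Banach space C([a, b]) with the sup norm. A continuous function on
   [a, b] is represented by its extension by zero to the whole line, so that
   elements can be evaluated at real numbers and have a unique representation. *)
Definition continuous_seg (R : realType) (a b : R) : {pred R -> R} :=
  mem [set g : R -> R | {within `[a, b], continuous g} /\
                        forall x, x \notin `[a, b] -> g x = 0].

Record contI (R : realType) (a b : R) := ContI {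
  contI_fun :> R -> R ;
  _ : contI_fun \in @continuous_seg R a b }.

HB.instance Definition _ (R : realType) (a b : R) :=
  [isSub for @contI_fun R a b].
HB.instance Definition _ (R : realType) (a b : R) :=
  [Choice of contI a b by <:].

Lemma continuous_seg_submod_closed (R : realType) (a b : R) :
  submod_closed (@continuous_seg R a b).
Proof.
split => [|k g h].
  by rewrite inE; split => [x|x _ //]; exact: cst_continuous.
rewrite !inE => -[gc g0] [hc h0]; split.
  move=> x; apply: continuousD; last exact: hc.
  by apply: continuousM; [exact: cst_continuous|exact: gc].
by move=> x xab; rewrite !fctE g0// h0// scaler0 addr0.
Qed.

HB.instance Definition _ (R : realType) (a b : R) :=
  GRing.isSubmodClosed.Build R (R -> R) (@continuous_seg R a b)
    (@continuous_seg_submod_closed R a b).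
HB.instance Definition _ (R : realType) (a b : R) :=
  [SubChoice_isSubLmodule of contI a b by <:].

Definition sup_norm (R : realType) (a b : R) (g : contI a b) : R :=
  sup [set `|g x| | x in `[a, b]].

Lemma contI_continuous (R : realType) (a b : R) (g : contI a b) :
  {within `[a, b], continuous g}.
Proof. by have := valP g; rewrite inE => -[]. Qed.

Lemma contI_out (R : realType) (a b : R) (g : contI a b) (x : R) :
  x \notin `[a, b] -> g x = 0.
Proof. by have := valP g; rewrite inE => -[_]; exact. Qed.

Lemma sup_norm_ub (R : realType) (a b : R) (g : contI a b) (x : R) :
  x \in `[a, b] -> `|g x| <= sup_norm g.
Proof.
move=> xab; apply: ub_le_sup; last by exists x.
have [M [_ gM]] := compact_bounded
  (continuous_compact (@contI_continuous _ _ _ g) (@segment_compact _ a b)).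
exists (M + 1) => _ [y yab <-].
by apply: (gM (M + 1)); rewrite ?ltrDl//; exists y.
Qed.

Lemma sup_norm_ge0 (R : realType) (a b : R) (g : contI a b) : 0 <= sup_norm g.
Proof.
have [ab|ba] := leP a b; last first.
  rewrite /sup_norm set_itv_ge ?image_set0 ?sup0//.
  by rewrite bnd_simp -ltNge.
by apply: le_trans (sup_norm_ub g (_ : a \in `[a, b])); rewrite // in_itv/= lexx.
Qed.

Lemma sup_norm_le (R : realType) (a b : R) (g : contI a b) (M : R) : 0 <= M ->
  (forall x, x \in `[a, b] -> `|g x| <= M) -> sup_norm g <= M.
Proof.
move=> M0 gM; rewrite /sup_norm.
have [->|/set0P ne] := eqVneq [set `|g x| | x in `[a, b]] set0.
  by rewrite sup0.
by apply: ge_sup => // _ [x xab <-]; exact: gM.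
Qed.

Lemma sup_normD (R : realType) (a b : R) (g h : contI a b) :
  sup_norm (g + h) <= sup_norm g + sup_norm h.
Proof.
apply: sup_norm_le => [|x xab]; first by rewrite addr_ge0// sup_norm_ge0.
by rewrite (le_trans (ler_normD _ _))// lerD// sup_norm_ub.
Qed.

Lemma sup_normZ (R : realType) (a b : R) (k : R) (g : contI a b) :
  sup_norm (k *: g) = `|k| * sup_norm g.
Proof.
have le_normZ l (h : contI a b) : sup_norm (l *: h) <= `|l| * sup_norm h.
  apply: sup_norm_le => [|x xab]; first by rewrite mulr_ge0// sup_norm_ge0.
  by rewrite [leLHS]normrM ler_wpM2l// sup_norm_ub.
apply/eqP; rewrite eq_le le_normZ/=.
have [->|k0] := eqVneq k 0; first by rewrite normr0 mul0r sup_norm_ge0.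
rewrite -ler_pdivlMl ?normr_gt0// -normfV.
by rewrite (le_trans _ (le_normZ _ _))// scalerA mulVf// scale1r.
Qed.

Lemma sup_norm_eq0 (R : realType) (a b : R) (g : contI a b) :
  sup_norm g = 0 -> g = 0.
Proof.
move=> g0; apply: val_inj; apply/funext => x /=.
have [xab|/contI_out -> //] := boolP (x \in `[a, b]).
by apply/eqP; rewrite -normr_le0 -g0 sup_norm_ub.
Qed.

HB.instance Definition _ (R : realType) (a b : R) :=
  Lmodule_isNormed.Build R (contI a b)
    (@sup_normD R a b) (@sup_normZ R a b) (@sup_norm_eq0 R a b).

Lemma contI_complete (R : realType) (a b : R) (F : set_system (contI a b)) :
  ProperFilter F -> cauchy F -> cvg F.
Proof.
move=> PF /cauchyP cF.
have norm_eval (g h : contI a b) (x : R) : `|g x - h x| <= `|g - h|.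
  have [xab|xab] := boolP (x \in `[a, b]); first exact: sup_norm_ub (g - h) _ _.
  by rewrite !contI_out// subrr normr0.
have cvg_eval (x : R) : cvg ((fun g : contI a b => g x) @ F).
  apply/cauchy_cvgP/cauchyP => e e0; have [g Fg] := cF _ e0.
  exists (g x); suff : F [set k : contI a b | `|g x - k x| < e].
    by rewrite -ball_normE.
  apply: filterS Fg => k; rewrite -ball_normE/=; exact: le_lt_trans.
pose h (x : R) : R := lim ((fun g : contI a b => g x) @ F).
have Fh (e : R) : 0 < e ->
    \forall g \near F, forall x, `|h x - (g : contI a b) x| <= e.
  move=> e0; have e30 : 0 < e / 3 by rewrite divr_gt0.
  have [g0 Fg0] := cF _ e30; apply: filterS (Fg0) => g g0g x.
  have hx : \forall k \near F, `|h x - (k : contI a b) x| < e / 3.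
    by have /cvgrPdist_lt/(_ _ e30) := cvg_eval x.
  have [k [hk g0k]] := filter_ex (filterI hx Fg0).
  rewrite -!ball_normE/= in g0g g0k.
  move: (le_lt_trans (norm_eval g0 g x) g0g) (le_lt_trans (norm_eval g0 k x) g0k).
  by move: hk => /=; rewrite !ltr_norml ler_norml => /andP[? ?] /andP[? ?]
    /andP[? ?]; apply/andP; split; lra.
have hE : h \in @continuous_seg R a b.
  rewrite inE; split => [x|x xab].
    apply/cvgrPdist_lt => e e0.
    have e30 : 0 < e / 3 by rewrite divr_gt0.
    have [g Fg] := filter_ex (Fh _ e30).
    have /cvgrPdist_lt/(_ _ e30) := @contI_continuous _ _ _ g x.
    apply: filterS => y gxy.
    have {}gxy : `|g x - g y| < e / 3 := gxy.
    have gx := Fg x; have gy := Fg y.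
    change (`|h x - h y| < e).
    move: (h x) (h y) (g x) (g y) gxy gx gy => hx hy gx gy.
    rewrite !ltr_norml !ler_norml.
    by move=> /andP[? ?] /andP[? ?] /andP[? ?]; apply/andP; split; lra.
  apply/cvg_lim => //; apply: cvg_near_cst; apply: nearW => g.
  exact: contI_out.
apply/cvg_ex; exists (ContI hE); apply/cvgrPdist_le => e e0.
apply: filterS (Fh _ e0) => g hg.
by apply: sup_norm_le => [|x _]; [exact: ltW|exact: hg].
Qed.

HB.instance Definition _ (R : realType) (a b : R) :=
  Uniform_isComplete.Build (contI a b) (@contI_complete R a b).

Definition cexp (R : realType) (z : R[i]) : R[i] :=
  (expR (complex.Re z) * cos (complex.Im z)) +i*
  (expR (complex.Re z) * sin (complex.Im z)).

Definition cintegrable (R : realType) (d : measure_display)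
    (T : measurableType d) (mu : {measure set T -> \bar R}) (D : set T)
    (g : T -> R[i]) : Prop :=
  mu.-integrable D (fun x => (complex.Re (g x))%:E) /\
  mu.-integrable D (fun x => (complex.Im (g x))%:E).

Definition cintegral (R : realType) (d : measure_display)
    (T : measurableType d) (mu : {measure set T -> \bar R}) (D : set T)
    (g : T -> R[i]) : R[i] :=
  (\int[mu]_(x in D) complex.Re (g x)) +i* (\int[mu]_(x in D) complex.Im (g x)).

Definition claplace (R : realType) (h : R -> R) (l : R[i]) : R[i] :=
  cintegral (@lebesgue_measure R) `[0, +oo[
    (fun t => cexp (- (l * t%:C)) * (h t)%:C).

Definition simple_fun (R : realType) (X : Type) (D : set R) (s : R -> X) : Prop :=
  finite_set (range s) /\
  forall y : X, measurable (D `&` s @^-1` [set y] : set (measurableTypeR R)).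

Definition strongly_measurable (R : realType) (X : completeNormedModType R)
    (D : set R) (v : R -> X) : Prop :=
  exists s : nat -> R -> X,
    (forall n, simple_fun D (s n)) /\
    forall t, D t -> s n t @[n --> \oo] --> v t.

(* Functions rather than classes; only the values on [0, +oo[ matter. *)
Definition Linfty (R : realType) (X : completeNormedModType R)
    (v : R -> X) : Prop :=
  strongly_measurable `[0, +oo[ v /\
  exists M : R, {ae @lebesgue_measure R, forall t, 0 <= t -> `|v t| <= M}.

Definition simple_integrable (R : realType) (X : completeNormedModType R)
    (D : set R) (s : R -> X) : Prop :=
  simple_fun D s /\
  forall y : X, y != 0 ->
    (@lebesgue_measure R (D `&` s @^-1` [set y]) < +oo)%E.

Definition simple_integral (R : realType) (X : completeNormedModType R)
    (D : set R) (s : R -> X) : X :=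
  \sum_(y \in range s)
    fine (@lebesgue_measure R (D `&` s @^-1` [set y])) *: y.

Definition is_bochner (R : realType) (X : completeNormedModType R)
    (D : set R) (g : R -> X) (J : X) : Prop :=
  strongly_measurable D g /\
  exists s : nat -> R -> X,
    [/\ forall n, simple_integrable D (s n),
        (\int[@lebesgue_measure R]_(t in D) (`|g t - s n t|)%:E)%E
          @[n --> \oo] --> 0%E &
        simple_integral D (s n) @[n --> \oo] --> J].

Definition bernstein (R : realType) (nu : {measure set R -> \bar R})
    (l : R[i]) : R[i] :=
  cintegral nu `]0, +oo[ (fun s => 1 - cexp (- (s%:C * l))).

Record levy_measure (R : realType) (nu : {measure set R -> \bar R}) : Prop := {
  levy_integrable : (\int[nu]_(s in `]0%R, +oo[) (minr s 1)%:E < +oo)%E ;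
  levy_infinite : nu `]0, +oo[%classic = +oo%E }.

Record subordinator (R : realType) (d : measure_display) (T : measurableType d)
    (P : probability T R) (Phi : R[i] -> R[i]) (sigma : R -> T -> R) : Prop := {
  sub_measurable : forall t, 0 <= t -> measurable_fun setT (sigma t) ;
  sub0 : forall x, sigma 0 x = 0 ;
  sub_nondecreasing : forall x s t, 0 <= s -> s <= t -> sigma s x <= sigma t x ;
  sub_right_continuous : forall x t, 0 <= t ->
    sigma s x @[s --> t^'+] --> sigma t x ;
  sub_stationary : forall s t (A : set (measurableTypeR R)),
    0 <= s -> 0 <= t -> measurable A ->
    P [set x | A (sigma (s + t) x - sigma s x)] = P [set x | A (sigma t x)] ;
  sub_independent : forall (n : nat) (t : nat -> R)
      (A : nat -> set (measurableTypeR R)),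
    0 <= t 0%N -> (forall i, t i <= t i.+1) -> (forall i, measurable (A i)) ->
    P [set x | forall i, (i < n)%N -> A i (sigma (t i.+1) x - sigma (t i) x)] =
    (\prod_(i < n) P [set x | A i (sigma (t i.+1) x - sigma (t i) x)%R])%E ;
  sub_laplace : forall t (l : R[i]), 0 <= t -> 0 < complex.Re l ->
    cintegral P setT (fun x => cexp (- (l * (sigma t x)%:C))) =
    cexp (- (t%:C * Phi l)) }.

Definition inverse_process (R : realType) (T : Type) (sigma : R -> T -> R)
    (t : R) (x : T) : R :=
  inf [set y | 0 < y /\ t < sigma y x].

(* The density of the law of the inverse process at time t is determined only
   up to null sets; the Laplace transform in t selects the usual version. *)
Record inverse_density (R : realType) (d : measure_display)
    (T : measurableType d) (P : probability T R) (Phi : R[i] -> R[i])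
    (sigma : R -> T -> R) (f : R -> R -> R) : Prop := {
  density_measurable :
    measurable_fun (`]0%R, +oo[ `*` `]0%R, +oo[ : set (R * R))
      (fun st : R * R => f st.1 st.2) ;
  density_ge0 : forall s t, 0 < s -> 0 < t -> 0 <= f s t ;
  density_law : forall t (A : set (measurableTypeR R)), 0 < t -> measurable A ->
    P [set x | A (inverse_process sigma t x)] =
    (\int[@lebesgue_measure R]_(s in A `&` `]0%R, +oo[) (f s t)%:E)%E ;
  density_laplace : forall s (l : R[i]), 0 < s -> 0 < complex.Re l ->
    cintegrable (@lebesgue_measure R) `]0, +oo[
      (fun t => cexp (- (l * t%:C)) * (f s t)%:C) /\
    cintegral (@lebesgue_measure R) `]0, +oo[
      (fun t => cexp (- (l * t%:C)) * (f s t)%:C) =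
    Phi l / l * cexp (- (s%:C * Phi l)) }.

(* vPhi(t) is the Bochner integral of f(s, t) v(s) for t > 0, with the
   convention vPhi(0) = v(0). *)
Definition is_SPhi (R : realType) (X : completeNormedModType R)
    (f : R -> R -> R) (v vPhi : R -> X) : Prop :=
  vPhi 0 = v 0 /\
  forall t, 0 < t -> is_bochner `]0, +oo[ (fun s => f s t *: v s) (vPhi t).

(* E[U_H(t)^2] for U_H(t) = e^(-t/theta) int_0^t e^(s/theta) dB^H(s). *)
Definition variance_fOU (R : realType) (H theta t : R) : R :=
  H * (2 * H - 1) * expR (- (2 * t / theta)) *
  \int[@lebesgue_measure R]_(u in `[0, t])
    \int[@lebesgue_measure R]_(v in `[0, t])
      (expR ((u + v) / theta) * `|u - v| `^ (2 * H - 2)).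

(* psi is a selection of preimages under Phi, in the right half-plane, of the
   points of the line c2 + iR; its values off the line are irrelevant. *)
Definition local_inverse (R : realType) (Phi : R[i] -> R[i]) (c2 : R)
    (psi : R[i] -> R[i]) : Prop :=
  forall z : R, 0 < complex.Re (psi (c2 +i* z)) /\
                Phi (psi (c2 +i* z)) = c2 +i* z.

Section operator.
Context (R : realType) (Phi : R[i] -> R[i]) (dV : R -> R) (c1 c2 : R).

Definition Lhat_pullback (psi h : R[i] -> R[i]) (z : R) : R[i] :=
  psi (c2 +i* z) / (c2 +i* z) * h (psi (c2 +i* z)).

Definition Lhat_z (psi h : R[i] -> R[i]) (w z : R) : R[i] :=
  claplace dV ((c1 - c2) +i* (w - z)) * Lhat_pullback psi h z.

Definition Lhat_w (psi h : R[i] -> R[i]) (t r w : R) : R[i] :=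
  cexp (t%:C * (c1 +i* w)) *
  cintegral (@lebesgue_measure R) `[- r, r] (Lhat_z psi h w).

Definition Lhat_r (psi h : R[i] -> R[i]) (t r : R) : R[i]^o :=
  cintegral (@lebesgue_measure R) setT (Lhat_w psi h t r).

Definition Lhat_t (psi h : R[i] -> R[i]) (l : R[i]) (t : R) : R[i] :=
  cexp (- (Phi l * t%:C)) * lim (Lhat_r psi h t r @[r --> +oo]).

Definition Lhat (psi h : R[i] -> R[i]) (l : R[i]) : R[i] :=
  ((4 * pi ^+ 2)^-1)%:C *
  cintegral (@lebesgue_measure R) `]0, +oo[ (Lhat_t psi h l).

Record Lhat_domain (psi h : R[i] -> R[i]) (l : R[i]) : Prop := {
  Lhat_branch : forall psi1 psi2,
    local_inverse Phi c2 psi1 -> local_inverse Phi c2 psi2 ->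
    forall z, Lhat_pullback psi1 h z = Lhat_pullback psi2 h z ;
  Lhat_z_integrable : forall r w, 0 < r ->
    cintegrable (@lebesgue_measure R) `[- r, r] (Lhat_z psi h w) ;
  Lhat_w_integrable : forall t r, 0 < t -> 0 < r ->
    cintegrable (@lebesgue_measure R) setT (Lhat_w psi h t r) ;
  Lhat_r_cvg : forall t, 0 < t -> cvg (Lhat_r psi h t r @[r --> +oo]) ;
  Lhat_t_integrable :
    cintegrable (@lebesgue_measure R) `]0, +oo[ (Lhat_t psi h l) }.

End operator.

(* Derivative along the segment [a, b], one-sided at the end points. *)
Definition is_derive_seg (R : realType) (a b : R) (F : R -> R[i]) (x : R)
    (D : R[i]) : Prop :=
  ((F y - F x) / (y - x)%:C : R[i]^o)
    @[y --> within [set` `[a, b]] x^'] --> (D : R[i]^o).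

Record cauchy_solution (R : realType) (Phi : R[i] -> R[i]) (dV : R -> R)
    (c1 c2 : R) (psi : R[i] -> R[i]) (a b : R) (f : R -> R) (g1 g2 : R -> R[i])
    (u : R -> contI a b) (ubar : R -> R[i] -> R[i]) : Prop := {
  solution_domain : forall x l, x \in `[a, b] -> 0 < l ->
    Lhat_domain Phi dV c1 c2 psi (ubar x) l%:C ;
  solution_equation : exists D1 D2 : R -> R -> R[i],
    [/\ forall x l, x \in `[a, b] -> 0 < l ->
          is_derive_seg a b
            (fun y => Lhat Phi dV c1 c2 psi (ubar y) l%:C) x (D1 x l),
        forall x l, x \in `[a, b] -> 0 < l ->
          is_derive_seg a b (fun y => D1 y l) x (D2 x l),
        forall x l, x \in `[a, b] -> 0 < l ->
          Phi l%:C * ubar x l%:C - Phi l%:C / l%:C * (u 0 x)%:C =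
          Phi l%:C / (2 * l%:C) * D2 x l &
        forall l, 0 < l -> D1 a l = g2 l] ;
  solution_initial : forall x, x \in `[a, b] -> u 0 x = f x ;
  solution_boundary : forall l, 0 < l ->
    Lhat Phi dV c1 c2 psi (ubar a) l%:C = g1 l }.

(* Preimages under S_Phi are unique up to null sets, hence p and q are just
   representatives. *)
Definition SPhi_le (R : realType) (a b : R) (f : R -> R -> R)
    (pPhi qPhi : R -> contI a b) : Prop :=
  exists p q : R -> contI a b,
    [/\ Linfty p /\ is_SPhi f p pPhi,
        Linfty q /\ is_SPhi f q qPhi,
        forall x t, x \in `[a, b] -> 0 <= t -> p t x <= q t x &
        exists e M : R, 0 < e <= M /\
          forall x, x \in `[a, b] ->
            {in `[0, e] &, {homo (fun t => q t x - p t x) : s t / s <= t}} /\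
            {in `[M, +oo[ &, {homo (fun t => q t x - p t x) : s t /~ s <= t}}].

(* Main.v *)
Require Import Defs.
From HB Require Import structures.
From mathcomp Require Import all_boot all_order all_algebra.
From mathcomp Require Import complex ring lra.
From mathcomp Require Import all_classical all_reals all_analysis.
From mathcomp Require Import measurable_realfun.

Set Implicit Arguments.
Unset Strict Implicit.
Unset Printing Implicit Defensive.

Import Order.TTheory GRing.Theory Num.Def Num.Theory.
Import numFieldNormedType.Exports.

Local Open Scope classical_set_scope.
Local Open Scope complex_scope.
Local Open Scope ring_scope.

(** Write u = v - w, and L for the Laplace transform in t.

    Subordination becomes a substitution under L, namely
    L[S v](l) = Phi(l) / l * L[v](Phi(l)) (is_SPhi_laplace). The function
    integrated along the line Re = c2 in the definition of the operator is
    therefore L[v](c2 + i z), and the two Fourier integrals undo the transforms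
    of exp(-c2 t) v(t) and of exp(-(c1 - c2) t) V'(t). Both are given as limits
    of truncated integrals that are known to exist, and Abel summation tells
    what they are: the mean of the Dirichlet kernel against c exp(-c r) dr is
    the Poisson kernel, an approximate identity (dirichlet_inversion). So the
    operator maps L[S v] to L[V' v](Phi(l)) (LhatE).

    Phi is continuous and unbounded on the half-line, the Levy measure being
    infinite, so that m = Phi(l) takes all large real values. The difference of
    the two equations is (d/dx)^2 L[V' u](m) = 2 m L[u](m) with zero data at a,
    that is L[V' u](m) = 2 m L[G](m), where G(x, t) is the integral over [a, x]
    of (x - y) u(t, y). Let Q(x, t) be the integral of V' u(., x) over [0, t];
    its transform is L[V' u](m) / m, so 2 G and Q have the same transform at
    all large real points and then the same primitive in t, by Phragmen's
    inversion formula (laplace_unique, primitive_defect).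

    The order concerns some representatives p and q. Again by uniqueness q - p
    and u have the same primitive in t, so u is nonnegative and, beyond some T,
    nonincreasing in t (primitive_order_ge0, primitive_order_nonincreasing).
    Beyond T, then, G is nonincreasing whereas Q is nondecreasing since V' > 0.
    As 2 G - Q has zero integral over every interval, both are constant there;
    a constant Q forces u = 0 beyond T; hence G = 0 and Q = 0 there, and the
    nonnegative V' u has zero integral over [0, t] for t > T (damped_eq0). *)

(** * Integrals of real functions *)

(** The inner integrals are real-valued, so they agree with the extended-real
    ones of Fubini's theorem only almost everywhere: they are 0 where the latter
    are infinite. *)
Lemma Rintegral_fubini (R : realType) (d1 d2 : measure_display)
    (T1 : measurableType d1) (T2 : measurableType d2)
    (m1 : {sigma_finite_measure set T1 -> \bar R})
    (m2 : {sigma_finite_measure set T2 -> \bar R})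
    (D1 : set T1) (D2 : set T2) (f : T1 * T2 -> R) :
    measurable D1 -> measurable D2 -> measurable_fun (D1 `*` D2) f ->
    (\int[m1]_(x in D1) \int[m2]_(y in D2) `|f (x, y)|%:E < +oo)%E ->
  [/\ m1.-integrable D1 (EFin \o fun x => \int[m2]_(y in D2) f (x, y)),
      m2.-integrable D2 (EFin \o fun y => \int[m1]_(x in D1) f (x, y)) &
      \int[m1]_(x in D1) \int[m2]_(y in D2) f (x, y) =
      \int[m2]_(y in D2) \int[m1]_(x in D1) f (x, y)].
Proof.
move=> mD1 mD2 mf foo.
have mD : measurable (D1 `*` D2) by exact: measurableX.
pose g := f \_ (D1 `*` D2).
have mg : measurable_fun setT g by apply/(measurable_restrictT _ _).1.
have gE x y : g (x, y) = ((fun x => ((fun y => f (x, y)) \_ D2) y) \_ D1) x.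
  rewrite /g !patchE in_setX /=; case: (x \in D1) => //=.
have g1 x : D1 x -> (fun y => g (x, y)) = (fun y => f (x, y)) \_ D2.
  by move=> xD; apply/funext => y; rewrite gE patchE mem_set.
have g2 y : D2 y -> (fun x => g (x, y)) = (fun x => f (x, y)) \_ D1.
  move=> yD; apply/funext => x; rewrite gE !patchE; case: ifP => // _.
  by rewrite mem_set.
have g1' x : ~ D1 x -> (fun y => g (x, y)) = cst 0.
  by move=> xD; apply/funext => y; rewrite gE patchE memNset.
have g2' y : ~ D2 y -> (fun x => g (x, y)) = cst 0.
  move=> yD; apply/funext => x; rewrite gE !patchE; case: ifP => // _.
  by rewrite memNset.
have ig : (m1 \x m2)%E.-integrable setT (EFin \o g).
  apply/integrable12ltyP; first exact/measurable_EFinP.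
  move: foo; rewrite integral_mkcond; congr (_ < _)%E.
  apply: eq_integral => x _; rewrite patchE; case: ifPn => [/set_mem|/negP] xD.
    rewrite integral_mkcond; apply: eq_integral => y _.
    have := congr1 (fun h => h y) (g1 _ xD); rewrite /= => ->.
    by rewrite !patchE; case: ifP => //=; rewrite normr0.
  rewrite (eq_integral (cst 0%E)) ?integral0// => y _.
  have := congr1 (fun h => h y) (g1' x (fun h => xD (mem_set h))).
  by rewrite /= => ->; rewrite normr0.
have FE : (fun x => \int[m2]_(y in D2) f (x, y)) \_ D1 =
          fun x => fine (\int[m2]_y (g (x, y))%:E).
  apply/funext => x; rewrite patchE; case: ifPn => [/set_mem|/negP] xD.
    rewrite Rintegral_mkcond; congr fine; apply: eq_integral => y _.
    by have := congr1 (fun h => h y) (g1 _ xD) => /= ->.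
  rewrite (eq_integral (cst 0%E)) ?integral0// => y _.
  by have := congr1 (fun h => h y) (g1' x (fun h => xD (mem_set h))) => /= ->.
have GE : (fun y => \int[m1]_(x in D1) f (x, y)) \_ D2 =
          fun y => fine (\int[m1]_x (g (x, y))%:E).
  apply/funext => y; rewrite patchE; case: ifPn => [/set_mem|/negP] yD.
    rewrite Rintegral_mkcond; congr fine; apply: eq_integral => x _.
    by have := congr1 (fun h => h x) (g2 _ yD) => /= ->.
  rewrite (eq_integral (cst 0%E)) ?integral0// => x _.
  by have := congr1 (fun h => h x) (g2' y (fun h => yD (mem_set h))) => /= ->.
have intfine d (T : measurableType d) (m : {measure set T -> \bar R}) F :
    m.-integrable setT F ->
    m.-integrable setT (EFin \o (fine \o F)) /\
    (\int[m]_x (fine (F x))%:E = \int[m]_x F x)%E.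
  move=> iF; have aeF := integrable_ae measurableT iF.
  have mF : measurable_fun setT (EFin \o (fine \o F)).
    apply/measurable_EFinP; apply: measurableT_comp => //.
    exact: measurable_int iF.
  have FF : ae_eq m setT F (EFin \o (fine \o F)).
    by apply: filterS aeF => x /= Fx _; rewrite fineK// Fx.
  split; last first.
    by apply/esym; apply: ae_eq_integral => //; exact: measurable_int iF.
  apply/integrableP; split => //.
  case/integrableP : (iF) => mF' ltF; apply: le_lt_trans ltF.
  apply: ae_ge0_le_integral => //.
  - exact: measurableT_comp.
  - exact: measurableT_comp.
  - by apply: filterS aeF => x /= /(_ I); case: (F x).
have [iF eF] := intfine _ _ _ _ (integrable_fubini_F ig).
have iG0 : m2.-integrable setT (fubini_G m1 (EFin \o g)).
  apply/integrableP; split; first exact: measurable_fubini_G ig.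
  have mg' : measurable_fun setT (EFin \o g) by exact/measurable_EFinP.
  have /(integrable21ltyP m1 m2 mg') := ig; apply: le_lt_trans.
  apply: ge0_le_integral => //.
  - by apply: measurableT_comp => //; exact: measurable_fubini_G ig.
  - apply: (measurable_fun_fubini_tonelli_G (abse \o (EFin \o g))) => //=.
    exact: measurableT_comp.
  - move=> y _; apply: le_abse_integral => //.
    exact: measurableT_comp.
have [iG eG] := intfine _ _ _ _ iG0.
split.
- by apply/(integrable_mkcond _ mD1); rewrite restrict_EFin FE.
- by apply/(integrable_mkcond _ mD2); rewrite restrict_EFin GE.
- rewrite Rintegral_mkcond FE [RHS]Rintegral_mkcond GE /Rintegral eF eG.
  by congr fine; exact: Fubini ig.
Qed.

Lemma measurable_inner_integral (R : realType) (d1 d2 : measure_display)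
    (T1 : measurableType d1) (T2 : measurableType d2)
    (m2 : {sigma_finite_measure set T2 -> \bar R})
    (D1 : set T1) (D2 : set T2) (f : T1 * T2 -> R) :
    measurable D1 -> measurable D2 -> measurable_fun (D1 `*` D2) f ->
    (forall z, 0 <= f z) ->
  measurable_fun D1 (fun x => \int[m2]_(y in D2) (f (x, y))%:E)%E.
Proof.
move=> mD1 mD2 mf f0.
have mD : measurable (D1 `*` D2) by exact: measurableX.
pose g := f \_ (D1 `*` D2).
have mg : measurable_fun setT g by apply/(measurable_restrictT _ _).1.
have g0 z : (0 <= (EFin \o g) z)%E.
  by rewrite /g /= patchE; case: ifP => // _; rewrite ?lee_fin.
apply: (@eq_measurable_fun _ _ _ _ _ (fubini_F m2 (EFin \o g))).
  move=> x /set_mem xD; rewrite /fubini_F [RHS]integral_mkcond.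
  apply: eq_integral => y _; rewrite /g /= !patchE in_setX/= (mem_set xD)/=.
  by case: ifP.
apply: measurable_funTS; apply: measurable_fun_fubini_tonelli_F => //.
exact/measurable_EFinP.
Qed.

Lemma measurable_fun_section (d1 d2 d3 : measure_display)
    (T1 : measurableType d1) (T2 : measurableType d2) (T3 : measurableType d3)
    (D1 : set T1) (D2 : set T2) (f : T1 * T2 -> T3) (x : T1) :
    measurable D1 -> measurable D2 -> measurable_fun (D1 `*` D2) f -> D1 x ->
  measurable_fun D2 (fun y => f (x, y)).
Proof.
move=> mD1 mD2 mf xD; apply: (measurable_comp (F := D1 `*` D2)) => //.
- exact: measurableX.
- by move=> _ [y yD <-].
- by apply: measurable_funTS; exact: pair1_measurable.
Qed.

Lemma measurable_fun_fst_setX (d1 d2 d3 : measure_display)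
    (T1 : measurableType d1) (T2 : measurableType d2) (T3 : measurableType d3)
    (D1 : set T1) (D2 : set T2) (f : T1 -> T3) :
    measurable D1 -> measurable D2 -> measurable_fun D1 f ->
  measurable_fun (D1 `*` D2) (fun z => f z.1).
Proof.
move=> mD1 mD2 mf; apply: (measurable_comp (F := D1)) => //.
- by move=> _ [z [zD _] <-].
- by apply: measurable_funTS; exact: measurable_fst.
Qed.

Lemma measurable_fun_snd_setX (d1 d2 d3 : measure_display)
    (T1 : measurableType d1) (T2 : measurableType d2) (T3 : measurableType d3)
    (D1 : set T1) (D2 : set T2) (f : T2 -> T3) :
    measurable D1 -> measurable D2 -> measurable_fun D2 f ->
  measurable_fun (D1 `*` D2) (fun z => f z.2).
Proof.
move=> mD1 mD2 mf; apply: (measurable_comp (F := D2)) => //.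
- by move=> _ [z [_ zD] <-].
- by apply: measurable_funTS; exact: measurable_snd.
Qed.

Lemma Rintegral_fubini_bound (R : realType) (d1 d2 : measure_display)
    (T1 : measurableType d1) (T2 : measurableType d2)
    (m1 : {sigma_finite_measure set T1 -> \bar R})
    (m2 : {sigma_finite_measure set T2 -> \bar R})
    (D1 : set T1) (D2 : set T2) (f : T1 * T2 -> R) (p : T1 -> R) (q : T2 -> R) :
    measurable D1 -> measurable D2 -> measurable_fun (D1 `*` D2) f ->
    (forall x y, D1 x -> D2 y -> `|f (x, y)| <= p x * q y) ->
    m1.-integrable D1 (EFin \o p) -> m2.-integrable D2 (EFin \o q) ->
  [/\ m1.-integrable D1 (EFin \o fun x => \int[m2]_(y in D2) f (x, y)),
      m2.-integrable D2 (EFin \o fun y => \int[m1]_(x in D1) f (x, y)) &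
      \int[m1]_(x in D1) \int[m2]_(y in D2) f (x, y) =
      \int[m2]_(y in D2) \int[m1]_(x in D1) f (x, y)].
Proof.
move=> mD1 mD2 mf fpq ip iq; apply: Rintegral_fubini => //.
have mf' : measurable_fun (D1 `*` D2) (fun z => `|f z|).
  exact: measurableT_comp.
set Q := (\int[m2]_(y in D2) `|(q y)%:E|)%E.
have Qoo : (Q < +oo)%E by case/integrableP : iq.
have Q0 : (0 <= Q)%E by exact: integral_ge0.
have Qfin : Q \is a fin_num by rewrite ge0_fin_numE.
have mp : measurable_fun D1 p by apply/measurable_EFinP; case/integrableP : ip.
have mq : measurable_fun D2 q by apply/measurable_EFinP; case/integrableP : iq.
apply: (@le_lt_trans _ _ (\int[m1]_(x in D1) (`|(p x)%:E| * Q))%E).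
  apply: ge0_le_integral => //.
  - by move=> x _; exact: integral_ge0.
  - exact: (@measurable_inner_integral _ _ _ _ _ m2 D1 D2 (fun z => `|f z|)).
  - rewrite -(fineK Qfin); apply/measurable_EFinP.
    by apply: measurable_funM => //; exact: measurableT_comp.
  - move=> x xD; rewrite /Q -ge0_integralZl//; last first.
      by apply/measurable_EFinP; exact: measurableT_comp.
    apply: ge0_le_integral => //.
    + apply/measurable_EFinP; apply: measurableT_comp => //.
      exact: measurable_fun_section mf xD.
    + by apply/measurable_EFinP; apply: measurable_funM => //; exact: measurableT_comp.
    + move=> y yD; rewrite lee_fin -normrM (le_trans (fpq _ _ xD yD))//.
      exact: ler_norm.
rewrite -(fineK Qfin) ge0_integralZr//.
- have ipn : (\int[m1]_(x in D1) `|(p x)%:E|)%E \is a fin_num.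
    rewrite ge0_fin_numE; first by case/integrableP : ip.
    exact: integral_ge0.
  by rewrite -(fineK ipn) -EFinM ltry.
- by apply/measurable_EFinP; exact: measurableT_comp.
- by rewrite lee_fin fine_ge0.
Qed.

Lemma is_derive_continuous (R : realType) (f : R -> R) (df : R -> R) :
  (forall x : R, is_derive x 1 f (df x)) -> continuous f.
Proof.
move=> fdf x; apply: differentiable_continuous; apply/derivable1_diffP.
by have [] := fdf x.
Qed.

Lemma FTC2_is_derive (R : realType) (f F : R -> R) (a b : R) :
    a <= b -> continuous f -> (forall x : R, is_derive x 1 F (f x)) ->
  \int[@lebesgue_measure R]_(x in `[a, b]) f x = F b - F a.
Proof.
rewrite le_eqVlt => /predU1P[<- _ _|ab cf dF].
  by rewrite set_itv1 Rintegral_set1 subrr.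
have cF := is_derive_continuous dF.
rewrite /Rintegral (@continuous_FTC2 _ f F)//.
- exact: continuous_subspaceT.
- split; first by move=> x _; have [] := dF x.
  + exact/cvg_at_right_filter/cF.
  + exact/cvg_at_left_filter/cF.
- by move=> x _; rewrite derive1E; have [] := dF x.
Qed.

Lemma continuous_itv_integrable (R : realType) (f : R -> R) (a b : R) :
  continuous f -> (@lebesgue_measure R).-integrable `[a, b] (EFin \o f).
Proof.
move=> cf; apply: continuous_compact_integrable; first exact: segment_compact.
exact: continuous_subspaceT.
Qed.

(** The sign condition gives integrability for free; functions of varying
    sign are treated by adding a multiple of an exponential. *)
Lemma FTC2y_is_derive (R : realType) (f F : R -> R) (a l : R) :
    (forall x, a <= x -> 0 <= f x) -> continuous f ->
    (forall x : R, is_derive x 1 F (f x)) -> F x @[x --> +oo] --> l ->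
  (@lebesgue_measure R).-integrable `[a, +oo[ (EFin \o f) /\
  \int[@lebesgue_measure R]_(x in `[a, +oo[) f x = l - F a.
Proof.
move=> f0 cf dF Fl; have cF := is_derive_continuous dF.
have intE : (\int[@lebesgue_measure R]_(x in `[a, +oo[) (f x)%:E =
             l%:E - (F a)%:E)%E.
  apply: ge0_continuous_FTC2y => //.
  - exact: continuous_subspaceT.
  - exact/cvg_at_right_filter/cF.
  - by move=> x _; rewrite derive1E; have [] := dF x.
split; last by rewrite /Rintegral intE.
apply/integrableP; split.
  apply/measurable_EFinP; apply: measurable_funTS.
  exact: continuous_measurable_fun.
suff : (\int[@lebesgue_measure R]_(x in `[a, +oo[) `|(EFin \o f) x| =
  l%:E - (F a)%:E)%E by move=> ->; rewrite -EFinB ltry.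
rewrite -intE; apply: eq_integral => x.
by rewrite inE/= in_itv/= andbT => ax; rewrite ger0_norm// f0.
Qed.

Lemma cvg_expR_Ny (R : realType) (c : R) : 0 < c ->
  expR (- (c * x)) @[x --> +oo] --> (0 : R).
Proof.
move=> c0; apply: (@cvg_comp _ _ _ (fun x => c * x) (fun x => expR (- x)) _ +oo).
  exact: gt0_cvgMry.
exact: cvgr_expR.
Qed.

Lemma is_derive_expRNM (R : realType) (c x : R) :
  is_derive x 1 (fun s => expR (- (c * s))) (- c * expR (- (c * x))).
Proof.
have : is_derive x 1 (fun s => - (c * s)) (- c).
  by apply: is_derive_eq; rewrite /GRing.scale /= mulr1.
move=> dg.
have := @is_derive1_comp R expR (fun s => - (c * s)) x _ _ (is_derive_expR _) dg.
by rewrite mulrC; exact.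
Qed.

Lemma is_derive_sinM (R : realType) (c x : R) :
  is_derive x 1 (fun s => sin (s * c)) (c * cos (x * c)).
Proof.
have : is_derive x 1 (fun s => s * c) c.
  by apply: is_derive_eq; rewrite /GRing.scale /= mulr1 mulr0 add0r.
move=> dg.
have := @is_derive1_comp R sin (fun s => s * c) x _ _ (is_derive_sin _) dg.
by rewrite mulrC; exact.
Qed.

Lemma is_derive_cosM (R : realType) (c x : R) :
  is_derive x 1 (fun s => cos (s * c)) (- c * sin (x * c)).
Proof.
have : is_derive x 1 (fun s => s * c) c.
  by apply: is_derive_eq; rewrite /GRing.scale /= mulr1 mulr0 add0r.
move=> dg.
have := @is_derive1_comp R cos (fun s => s * c) x _ _ (is_derive_cos _) dg.
by rewrite mulrC mulrN mulNr; exact.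
Qed.

Lemma continuous_expRNM (R : realType) (c : R) :
  continuous (fun s => expR (- (c * s))).
Proof. exact: is_derive_continuous (is_derive_expRNM c). Qed.

Lemma integral_expR_tail (R : realType) (c a : R) : 0 < c ->
  (@lebesgue_measure R).-integrable `[a, +oo[ (EFin \o fun s => expR (- (c * s))) /\
  \int[@lebesgue_measure R]_(s in `[a, +oo[) expR (- (c * s)) =
  c^-1 * expR (- (c * a)).
Proof.
move=> c0.
have /= [||||i ->] := @FTC2y_is_derive R (fun s => expR (- (c * s)))
    (fun s => - c^-1 * expR (- (c * s))) a 0.
- by move=> x _; exact: expR_ge0.
- exact: continuous_expRNM.
- move=> x; have h := is_derive_expRNM c x.
  by apply: is_derive_eq; rewrite /GRing.scale /= mulrA mulrNN mulVf ?gt_eqF// mul1r.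
- rewrite -(mulr0 (- c^-1)).
  by apply: cvgMr; exact: cvg_expR_Ny.
by split => //; rewrite sub0r mulNr opprK.
Qed.

Lemma integral_expR (R : realType) (c : R) : 0 < c ->
  (@lebesgue_measure R).-integrable `[0, +oo[ (EFin \o fun s => expR (- (c * s))) /\
  \int[@lebesgue_measure R]_(s in `[0, +oo[) expR (- (c * s)) = c^-1.
Proof.
by move=> /(integral_expR_tail 0); rewrite mulr0 oppr0 expR0 mulr1.
Qed.

Lemma measurable_invr (R : realType) : measurable_fun setT (@GRing.inv R).
Proof.
have D0 : measurable [set x : R | x != 0].
  by rewrite (_ : mkset _ = ~` [set 0])//; [exact: measurableC|
    apply/seteqP; split => x /= /eqP].
rewrite (_ : setT = [set x : R | x != 0] `|` [set 0]).
  apply/measurable_funU => //; split; last exact: measurable_fun_set1.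
  apply: open_continuous_measurable_fun; first exact: open_neq.
  by move=> x; rewrite inE /=; exact: inv_continuous.
by apply/seteqP; split => x //= _; case: (eqVneq x 0) => h; [right|left].
Qed.

Lemma Rintegral_dominated_cvg (R : realType) (d : measure_display)
    (T : measurableType d) (m : {measure set T -> \bar R}) (D : set T)
    (f_ : nat -> T -> R) (f g : T -> R) :
    measurable D -> (forall n, measurable_fun D (f_ n)) ->
    (forall x, D x -> f_ n x @[n --> \oo] --> f x) ->
    m.-integrable D (EFin \o g) ->
    (forall n x, D x -> `|f_ n x| <= g x) ->
  m.-integrable D (EFin \o f) /\
  \int[m]_(x in D) f_ n x @[n --> \oo] --> \int[m]_(x in D) f x.
Proof.
move=> mD mf_ f_f ig f_g.
have mf : measurable_fun D f by exact: measurable_fun_cvg f_f.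
have [||||i _ cv] := @dominated_convergence _ _ _ m D mD
  (fun n => EFin \o f_ n) (EFin \o f) (EFin \o g) _ _ _ ig.
- by move=> n; exact/measurable_EFinP.
- exact/measurable_EFinP.
- by apply: aeW => x Dx; apply: cvg_EFin; [exact: nearW|exact: f_f].
- by apply: aeW => x n Dx; rewrite lee_fin f_g.
split => //; apply: fine_cvg.
by rewrite fineK//; exact: integrable_fin_num.
Qed.

Lemma Rintegral_le_bound (R : realType) (d : measure_display)
    (T : measurableType d) (m : {measure set T -> \bar R}) (D : set T)
    (f g : T -> R) : measurable D -> measurable_fun D f ->
    m.-integrable D (EFin \o g) -> (forall x, D x -> `|f x| <= g x) ->
  m.-integrable D (EFin \o f) /\
  `|\int[m]_(x in D) f x| <= \int[m]_(x in D) g x.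
Proof.
move=> mD mf ig fg.
have if_ : m.-integrable D (EFin \o f).
  apply: le_integrable ig => //; first exact/measurable_EFinP.
  by move=> x Dx /=; rewrite lee_fin (le_trans (fg _ Dx))// ler_norm.
split => //; apply: le_trans (le_normr_Rintegral _ if_) _ => //.
by apply: le_Rintegral => //; exact: integrable_norm.
Qed.

Lemma integrable_scale (R : realType) (d : measure_display)
    (T : measurableType d) (m : {measure set T -> \bar R}) (D : set T)
    (k : R) (h : T -> R) : measurable D -> m.-integrable D (EFin \o h) ->
  m.-integrable D (EFin \o (fun x => k * h x)).
Proof. by move=> mD ih; apply: eq_integrable (integrableZl _ k ih). Qed.

Lemma integrable_add (R : realType) (d : measure_display)
    (T : measurableType d) (m : {measure set T -> \bar R}) (D : set T)
    (g h : T -> R) : measurable D -> m.-integrable D (EFin \o g) ->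
    m.-integrable D (EFin \o h) ->
  m.-integrable D (EFin \o (fun x => g x + h x)).
Proof.
move=> mD ig ih.
by apply: eq_integrable (integrableD mD ig ih) => // x _; rewrite /= EFinD.
Qed.

(** * Integrals of complex functions *)

Section complex_integral.
Context {R : realType} {d : measure_display} {T : measurableType d}.
Implicit Types (D : set T) (g : T -> R[i]).

Definition cmeasurable D g :=
  measurable_fun D (fun x => complex.Re (g x)) /\
  measurable_fun D (fun x => complex.Im (g x)).

Lemma cmeasurableM D g h :
  cmeasurable D g -> cmeasurable D h -> cmeasurable D (fun x => g x * h x).
Proof.
move=> [g1 g2] [h1 h2]; split.
- apply: (@eq_measurable_fun _ _ _ _ _ (fun x =>
    complex.Re (g x) * complex.Re (h x) - complex.Im (g x) * complex.Im (h x))).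
    by move=> x _; case: (g x) (h x) => ? ? [].
  by apply: measurable_funB; exact: measurable_funM.
- apply: (@eq_measurable_fun _ _ _ _ _ (fun x =>
    complex.Re (g x) * complex.Im (h x) + complex.Im (g x) * complex.Re (h x))).
    by move=> x _; case: (g x) (h x) => ? ? [].
  by apply: measurable_funD; exact: measurable_funM.
Qed.

Lemma cmeasurable_real D (h : T -> R) :
  measurable_fun D h -> cmeasurable D (fun x => (h x)%:C).
Proof. by move=> mh; split => //=; exact: measurable_cst. Qed.

Lemma cmeasurable_cexp D g : cmeasurable D g -> cmeasurable D (fun x => cexp (g x)).
Proof.
move=> [g1 g2]; split; rewrite /cexp /=; apply: measurable_funM.
- exact: measurableT_comp.
- by apply: measurableT_comp => //; exact: continuous_measurable_fun (@continuous_cos _).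
- exact: measurableT_comp.
- by apply: measurableT_comp => //; exact: continuous_measurable_fun (@continuous_sin _).
Qed.

End complex_integral.
Lemma cexpD (R : realType) (z w : R[i]) : cexp (z + w) = cexp z * cexp w.
Proof.
case: z w => a b [c e]; rewrite /cexp; simpc => /=.
by rewrite expRD cosD sinD; congr (_ +i* _); ring.
Qed.

Lemma cexp_real (R : realType) (x y : R) :
  cexp (- (x%:C * y%:C)) = (expR (- (x * y)))%:C.
Proof.
rewrite /cexp /= !(mulr0, mul0r) !addr0 !subr0 oppr0 cos0 sin0 mulr1 mulr0.
by [].
Qed.

Lemma normc_cexp (R : realType) (z : R[i]) :
  Normc.normc (cexp z) = expR (complex.Re z).
Proof.
rewrite /cexp /= !exprMn -mulrDr cos2Dsin2 mulr1 sqrtr_sqr.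
by rewrite ger0_norm// expR_ge0.
Qed.

Lemma normc_real (R : realType) (x : R) : Normc.normc (x%:C) = `|x|.
Proof. by rewrite /= expr0n /= addr0 sqrtr_sqr. Qed.

Lemma normc_Re (R : realType) (z : R[i]) : `|complex.Re z| <= Normc.normc z.
Proof.
case: z => a b /=; rewrite -sqrtr_sqr ler_wsqrtr// lerDl; exact: sqr_ge0.
Qed.

Lemma normc_Im (R : realType) (z : R[i]) : `|complex.Im z| <= Normc.normc z.
Proof.
case: z => a b /=; rewrite -[leLHS]sqrtr_sqr ler_wsqrtr// lerDr; exact: sqr_ge0.
Qed.

Lemma ReM_real (R : realType) (z : R[i]) (x : R) :
  complex.Re (z * x%:C) = complex.Re z * x.
Proof. by case: z => a b /=; rewrite mulr0 subr0. Qed.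

Lemma ImM_real (R : realType) (z : R[i]) (x : R) :
  complex.Im (z * x%:C) = complex.Im z * x.
Proof. by case: z => a b /=; rewrite mulr0 add0r. Qed.

Section complex_integral.
Context {R : realType} {d : measure_display} {T : measurableType d}.
Variable m : {measure set T -> \bar R}.
Implicit Types (D : set T) (g : T -> R[i]).

Lemma cintegrable_bound D g (h : T -> R) : measurable D -> cmeasurable D g ->
    m.-integrable D (EFin \o h) ->
    (forall x, D x -> Normc.normc (g x) <= h x) -> cintegrable m D g.
Proof.
move=> mD [mr mi] ih gh; split.
- have [|//] := @Rintegral_le_bound _ _ _ m D _ h mD mr ih.
  by move=> x Dx; apply: le_trans (normc_Re _) (gh _ Dx).
- have [|//] := @Rintegral_le_bound _ _ _ m D _ h mD mi ih.
  by move=> x Dx; apply: le_trans (normc_Im _) (gh _ Dx).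
Qed.

Lemma cintegrable_cmeasurable D g : cintegrable m D g -> cmeasurable D g.
Proof.
by move=> [/integrableP[/measurable_EFinP ? _] /integrableP[/measurable_EFinP ? _]].
Qed.

Lemma eq_cintegral D g h : (forall x, D x -> g x = h x) ->
  cintegral m D g = cintegral m D h.
Proof.
by move=> gh; congr (_ +i* _); apply: eq_Rintegral => x /set_mem Dx; rewrite gh.
Qed.

Lemma cintegralZl D g (c : R[i]) : measurable D -> cintegrable m D g ->
  cintegrable m D (fun x => c * g x) /\
  cintegral m D (fun x => c * g x) = c * cintegral m D g.
Proof.
move=> mD [i1 i2]; case: c => a b.
have E1 x : complex.Re ((a +i* b) * g x) =
    a * complex.Re (g x) - b * complex.Im (g x) by case: (g x).
have E2 x : complex.Im ((a +i* b) * g x) =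
    a * complex.Im (g x) + b * complex.Re (g x) by case: (g x).
have iZ k h : m.-integrable D (EFin \o h) -> m.-integrable D (fun x => (k * h x)%:E).
  by move=> ih; apply: eq_integrable (integrableZl _ k ih).
split; first split.
- by under eq_fun do rewrite E1 EFinB; apply: integrableB => //; exact: iZ.
- by under eq_fun do rewrite E2 EFinD; apply: integrableD => //; exact: iZ.
rewrite /cintegral; simpc; congr (_ +i* _).
- under eq_Rintegral do rewrite E1.
  by rewrite RintegralB//; [rewrite !RintegralZl|exact: iZ|exact: iZ].
- under eq_Rintegral do rewrite E2.
  by rewrite RintegralD//; [rewrite !RintegralZl|exact: iZ|exact: iZ].
Qed.

End complex_integral.

Lemma cintegral_fubini_bound (R : realType) (d1 d2 : measure_display)
    (T1 : measurableType d1) (T2 : measurableType d2)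
    (m1 : {sigma_finite_measure set T1 -> \bar R})
    (m2 : {sigma_finite_measure set T2 -> \bar R})
    (D1 : set T1) (D2 : set T2) (f : T1 * T2 -> R[i]) (p : T1 -> R) (q : T2 -> R) :
    measurable D1 -> measurable D2 -> cmeasurable (D1 `*` D2) f ->
    (forall x y, D1 x -> D2 y -> Normc.normc (f (x, y)) <= p x * q y) ->
    m1.-integrable D1 (EFin \o p) -> m2.-integrable D2 (EFin \o q) ->
  [/\ cintegrable m1 D1 (fun x => cintegral m2 D2 (fun y => f (x, y))),
      cintegrable m2 D2 (fun y => cintegral m1 D1 (fun x => f (x, y))) &
      cintegral m1 D1 (fun x => cintegral m2 D2 (fun y => f (x, y))) =
      cintegral m2 D2 (fun y => cintegral m1 D1 (fun x => f (x, y)))].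
Proof.
move=> mD1 mD2 [mr mi] fpq ip iq.
have [|r1 r2 r3] := Rintegral_fubini_bound mD1 mD2 mr _ ip iq.
  by move=> x y xD yD; apply: le_trans (normc_Re _) (fpq _ _ xD yD).
have [|i1 i2 i3] := Rintegral_fubini_bound mD1 mD2 mi _ ip iq.
  by move=> x y xD yD; apply: le_trans (normc_Im _) (fpq _ _ xD yD).
by split; [split|split|rewrite /cintegral /= r3 i3].
Qed.

(** * Abel means of the Dirichlet kernel *)

Lemma ler_id_expRM (R : realType) (c x : R) : 0 < c ->
  x * expR (- (c * x)) <= (2 / c) * expR (- (c / 2 * x)).
Proof.
move=> c0; have c20 : 0 < c / 2 by rewrite divr_gt0.
have -> : - (c * x) = - (c / 2 * x) + - (c / 2 * x) by field.
rewrite expRD mulrA ler_pM2r ?expR_gt0// expRN ler_pdivrMr ?expR_gt0//.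
rewrite -invf_div ler_pdivlMl// (le_trans _ (expR_ge1Dx _))// lerDr ler01 //.
Qed.

Lemma cvg_id_expRM (R : realType) (c : R) : 0 < c ->
  x * expR (- (c * x)) @[x --> +oo] --> (0 : R).
Proof.
move=> c0; apply: (@squeeze_cvgr _ _ _ _ (cst 0)
    (fun x => (2 / c) * expR (- (c / 2 * x)))).
- near=> x; rewrite ler_id_expRM// andbT mulr_ge0 ?expR_ge0//.
- exact: cvg_cst.
- rewrite -[X in _ --> X](mulr0 (2 / c)); apply: cvgMr.
  by apply: cvg_expR_Ny; rewrite divr_gt0.
Unshelve. all: by end_near. Qed.

Lemma integral_id_expRM (R : realType) (c : R) : 0 < c ->
  (@lebesgue_measure R).-integrable `[0, +oo[
    (EFin \o fun s => s * expR (- (c * s))) /\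
  \int[@lebesgue_measure R]_(s in `[0, +oo[) (s * expR (- (c * s))) = c^-1 ^+ 2.
Proof.
move=> c0.
have dF (x : R) : is_derive x 1
    (fun s => - (c^-1 * (s * expR (- (c * s)))) - c^-1 ^+ 2 * expR (- (c * s)))
    (x * expR (- (c * x))).
  have h := is_derive_expRNM c x.
  by apply: is_derive_eq; rewrite /GRing.scale /=; field; rewrite gt_eqF.
have df (x : R) : is_derive x 1 (fun s => s * expR (- (c * s)))
    (expR (- (c * x)) - x * (c * expR (- (c * x)))).
  have h := is_derive_expRNM c x.
  by apply: is_derive_eq; rewrite /GRing.scale /=; ring.
have [||i ->] := FTC2y_is_derive _ (is_derive_continuous df) dF (a := 0) (l := 0).
- by move=> x x0; rewrite mulr_ge0// expR_ge0.
- rewrite -[X in _ --> X](_ : - (c^-1 * 0) - c^-1 ^+ 2 * 0 = 0); last first.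
    by rewrite !mulr0 oppr0 addr0.
  apply: cvgB; last by apply: cvgMr; exact: cvg_expR_Ny.
  by apply: cvgN; apply: cvgMr; exact: cvg_id_expRM.
by split => //; rewrite !(mul0r, mulr0) oppr0 expR0 mulr1 !sub0r opprK.
Qed.

(** The integrand changes sign, so the antiderivative is taken of its sum with
    exp (- (c * s)), which is nonnegative. *)
Lemma integral_sin_expRM (R : realType) (c x : R) : 0 < c ->
  (@lebesgue_measure R).-integrable `[0, +oo[
    (EFin \o fun s => sin (s * x) * expR (- (c * s))) /\
  \int[@lebesgue_measure R]_(s in `[0, +oo[) (sin (s * x) * expR (- (c * s))) =
  x / (c ^+ 2 + x ^+ 2).
Proof.
move=> c0; have cx0 : 0 < c ^+ 2 + x ^+ 2.
  by rewrite ltr_wpDr ?sqr_ge0// exprn_gt0.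
pose f s : R := sin (s * x) * expR (- (c * s)).
pose e s : R := expR (- (c * s)).
pose F s : R := - (c^-1 * e s) -
  (c ^+ 2 + x ^+ 2)^-1 * ((c * sin (s * x) + x * cos (s * x)) * e s).
have dF (s : R) : is_derive s 1 F (f s + e s).
  have h := is_derive_expRNM c s; have h1 := is_derive_sinM x s.
  have h2 := is_derive_cosM x s.
  rewrite /F /e; apply: is_derive_eq; rewrite /GRing.scale /= /f /e; field.
  by rewrite !gt_eqF.
have df (s : R) : is_derive s 1 (f + e)%R
    (x * cos (s * x) * e s - c * sin (s * x) * e s - c * e s).
  have h := is_derive_expRNM c s; have h1 := is_derive_sinM x s.
  rewrite /f /e; apply: is_derive_eq; rewrite /GRing.scale /=; ring.
have [||i fe] := FTC2y_is_derive _ (is_derive_continuous df) dF (a := 0) (l := 0).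
- move=> s _; rewrite /f /e /= fctE -[X in _ + X]mul1r -mulrDl mulr_ge0 ?expR_ge0//.
- rewrite -[X in _ --> X](_ : - (c^-1 * 0) - (c ^+ 2 + x ^+ 2)^-1 * 0 = 0); last first.
    by rewrite !mulr0 oppr0 addr0.
  have ce : e s @[s --> +oo] --> 0 by exact: cvg_expR_Ny.
  apply: cvgB; first by apply: cvgN; exact: cvgMr.
  apply: cvgMr; apply: (@squeeze_cvgr _ _ _ _
    (fun s => - ((c + `|x|) * e s)) (fun s => (c + `|x|) * e s)).
  + near=> s; rewrite -ler_norml normrM [X in _ * X]ger0_norm ?expR_ge0//.
    rewrite ler_wpM2r ?expR_ge0// (le_trans (ler_normD _ _))// !normrM.
    rewrite (gtr0_norm c0) lerD//.
      by rewrite ler_piMr ?(ltW c0)// ler_norml sin_geN1 sin_le1.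
    by rewrite ler_piMr// ler_norml cos_geN1 cos_le1.
  + by rewrite -[X in _ --> X]oppr0 -(mulr0 (c + `|x|)); apply: cvgN; exact: cvgMr.
  + by rewrite -(mulr0 (c + `|x|)); exact: cvgMr.
have [ie eE] := integral_expR c0.
have fE : EFin \o f = ((EFin \o (f + e)%R) \- (EFin \o e))%E.
  by apply/funext => s /=; rewrite -EFinB fctE addrK.
have if_ : (@lebesgue_measure R).-integrable `[0, +oo[ (EFin \o f).
  by rewrite fE; exact: integrableB.
split => //.
have -> : \int[@lebesgue_measure R]_(s in `[0, +oo[) f s =
          \int[@lebesgue_measure R]_(s in `[0, +oo[) ((f + e)%R s - e s).
  by apply: eq_Rintegral => s _; rewrite fctE addrK.
rewrite RintegralB// fe eE /F /e !(mul0r, mulr0) oppr0 expR0 sin0 cos0.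
by field; rewrite !gt_eqF.
Unshelve. all: by end_near. Qed.

(** The Dirichlet kernel, the integral of exp (i z x) over z in [- r, r]; see
    dirichletE. *)
Definition dirichlet (R : realType) (r x : R) : R :=
  if x == 0 then 2 * r else 2 * sin (r * x) * x^-1.

Lemma cexp_im (R : realType) (y : R) : cexp (0 +i* y) = cos y +i* sin y.
Proof. by rewrite /cexp /= expR0 !mul1r. Qed.

Lemma continuous_cosM (R : realType) (x : R) : continuous (fun z : R => cos (z * x)).
Proof. exact: is_derive_continuous (is_derive_cosM x). Qed.

Lemma continuous_sinM (R : realType) (x : R) : continuous (fun z : R => sin (z * x)).
Proof. exact: is_derive_continuous (is_derive_sinM x). Qed.

Lemma dirichletE (R : realType) (r x : R) : 0 <= r ->
  cintegral (@lebesgue_measure R) `[- r, r] (fun z => cexp (0 +i* (z * x))) =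
  (dirichlet r x)%:C.
Proof.
move=> r0; have rr : - r <= r by rewrite (le_trans _ r0)// oppr_le0.
rewrite /cintegral /dirichlet; under eq_Rintegral do rewrite cexp_im /=.
under [X in _ +i* X]eq_Rintegral do rewrite cexp_im /=.
have cs := @continuous_sinM R x.
case: eqVneq => [->|x0].
  under eq_Rintegral do rewrite mulr0 cos0.
  under [X in _ +i* X]eq_Rintegral do rewrite mulr0 sin0.
  rewrite (@FTC2_is_derive R (fun=> 1) id)//; last by move=> ?; exact: cst_continuous.
  rewrite Rintegral_cst// mul0r; congr (_ +i* _); ring.
have dS (z : R) : is_derive z 1 (fun z => x^-1 * sin (z * x)) (cos (z * x)).
  have h := is_derive_sinM x z.
  by apply: is_derive_eq; rewrite /GRing.scale /=; field.
have dC (z : R) : is_derive z 1 (fun z => - (x^-1 * cos (z * x))) (sin (z * x)).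
  have h := is_derive_cosM x z.
  by apply: is_derive_eq; rewrite /GRing.scale /=; field.
rewrite (FTC2_is_derive rr _ dS); last exact: continuous_cosM.
rewrite (FTC2_is_derive rr _ dC)// mulNr sinN cosN.
by congr (_ +i* _); field.
Qed.

Lemma dirichlet_le (R : realType) (r x : R) : 0 <= r -> `|dirichlet r x| <= 2 * r.
Proof.
move=> r0; have rr : - r <= r by rewrite (le_trans _ r0)// oppr_le0.
have /(congr1 (@complex.Re R)) /= <- := dirichletE x r0.
have ic : (@lebesgue_measure R).-integrable `[- r, r] (EFin \o fun=> 1).
  by apply: continuous_itv_integrable => ?; exact: cst_continuous.
have -> : 2 * r = \int[@lebesgue_measure R]_(z in `[- r, r]) 1.
  rewrite (@FTC2_is_derive R (fun=> 1) id)//; last by move=> ?; exact: cst_continuous.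
  by rewrite opprK mulr_natl.
apply: (Rintegral_le_bound _ _ ic _).2 => //.
- apply: measurable_funTS; apply: measurable_funM => //.
  exact: (continuous_measurable_fun (@continuous_cosM R x)).
- by move=> z _; rewrite expR0 mul1r ler_norml cos_geN1 cos_le1.
Qed.

Lemma dirichlet_measurable (R : realType) :
  measurable_fun setT (fun p : R * R => dirichlet p.1 p.2).
Proof.
apply: measurable_fun_ifT.
- by apply: measurable_fun_eqr; [exact: measurable_snd|exact: measurable_cst].
- by apply: measurable_funM; [exact: measurable_cst|exact: measurable_fst].
- apply: measurable_funM; last first.
    by apply: measurableT_comp; [exact: measurable_invr|exact: measurable_snd].
  apply: measurable_funM; first exact: measurable_cst.
  apply: measurableT_comp; first exact: continuous_measurable_fun (@continuous_sin _).
  by apply: measurable_funM; [exact: measurable_fst|exact: measurable_snd].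
Qed.

(** The Abel mean of the Dirichlet kernel is the Poisson kernel of the
    half-plane. It is integrable, unlike the kernel itself, and so defines an
    approximate identity. *)
Lemma dirichlet_abel (R : realType) (c x : R) : 0 < c ->
  (@lebesgue_measure R).-integrable `[0, +oo[
    (EFin \o fun r => c * expR (- (c * r)) * dirichlet r x) /\
  \int[@lebesgue_measure R]_(r in `[0, +oo[) (c * expR (- (c * r)) * dirichlet r x) =
  2 * c / (c ^+ 2 + x ^+ 2).
Proof.
move=> c0; rewrite /dirichlet; case: eqVneq => [->|x0].
  have [i e] := integral_id_expRM c0.
  have E r : c * expR (- (c * r)) * (2 * r) = 2 * c * (r * expR (- (c * r))) by ring.
  split.
    by rewrite (funext E); exact: integrable_scale.
  under eq_Rintegral do rewrite E.
  by rewrite RintegralZl// e; field; rewrite gt_eqF.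
have [i e] := integral_sin_expRM x c0.
have E r : c * expR (- (c * r)) * (2 * sin (r * x) / x) =
  2 * c / x * (sin (r * x) * expR (- (c * r))) by field.
split.
  by rewrite (funext E); exact: integrable_scale.
under eq_Rintegral do rewrite E.
rewrite RintegralZl// e; field; rewrite x0 gt_eqF//.
by rewrite ltr_wpDr ?sqr_ge0// exprn_gt0.
Qed.

(** Abel summation is regular: the weights c exp (- (c r)) have total mass 1
    and, as c tends to 0, put less and less of it on bounded sets of r. *)
Lemma abel_mean (R : realType) (J : R -> R) (B l : R) :
    measurable_fun (`[0, +oo[ : set R) J -> (forall r : R, 0 <= r -> `|J r| <= B * r) ->
    J r @[r --> +oo] --> l ->
  forall eta : R, 0 < eta -> exists2 c1 : R, 0 < c1 & forall c : R, 0 < c -> c < c1 ->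
    `|\int[@lebesgue_measure R]_(r in `[0, +oo[) (c * expR (- (c * r)) * J r) - l|
    <= eta.
Proof.
move=> mJ JB Jl eta eta0.
have eta20 : 0 < eta / 2 by rewrite divr_gt0.
have B0 : 0 <= B by have := JB 1 ler01; rewrite mulr1; apply: le_trans.
have [r0 [r0real rP]] : \forall r \near +oo, `|l - J r| < eta / 2.
  by have /cvgrPdist_lt/(_ _ eta20) := Jl.
have r0' : 0 <= Num.max r0 0 by rewrite le_max lexx orbT.
set r1 := Num.max r0 0 in r0'.
pose C := B * r1 + `|l|.
have C0 : 0 <= C by rewrite addr_ge0 ?mulr_ge0.
have JC r : 0 <= r -> `|J r - l| <= eta / 2 + C * (expR r1 * expR (- (1 * r))).
  move=> rge0; have [rr|rr] := leP r r1.
    rewrite -[leLHS]add0r lerD ?(ltW eta20)//.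
    apply: (@le_trans _ _ C).
      rewrite (le_trans (ler_normB _ _))// lerD// (le_trans (JB _ rge0))//.
      by rewrite ler_wpM2l.
    by rewrite ler_peMr// -expRD mul1r -expR0 ler_expR subr_ge0.
  rewrite distrC -[leLHS]addr0 lerD//; last by rewrite !mulr_ge0 ?expR_ge0.
  by apply/ltW/rP; rewrite (le_lt_trans _ rr)// /r1 le_max lexx.
have CE : 0 < C * expR r1 + 1 by rewrite ltr_pwDr// mulr_ge0// expR_ge0.
exists (eta / 2 / (C * expR r1 + 1)); first by rewrite divr_gt0.
move=> c c0 cc1.
have [ic ec] := integral_expR c0.
have [i1 e1] := @integral_expR R 1 ltr01.
pose G r : R := (eta / 2 * c) * expR (- (c * r)) + (c * (C * expR r1)) * expR (- (1 * r)).
have iZ (k : R) h : (@lebesgue_measure R).-integrable `[0, +oo[ (EFin \o h) ->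
    (@lebesgue_measure R).-integrable `[0, +oo[ (fun x => (k * h x)%:E).
  by move=> ih; apply: eq_integrable (integrableZl _ k ih).
have iG : (@lebesgue_measure R).-integrable `[0, +oo[ (EFin \o G).
  rewrite /G (_ : _ \o _ = (fun r => ((eta / 2 * c) * expR (- (c * r)))%:E +
    ((c * (C * expR r1)) * expR (- (1 * r)))%:E)%E)//.
  by apply: integrableD => //; exact: iZ.
have mh (h : R -> R) : measurable_fun (`[0, +oo[ : set R) h ->
    measurable_fun (`[0, +oo[ : set R) (fun r => c * expR (- (c * r)) * h r).
  move=> mh; apply: measurable_funM => //; apply: measurable_funM => //.
  apply: measurable_funTS.
  exact: (continuous_measurable_fun (@continuous_expRNM R c)).
have [|||id le_d] := @Rintegral_le_bound _ _ _ (@lebesgue_measure R) `[0%R, +oo[%classic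
    (fun r => c * expR (- (c * r)) * (J r - l)) G _ _ iG.
- by [].
- by apply: mh; exact: measurable_funB.
- move=> r /=; rewrite in_itv/= andbT => rge0.
  rewrite normrM ger0_norm ?mulr_ge0 ?expR_ge0 ?(ltW c0)//.
  apply: (@le_trans _ _ (c * expR (- (c * r)) *
     (eta / 2 + C * (expR r1 * expR (- (1 * r)))))).
    by rewrite ler_wpM2l ?JC// mulr_ge0 ?expR_ge0 ?(ltW c0).
  rewrite mulrDr /G lerD//; first by rewrite mulrC mulrA.
  rewrite -!mulrA ler_wpM2l ?(ltW c0)// ler_piMl ?mulr_ge0 ?expR_ge0//.
  by rewrite -expR0 ler_expR oppr_le0 mulr_ge0 ?(ltW c0).
have -> : \int[@lebesgue_measure R]_(r in `[0, +oo[) (c * expR (- (c * r)) * J r) =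
    \int[@lebesgue_measure R]_(r in `[0, +oo[) (c * expR (- (c * r)) * (J r - l)) + l.
  have {2}->: l = \int[@lebesgue_measure R]_(r in `[0, +oo[) (l * c * expR (- (c * r))).
    by rewrite RintegralZl// ec; field; rewrite gt_eqF.
  rewrite -RintegralD//; last exact: iZ.
  by apply: eq_Rintegral => r _; ring.
rewrite addrK; apply: (le_trans le_d); rewrite /G RintegralD//; [|exact: iZ|exact: iZ].
rewrite !RintegralZl// ec e1 invr1 mulr1.
rewrite [X in X + _](_ : _ = eta / 2); last by field; rewrite gt_eqF.
rewrite [leRHS](splitr eta) lerD2l.
have := ltW cc1; rewrite ler_pdivlMr//; apply: le_trans.
by rewrite ler_pM2l// lerDl.
Qed.

Lemma integral_poisson (R : realType) (c t : R) : 0 < c ->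
  (@lebesgue_measure R).-integrable `[0, +oo[
    (EFin \o fun s => 2 * c / (c ^+ 2 + (t - s) ^+ 2)) /\
  \int[@lebesgue_measure R]_(s in `[0, +oo[) (2 * c / (c ^+ 2 + (t - s) ^+ 2)) =
  pi + 2 * atan (t / c).
Proof.
move=> c0.
have cx0 (s : R) : 0 < c ^+ 2 + (t - s) ^+ 2.
  by rewrite ltr_wpDr ?sqr_ge0// exprn_gt0.
have dat (x : R) : is_derive x 1 (@atan R) (1 + x ^+ 2)^-1.
  by apply: DeriveDef; [exact: derivable_atan|rewrite -derive1E derive1_atan].
have dF (s : R) : is_derive s 1 (fun s => 2 * atan ((s - t) / c))
    (2 * c / (c ^+ 2 + (t - s) ^+ 2)).
  have dg : is_derive s 1 (fun s => (s - t) / c) (c^-1).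
    by apply: is_derive_eq; rewrite /GRing.scale /=; ring.
  have h := @is_derive1_comp R (@atan R) (fun s => (s - t) / c) s _ _ (dat _) dg.
  apply: is_derive_eq; rewrite /GRing.scale /=.
  have := cx0 s; have : 0 < c ^+ 2 + (s - t) ^+ 2.
    by have := cx0 s; rewrite -(sqrrN (t - s)) opprB.
  by move=> h1 h2; field; rewrite !gt_eqF.
have cf : continuous (fun s : R => 2 * c / (c ^+ 2 + (t - s) ^+ 2) : R).
  move=> s; apply: cvgM; first exact: cvg_cst.
  apply: cvgV; first by rewrite gt_eqF.
  apply: cvgD; first exact: cvg_cst.
  apply: (@cvg_comp _ _ _ (fun s : R => t - s) (fun x : R => x ^+ 2)).
    by apply: cvgB; [exact: cvg_cst|exact: cvg_id].
  exact: exprn_continuous.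
have [||i ->] := FTC2y_is_derive _ cf dF (a := 0) (l := 2 * (pi / 2)).
- by move=> s _; rewrite divr_ge0 ?(ltW (cx0 _))// mulr_ge0// ltW.
- apply: cvgMr; apply: (@cvg_comp _ _ _ (fun s => (s - t) / c) (@atan R) _ +oo);
    last exact: cvgy_atan.
  apply/cvgryPge => A; near=> s; rewrite ler_pdivlMr// lerBrDr.
  by near: s; apply: nbhs_pinfty_ge; rewrite num_real.
by split => //; rewrite sub0r mulNr atanN; field.
Unshelve. all: by end_near. Qed.

(** * Fourier inversion on the half-line *)

(** Near t the function is close to g t by continuity and the kernel has mass
    close to 2 pi, because t > 0 is interior to the half-line. At distance at
    least del from t the kernel is at most 2 c / del ^ 2, and it is also at most
    a multiple of c times the kernel of parameter 1, which controls the constant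
    g t. *)
Lemma poisson_mean (R : realType) (g : R -> R) (t : R) :
    (@lebesgue_measure R).-integrable `[0, +oo[ (EFin \o g) -> 0 < t ->
    {for t, continuous g} ->
  forall eta : R, 0 < eta -> exists2 c1 : R, 0 < c1 & forall c : R, 0 < c -> c < c1 ->
    `|\int[@lebesgue_measure R]_(s in `[0, +oo[)
        (g s * (2 * c / (c ^+ 2 + (t - s) ^+ 2))) - 2 * pi * g t| <= eta.
Proof.
move=> ig t0 gt eta eta0.
pose K (c s : R) : R := 2 * c / (c ^+ 2 + (t - s) ^+ 2).
have pi0 : 0 < pi :> R by exact: pi_gt0.
pose S : R := 2 * pi.
have S0 : 0 < S by rewrite mulr_gt0.
have K0 (c s : R) : 0 < c -> 0 <= K c s.
  by move=> c0; rewrite divr_ge0 ?mulr_ge0 ?(ltW c0)// addr_ge0 ?sqr_ge0.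
have iK (c : R) : 0 < c -> (@lebesgue_measure R).-integrable `[0, +oo[ (EFin \o K c).
  by move=> c0; exact: (integral_poisson t c0).1.
have eK (c : R) : 0 < c ->
    \int[@lebesgue_measure R]_(s in `[0, +oo[) K c s = pi + 2 * atan (t / c).
  by move=> c0; exact: (integral_poisson t c0).2.
have eKS (c : R) : 0 < c -> \int[@lebesgue_measure R]_(s in `[0, +oo[) K c s <= S.
  by move=> c0; have := atan_ltpi2 (t / c); rewrite eK// /S; lra.
have eta1 : 0 < eta / (4 * S) by rewrite divr_gt0// mulr_gt0.
have [del /= del0 gdel] : \forall s \near t, `|g t - g s| < eta / (4 * S).
  by have /cvgrPdist_lt/(_ _ eta1) := gt.
pose G := \int[@lebesgue_measure R]_(s in `[0, +oo[) `|g s|.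
have G0 : 0 <= G by exact: Rintegral_ge0.
pose M := 2 / del ^+ 2 * G + `|g t| * (1 + del ^- 2) * S.
have del2 : 0 < del ^+ 2 by exact: exprn_gt0.
have d1 : 0 <= 1 + del ^- 2 by rewrite addr_ge0// invr_ge0 ltW.
have d2 : 0 <= 2 / del ^+ 2 by rewrite divr_ge0// ltW.
have M0 : 0 <= M.
  by rewrite addr_ge0//; [exact: mulr_ge0|rewrite !mulr_ge0// ltW].
have eta2 : 0 < eta / (4 * (`|g t| + 1)).
  by rewrite divr_gt0// mulr_gt0// ltr_wpDl.
have [Y [Yreal YP]] : \forall y \near +oo, `|pi / 2 - atan y| < eta / (4 * (`|g t| + 1)).
  by have /cvgrPdist_lt/(_ _ eta2) := @cvgy_atan R.
pose Y1 := Num.max Y 0 + 1.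
have Y10 : 0 < Y1 by rewrite ltr_wpDl// le_max lexx orbT.
have M10 : 0 < 4 * (M + 1) by rewrite mulr_gt0// ltr_wpDl.
(* The first bound makes c M small, the second makes atan (t / c) close to pi / 2. *)
exists (Num.min (eta / (4 * (M + 1))) (t / Y1)).
  by rewrite lt_min !divr_gt0.
move=> c c0; rewrite lt_min => /andP[cM cY].
have cd0 : 0 <= 2 * c / del ^+ 2 by rewrite !mulr_ge0 ?invr_ge0 ?ltW.
have cd1 : 0 <= c * (1 + del ^- 2) by rewrite mulr_ge0// ltW.
pose B s : R := eta / (4 * S) * K c s +
  (2 * c / del ^+ 2 * `|g s| + `|g t| * (c * (1 + del ^- 2)) * K 1 s).
have mg : measurable_fun (`[0, +oo[ : set R) g.
  by apply/measurable_EFinP; exact: measurable_int ig.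
have mK : measurable_fun (`[0, +oo[ : set R) (K c).
  by apply/measurable_EFinP; exact: measurable_int (iK c c0).
have in_ : (@lebesgue_measure R).-integrable `[0, +oo[ (EFin \o (fun s => `|g s|)).
  exact: integrable_norm.
have iB1 : (@lebesgue_measure R).-integrable `[0, +oo[ (EFin \o fun s =>
    2 * c / del ^+ 2 * `|g s| + `|g t| * (c * (1 + del ^- 2)) * K 1 s).
  apply: integrable_add => //.
    exact: integrable_scale.
  by apply: integrable_scale => //; exact: iK.
have iB0 : (@lebesgue_measure R).-integrable `[0, +oo[
    (EFin \o fun s => eta / (4 * S) * K c s).
  by apply: integrable_scale => //; exact: iK.
have iB : (@lebesgue_measure R).-integrable `[0, +oo[ (EFin \o B).
  exact: integrable_add.
have [|||id le_d] := @Rintegral_le_bound _ _ _ (@lebesgue_measure R) `[0%R, +oo[%classic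
    (fun s => (g s - g t) * K c s) B _ _ iB.
- by [].
- by apply: measurable_funM => //; exact: measurable_funB.
- move=> s _; rewrite normrM (ger0_norm (K0 _ _ c0)).
  have [st|st] := ltP `|t - s| del.
    rewrite -[leLHS]addr0 lerD//.
      by rewrite ler_wpM2r ?K0// distrC ltW// gdel.
    by apply: addr_ge0; [exact: mulr_ge0|apply: mulr_ge0; [exact: mulr_ge0|exact: K0]].
  rewrite -[leLHS]add0r lerD//; first by rewrite mulr_ge0 ?K0// ltW.
  have ds : del ^+ 2 <= (t - s) ^+ 2.
    by rewrite -[leRHS]real_normK ?num_real// lerXn2r// nnegrE ltW.
  have ts0 : 0 < (t - s) ^+ 2 by apply: lt_le_trans ds.
  (* Away from t: Kle1 serves the term with g s, Kle2 the constant term g t. *)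
  have Kle1 : K c s <= 2 * c / del ^+ 2.
    rewrite ler_pM2l ?mulr_gt0// lef_pV2 ?posrE//.
      by rewrite (le_trans ds)// lerDr sqr_ge0.
    by rewrite ltr_wpDl ?sqr_ge0.
  have Kle2 : K c s <= c * (1 + del ^- 2) * K 1 s.
    rewrite /K; set x := (t - s) ^+ 2 in ds ts0 *.
    have x1 : 0 < 1 + x by rewrite ltr_wpDr// ltW.
    have hx : x^-1 <= (1 + del ^- 2) / (1 + x).
      rewrite ler_pdivlMr// mulrC ler_pdivrMr// mulrDl mul1r addrC lerD2l.
      by rewrite mulrC ler_pdivlMr// mul1r.
    have -> : c * (1 + del ^- 2) * (2 * 1 / (1 ^+ 2 + x)) =
      2 * c * ((1 + del ^- 2) / (1 + x)) by rewrite expr1n; ring.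
    rewrite ler_pM2l ?mulr_gt0// (le_trans _ hx)// lef_pV2 ?posrE//.
      by rewrite lerDr sqr_ge0.
    by rewrite ltr_wpDl ?sqr_ge0.
  rewrite (le_trans (ler_wpM2r (K0 _ _ c0) (ler_normB _ _)))// mulrDl lerD//.
    by rewrite mulrC ler_wpM2r.
  by rewrite -mulrA ler_wpM2l.
have cK : \int[@lebesgue_measure R]_(s in `[0, +oo[) (g t * K c s) = g t * (pi + 2 * atan (t / c)).
  by rewrite RintegralZl ?eK//; exact: iK.
have -> : \int[@lebesgue_measure R]_(s in `[0, +oo[) (g s * K c s) =
  \int[@lebesgue_measure R]_(s in `[0, +oo[) ((g s - g t) * K c s) +
  g t * (pi + 2 * atan (t / c)).
  rewrite -cK -RintegralD//; last by apply: integrable_scale => //; exact: iK.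
  by apply: eq_Rintegral => s _; ring.
have -> a : a + g t * (pi + 2 * atan (t / c)) - 2 * pi * g t =
    a - 2 * g t * (pi / 2 - atan (t / c)) by field.
rewrite (le_trans (ler_normB _ _))//.
have -> : eta = (eta / 4 + eta / 4) + eta / 2 by field.
rewrite lerD//.
  apply: le_trans le_d _; rewrite RintegralD// RintegralZl ?iK//.
  rewrite RintegralD//; last 2 first.
    exact: integrable_scale.
    by apply: integrable_scale => //; exact: iK.
  rewrite (RintegralZl _ _ in_)// (RintegralZl _ _ (iK _ ltr01))//; apply: lerD.
    rewrite (@le_trans _ _ (eta / (4 * S) * S))//.
      by rewrite ler_wpM2l ?eKS// ltW.
    by rewrite le_eqVlt; apply/orP; left; apply/eqP; field; rewrite gt_eqF.
  apply: (@le_trans _ _ (c * M)).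
    have -> : c * M = 2 * c / del ^+ 2 * G + `|g t| * (c * (1 + del ^- 2)) * S.
      by rewrite /M; ring.
    by apply: lerD => //; apply: ler_wpM2l; [exact: mulr_ge0|exact: eKS].
  rewrite (le_trans (_ : _ <= c * (M + 1)))//.
    by rewrite ler_pM2l// lerDl.
  by have := ltW cM; rewrite ler_pdivlMr//; lra.
have /YP yP : Y < t / c.
  rewrite (@lt_trans _ _ Y1)//.
    by rewrite /Y1 (@le_lt_trans _ _ (Num.max Y 0)) ?ltrDl// le_max lexx.
  by rewrite ltr_pdivlMr// mulrC -ltr_pdivlMr.
rewrite normrM normrM ger0_norm//.
rewrite (@le_trans _ _ (2 * (`|g t| + 1) * (eta / (4 * (`|g t| + 1)))))//.
  by apply: ler_pM => //; [rewrite ler_wpM2l// lerDl|exact: ltW].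
by rewrite le_eqVlt; apply/orP; left; apply/eqP; field; rewrite gt_eqF// ltr_wpDl.
Qed.

(** Fourier inversion at a point of continuity, for g merely integrable. The
    existence of the limit is a hypothesis; its value is found by taking Abel
    means in r. By Fubini these are the Poisson means of g, which tend to
    2 pi g t, while Abel means of a convergent function tend to its limit. *)
Lemma dirichlet_inversion (R : realType) (g : R -> R) (t l : R) :
    (@lebesgue_measure R).-integrable `[0, +oo[ (EFin \o g) -> 0 < t ->
    {for t, continuous g} ->
    \int[@lebesgue_measure R]_(s in `[0, +oo[) (g s * dirichlet r (t - s))
      @[r --> +oo] --> l ->
  l = 2 * pi * g t.
Proof.
move=> ig t0 gt Jl.
set J := (X in X @ _ --> _) in Jl.
pose D : set R := `[0, +oo[%classic.
have mD : measurable D by exact: measurable_itv.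
have mg : measurable_fun D g by apply/measurable_EFinP; exact: measurable_int ig.
have ing : (@lebesgue_measure R).-integrable D (EFin \o (fun s => `|g s|)).
  exact: integrable_norm.
pose G := \int[@lebesgue_measure R]_(s in `[0, +oo[) `|g s|.
have md : measurable_fun setT (fun p : R * R => dirichlet p.1 (t - p.2)).
  have mp : measurable_fun setT (fun p : R * R => (p.1, t - p.2)).
    apply: measurable_fun_pair; first exact: measurable_fst.
    by apply: measurable_funB; [exact: measurable_cst|exact: measurable_snd].
  exact: (measurableT_comp (@dirichlet_measurable R) mp).
have mgd : measurable_fun (D `*` D) (fun p : R * R => g p.2 * dirichlet p.1 (t - p.2)).
  apply: measurable_funM; last exact: measurable_funTS.
  exact: measurable_fun_snd_setX.
have mgd1 r : D r -> measurable_fun D (fun s => g s * dirichlet r (t - s)).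
  by move=> rD; exact: (measurable_fun_section mD mD mgd rD).
have Db r s : D r -> `|g s * dirichlet r (t - s)| <= (2 * r) * `|g s|.
  rewrite /D /= in_itv/= andbT => r0.
  by rewrite normrM mulrC ler_wpM2r// dirichlet_le.
have iJ r : D r -> (@lebesgue_measure R).-integrable D
    (EFin \o (fun s => g s * dirichlet r (t - s))) /\ `|J r| <= 2 * G * r.
  move=> rD; rewrite mulrAC -(RintegralZl _ _ ing)//.
  apply: Rintegral_le_bound => //; first exact: mgd1.
    exact: integrable_scale.
  by move=> s _; exact: Db.
have FJ (c : R) : 0 < c ->
    (@lebesgue_measure R).-integrable D
      (EFin \o (fun r => c * expR (- (c * r)) * J r)) /\
    \int[@lebesgue_measure R]_(r in `[0, +oo[) (c * expR (- (c * r)) * J r) =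
    \int[@lebesgue_measure R]_(s in `[0, +oo[)
      (g s * (2 * c / (c ^+ 2 + (t - s) ^+ 2))).
  move=> c0; have [ii _] := integral_id_expRM c0.
  have [||||i1 _] := @Rintegral_fubini_bound R _ _ _ _ (@lebesgue_measure R)
      (@lebesgue_measure R) D D
      (fun p => c * expR (- (c * p.1)) * (g p.2 * dirichlet p.1 (t - p.2)))
      (fun r => (2 * c) * (r * expR (- (c * r)))) (fun s => `|g s|) mD mD.
  - apply: measurable_funM => //; apply: measurable_funM => //.
    apply: (@measurable_fun_fst_setX _ _ _ _ _ _ D D (fun r => expR (- (c * r)))) => //.
    apply: measurable_funTS.
    exact: (continuous_measurable_fun (@continuous_expRNM R c)).
  - move=> r s rD sD /=; rewrite normrM ger0_norm; last first.
      by rewrite mulr_ge0 ?expR_ge0// ltW.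
    apply: le_trans (ler_wpM2l _ (Db _ _ rD)) _.
      by rewrite mulr_ge0 ?expR_ge0// ltW.
    by rewrite le_eqVlt; apply/orP; left; apply/eqP; ring.
  - exact: integrable_scale.
  - exact: ing.
  have E1 r : D r -> \int[@lebesgue_measure R]_(s in D)
      (c * expR (- (c * r)) * (g s * dirichlet r (t - s))) = c * expR (- (c * r)) * J r.
    by move=> rD; rewrite RintegralZl//; exact: (iJ _ rD).1.
  rewrite /= in i1 *; move=> E2; split.
    apply: eq_integrable i1 => // r /set_mem rD.
    exact: (congr1 EFin (E1 r rD)).
  transitivity (\int[@lebesgue_measure R]_(r in D) \int[@lebesgue_measure R]_(s in D)
      (c * expR (- (c * r)) * (g s * dirichlet r (t - s)))).
    by apply: eq_Rintegral => r /set_mem rD; exact/esym/E1.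
  rewrite E2; apply: eq_Rintegral => s _ /=.
  have [id <-] := dirichlet_abel (t - s) c0; rewrite -RintegralZl//.
  by apply: eq_Rintegral => r _; ring.
have mJ : measurable_fun D J.
  have /measurable_int/measurable_EFinP h := (FJ 1 ltr01).1.
  apply: (@eq_measurable_fun _ _ _ _ _ (fun r => expR r * (1 * expR (- (1 * r)) * J r))).
    by move=> r _; rewrite !mul1r mulrA -expRD subrr expR0 mul1r.
  by apply: measurable_funM => //; exact: measurable_funTS.
have JB r : 0 <= r -> `|J r| <= 2 * G * r.
  by move=> r0; apply: (iJ _ _).2; rewrite /D /= in_itv/= andbT.
apply/eqP; rewrite -subr_eq0 -normr_le0; apply/ler_addgt0Pl => e e0.
have e20 : 0 < e / 2 by rewrite divr_gt0.
have [c1 c10 h1] := abel_mean mJ JB Jl e20.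
have [c2 c20 h2] := poisson_mean ig t0 gt e20.
pose c := Num.min c1 c2 / 2.
have c0 : 0 < c by rewrite divr_gt0// lt_min c10.
have cm : c < Num.min c1 c2 by rewrite /c ltr_pdivrMr// ltr_pMr ?ltr1n// lt_min c10.
have /andP[cc1 cc2] : (c < c1) && (c < c2) by rewrite -lt_min.
have := h1 _ c0 cc1; rewrite (FJ _ c0).2 => hl.
apply: le_trans (ler_distD _ _ _) _; rewrite addr0 [leRHS](splitr e).
by apply: lerD (h2 _ c0 cc2); rewrite distrC.
Qed.

(** * Uniqueness of the Laplace transform on a real half-line *)

Lemma exp_partial_sum (R : realType) (y : R) (N : nat) : 0 <= y ->
  `|\sum_(i < N) ((- y) ^+ i.+1 / i.+1`!%:R)| <= y * expR y.
Proof.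
move=> y0; apply: (le_trans (ler_norm_sum _ _ _)).
apply: (@le_trans _ _ (y * \sum_(i < N) (y ^+ i / i`!%:R))).
  rewrite mulr_sumr ler_sum// => i _; rewrite normrM normrX normrN (ger0_norm y0).
  rewrite exprS -mulrA ler_wpM2l// ler_wpM2l ?exprn_ge0// ger0_norm ?invr_ge0//.
  rewrite lef_pV2 ?posrE ?ltr0n ?fact_gt0// ler_nat factS leq_pmull//.
rewrite ler_wpM2l//.
have := @nondecreasing_cvgn_le _ (series (exp_coeff y)) _ (is_cvg_series_exp_coeff y) N.
rewrite /series /= big_mkord; apply.
by apply: nondecreasing_series => n _ _; exact: exp_coeff_ge0.
Qed.

Lemma cvg_exp_partial_sum (R : realType) (y : R) :
  \sum_(i < N) ((- y) ^+ i.+1 / i.+1`!%:R) @[N --> \oo] --> expR (- y) - 1.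
Proof.
have h : series (exp_coeff (- y)) N @[N --> \oo] --> expR (- y).
  exact: is_cvg_series_exp_coeff.
have E : (fun N => \sum_(i < N) ((- y) ^+ i.+1 / i.+1`!%:R)) =
         (fun N => series (exp_coeff (- y)) N.+1 - 1).
  apply/funext => N; rewrite /series /= big_mkord big_ord_recl /= /exp_coeff/=.
  by rewrite expr0 fact0 invr1 mulr1 addrAC subrr add0r.
rewrite E; apply: cvgB; last exact: cvg_cst.
by move: h; rewrite -(cvg_shiftS (series (exp_coeff (- y)))).
Qed.

Section laplace_uniqueness.
Context {R : realType}.
Notation mu := (@lebesgue_measure R).
Variables (k : R -> R) (m0 : R).
Hypothesis m00 : 0 <= m0.
Hypothesis ik : mu.-integrable `[0, +oo[ (EFin \o fun s => expR (- (m0 * s)) * k s).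

Lemma laplace_integrable_ge (m : R) : m0 <= m ->
  mu.-integrable `[0, +oo[ (EFin \o fun s => expR (- (m * s)) * k s).
Proof.
move=> m0m; have /integrableP[/measurable_EFinP mk _] := ik.
apply: le_integrable ik => //.
  apply/measurable_EFinP.
  apply: (@eq_measurable_fun _ _ _ _ _
      (fun s => expR (- ((m - m0) * s)) * (expR (- (m0 * s)) * k s))).
    by move=> s _; rewrite mulrA -expRD -opprD -mulrDl subrK.
  apply: measurable_funM => //; apply: measurable_funTS.
  exact: (continuous_measurable_fun (@continuous_expRNM R (m - m0))).
move=> s /=; rewrite in_itv/= andbT => s0.
rewrite lee_fin !normrM ler_wpM2r// !ger0_norm ?expR_ge0//.
by rewrite ler_expR lerN2 ler_wpM2r.
Qed.

Lemma laplace_kernel_measurable : measurable_fun (`[0, +oo[ : set R) k.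
Proof.
have /integrableP[/measurable_EFinP mk _] := ik.
apply: (@eq_measurable_fun _ _ _ _ _
    (fun s => expR (m0 * s) * (expR (- (m0 * s)) * k s))).
  by move=> s _; rewrite mulrA -expRD subrr expR0 mul1r.
apply: measurable_funM => //; apply: measurable_funTS.
have := @continuous_expRNM R (- m0); under eq_fun do rewrite mulNr opprK.
exact: continuous_measurable_fun.
Qed.

Hypothesis k0 : forall m, m0 <= m ->
  \int[mu]_(s in `[0, +oo[) (expR (- (m * s)) * k s) = 0.

Let y (x t s : R) : R := expR (x * (t - s)).

(** Expand 1 - exp (- y) in powers of y = exp (x (t - s)). The i-th power is a
    constant times exp (- (i x s)), so its integral against k vanishes by
    hypothesis; the partial sums are dominated by y exp y. *)
Lemma phragmen_integral (x t : R) : m0 <= x -> 0 < x ->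
  \int[mu]_(s in `[0, +oo[) (k s * (1 - expR (- y x t s))) = 0.
Proof.
move=> m0x x0.
pose c i : R := - (-1) ^+ i.+1 * expR (i.+1%:R * (x * t)) / i.+1`!%:R.
pose F (N : nat) (s : R) : R := \sum_(i < N) (c i * (expR (- (i.+1%:R * x * s)) * k s)).
have xi i : m0 <= i.+1%:R * x.
  by rewrite (le_trans m0x)// ler_peMl ?ler1n// ltW.
have FI N : mu.-integrable `[0, +oo[ (EFin \o F N) /\
    \int[mu]_(s in `[0, +oo[) F N s = 0.
  elim: N => [|N [IH1 IH2]].
    split.
      apply: (eq_integrable _ (cst 0%E)) => //; last exact: integrable0.
      by move=> s _; rewrite /= /F big_ord0.
    rewrite (@eq_Rintegral _ _ _ _ _ (fun=> 0)).
      by rewrite Rintegral_cst// mul0r.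
    by move=> s _; rewrite /F big_ord0.
  have FS s : F N.+1 s = F N s + c N * (expR (- (N.+1%:R * x * s)) * k s).
    by rewrite /F big_ord_recr.
  have i1 : mu.-integrable `[0, +oo[
      (EFin \o fun s => c N * (expR (- (N.+1%:R * x * s)) * k s)).
    by apply: integrable_scale => //; exact: laplace_integrable_ge.
  rewrite (funext FS); split; first exact: integrable_add.
  rewrite RintegralD// IH2 RintegralZl//; last exact: laplace_integrable_ge.
  by rewrite k0// mulr0 addr0.
have FE N s : F N s = k s * - \sum_(i < N) ((- y x t s) ^+ i.+1 / i.+1`!%:R).
  rewrite /F -sumrN mulr_sumr; apply: eq_bigr => i _.
  rewrite (exprNn (y x t s)) /c /y -expRM_natl.
  have -> : i.+1%:R * (x * (t - s)) = i.+1%:R * (x * t) + - (i.+1%:R * x * s).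
    by ring.
  by rewrite expRD; ring.
have yb s : 0 <= s -> y x t s * expR (y x t s) <=
    expR (x * t) * expR (expR (x * t)) * expR (- (x * s)).
  move=> s0; have -> : y x t s = expR (x * t) * expR (- (x * s)).
    by rewrite /y mulrBr expRD.
  rewrite mulrAC ler_wpM2r ?expR_ge0// ler_wpM2l ?expR_ge0//.
  rewrite ler_expR ler_piMr ?expR_ge0// -expR0 ler_expR oppr_le0.
  by rewrite mulr_ge0// ltW.
pose G s : R := expR (x * t) * expR (expR (x * t)) * `|expR (- (x * s)) * k s|.
have ib : mu.-integrable `[0, +oo[ (EFin \o G).
  apply: integrable_scale => //.
  by apply: integrable_norm => //; exact: laplace_integrable_ge.
have [||||_ cv] := @Rintegral_dominated_cvg _ _ _ mu `[0%R, +oo[%classic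
   F (fun s => k s * (1 - expR (- y x t s))) G _ _ _ ib.
- by [].
- by move=> N; apply/measurable_EFinP; exact: measurable_int (FI N).1.
- move=> s _; under eq_fun do rewrite FE.
  by rewrite -opprB; apply: cvgMr; apply: cvgN; exact: cvg_exp_partial_sum.
- move=> N s /=; rewrite in_itv/= andbT => s0; rewrite FE normrM normrN /G normrM.
  rewrite (ger0_norm (expR_ge0 (- _))) mulrA mulrC ler_wpM2r//.
  apply: le_trans (exp_partial_sum _ _) _; first exact: expR_ge0.
  exact: yb.
move: cv; under eq_fun do rewrite (FI _).2.
by move=> /cvg_lim <- //; rewrite lim_cst.
Qed.

(** As x grows, exp (x (t - s)) tends to infinity for s < t and to 0 for s > t,
    so the weight 1 - exp (- exp (x (t - s))) of the previous lemma tends to the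
    indicator of [0, t]. The point s = t, where the weight does not converge to
    that indicator, is removed. Only real arguments of the Laplace transform
    enter, and the conclusion is about primitives, so that k may be merely
    measurable. *)
Lemma laplace_unique (t : R) : 0 <= t -> \int[mu]_(s in `[0, t]) k s = 0.
Proof.
move=> t0; pose D : set R := `[0, +oo[%classic.
have mD : measurable D by exact: measurable_itv.
have mDt : measurable (D `\ t) by exact: measurableD.
have mk := laplace_kernel_measurable.
(* Integer points are enough; they start above m0, where k has a transform. *)
pose N0 := truncn m0.
pose x (n : nat) : R := (n + N0.+1)%:R.
have x0 n : 0 < x n by rewrite /x ltr0n addnS.
have xm n : m0 <= x n.
  by rewrite (@le_trans _ _ N0.+1%:R)//; [rewrite ltW// truncnS_gt|rewrite ler_nat leq_addl].
have xoo : x n @[n --> \oo] --> +oo.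
  by have := @cvgr_idn R; rewrite -(cvg_shiftn N0.+1).
pose f n s : R := k s * (1 - expR (- y (x n) t s)).
have my n : measurable_fun setT (y (x n) t).
  apply: measurableT_comp => //; apply: measurable_funM => //.
  exact: measurable_funB.
have mf n : measurable_fun D (f n).
  apply: measurable_funM => //; apply: measurable_funB => //.
  apply: measurable_funTS; apply: measurableT_comp => //.
  exact: measurableT_comp.
pose G s : R := expR (m0 * t) * `|expR (- (m0 * s)) * k s|.
have iG : mu.-integrable D (EFin \o G).
  by apply: integrable_scale => //; exact: integrable_norm.
have fG n s : D s -> `|f n s| <= G s.
  move=> _; rewrite /f /G !normrM mulrC (ger0_norm (expR_ge0 (- _))) mulrA.
  rewrite ler_wpM2r// -expRD -mulrBr.
  have y0 : 0 <= y (x n) t s by exact: expR_ge0.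
  have e1 : expR (- y (x n) t s) <= 1 by rewrite -expR0 ler_expR oppr_le0.
  rewrite ger0_norm ?subr_ge0//.
  have [st|st] := leP s t.
    apply: (@le_trans _ _ 1); first by rewrite lerBlDr lerDl expR_ge0.
    by rewrite -expR0 ler_expR mulr_ge0// subr_ge0.
  apply: (@le_trans _ _ (y (x n) t s)).
    by rewrite lerBlDr addrC -lerBlDr (le_trans _ (expR_ge1Dx _)).
  by rewrite ler_expR ler_wnM2r// subr_le0 ltW.
have int0 n : \int[mu]_(s in D `\ t) f n s = 0.
  rewrite /Rintegral integral_setD1//; first exact: (phragmen_integral _ (xm n)).
  apply/measurable_EFinP; exact: measurable_funS (mf n).
pose L : R -> R := k \_ `[0, t].
have [||||iL cv] := @Rintegral_dominated_cvg _ _ _ mu (D `\ t) f L G mDt.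
- by move=> n; exact: measurable_funS (mf n).
- move=> s [Ds /eqP st]; rewrite /L patchE mem_setE in_itv/=.
  move: Ds; rewrite /D /= in_itv/= andbT => -> /=.
  have [st'|st'] := leP s t.
    have {}st : 0 < t - s by rewrite subr_gt0 lt_neqAle st st'.
    rewrite -[X in _ --> X]mulr1 -[X in k s * X]subr0; apply: cvgMr.
    apply: cvgB; first exact: cvg_cst.
    apply: (@cvg_comp _ _ _ (fun n => y (x n) t s) (fun z => expR (- z)) _ +oo);
      last exact: cvgr_expR.
    apply/cvgryPge => A; have /cvgryPge/(_ (A / (t - s))) := xoo.
    apply: filterS => n; rewrite ler_pdivrMr// => /le_trans; apply.
    by rewrite (le_trans _ (expR_ge1Dx _))// lerDr.
  have -> : point = k s * (1 - 1) :> R by rewrite subrr mulr0.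
  apply: cvgMr.
  apply: cvgB; first exact: cvg_cst.
  have yc : y (x n) t s @[n --> \oo] --> (0 : R).
    have E : (fun n => y (x n) t s) = (fun z => expR (- ((s - t) * z))) \o x.
      by apply/funext => n; rewrite /y /= -mulNr opprB mulrC.
    rewrite E; apply: cvg_comp xoo _; apply: cvg_expR_Ny.
    by rewrite subr_gt0.
  have -> : 1 = expR (- 0) :> R by rewrite oppr0 expR0.
  apply: (@cvg_comp _ _ _ (fun n => - y (x n) t s) (@expR R)).
    by apply: cvgN; exact: yc.
  exact: continuous_expR.
- by apply: integrableS iG => //; exact: subDsetl.
- by move=> n s [Ds _]; exact: fG.
have : \int[mu]_(s in D `\ t) L s = 0.
  by move: cv; under eq_fun do rewrite int0; move=> /cvg_lim <- //; rewrite lim_cst.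
rewrite /Rintegral integral_setD1//; last exact: measurable_int iL.
rewrite -[fine _ in X in X -> _]/(Rintegral mu D (k \_ `[0, t])).
rewrite -Rintegral_mkcondr (_ : D `&` _ = `[0, t]%classic)//.
apply/seteqP; split => s; rewrite /D /= !in_itv/=; first by case.
by move=> /andP[-> ->].
Qed.

End laplace_uniqueness.

(** * The derivative of the variance function *)

Lemma FTC2_is_derive_in (R : realType) (f F : R -> R) (a b : R) : a < b ->
    (forall x : R, a <= x <= b -> {for x, continuous f}) ->
    (forall x : R, a <= x <= b -> is_derive x 1 F (f x)) ->
  (\int[@lebesgue_measure R]_(x in `[a, b]) (f x)%:E = (F b - F a)%:E)%E.
Proof.
move=> ab cf dF.
have cF (x : R) : a <= x <= b -> {for x, continuous F}.
  move=> xab; apply: differentiable_continuous; apply/derivable1_diffP.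
  by have [] := dF _ xab.
have aab : a <= a <= b by rewrite lexx ltW.
have bab : a <= b <= b by rewrite lexx ltW.
rewrite EFinB; apply: continuous_FTC2 => //.
- apply: continuous_in_subspaceT => x; rewrite inE /= in_itv /= => xab.
  exact: cf.
- split.
  + move=> x; rewrite in_itv/= => /andP[ax xb].
    by have [] := dF x; rewrite ?ltW ?ax.
  + exact/cvg_at_right_filter/cF.
  + exact/cvg_at_left_filter/cF.
- move=> x; rewrite in_itv/= => /andP[ax xb].
  by rewrite derive1E; have [] := dF x; rewrite ?ltW ?ax.
Qed.

(** The antiderivative is used on [1 / (n + 2), 1], since the power is singular at 0. *)
Lemma integrable_powR (R : realType) (p : R) : -1 < p ->
  (@lebesgue_measure R).-integrable `[0, 1] (EFin \o fun r => r `^ p).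
Proof.
move=> p1; have p10 : 0 < p + 1 by rewrite -ltrBlDr sub0r.
have mp : measurable_fun setT (fun r : R => r `^ p) by exact: measurable_powR.
apply/integrableP; split; first by apply/measurable_EFinP; exact: measurable_funTS.
pose F (n : nat) : set R := `[n.+2%:R^-1, 1]%classic.
have FE : \bigcup_n F n = `]0, 1]%classic.
  apply/seteqP; split => [x [n _]|x]; rewrite /F /= !in_itv /=.
    by move=> /andP[nx ->]; rewrite andbT (lt_le_trans _ nx)// invr_gt0.
  move=> /andP[x0 x1]; exists (truncn x^-1) => //=; rewrite in_itv/= x1 andbT.
  rewrite -[leRHS]invrK lef_pV2 ?posrE ?invr_gt0// ltW//.
  by rewrite (lt_trans (truncnS_gt _))// ltr_nat.
have nd : nondecreasing_seq F.
  move=> m n mn; apply/subsetPset => x; rewrite /F /= !in_itv/= => /andP[mx ->].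
  by rewrite andbT (le_trans _ mx)// lef_pV2 ?posrE// ler_nat.
have mF n : measurable (F n) by exact: measurable_itv.
rewrite -integral_itv_obnd_cbnd; last first.
  by apply: measurableT_comp => //; apply/measurable_EFinP; exact: measurable_funTS.
rewrite -FE.
have cv : (\int[@lebesgue_measure R]_(x in F i) `|(x `^ p)%:E| @[i --> \oo] -->
    \int[@lebesgue_measure R]_(x in \bigcup_i F i) `|(x `^ p)%:E|)%E.
  apply: ge0_nondecreasing_set_cvg_integral => // n.
  by apply/measurable_EFinP; apply: measurableT_comp => //; exact: measurable_funTS.
apply: (@le_lt_trans _ _ (p + 1)^-1%:E); last exact: ltry.
rewrite -(cvg_lim _ cv)//; apply: lime_le; first by apply/cvg_ex; eexists; exact: cv.
apply: nearW => n.
have n0 : 0 < n.+2%:R^-1 :> R by rewrite invr_gt0.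
have n1 : n.+2%:R^-1 < 1 :> R by rewrite invf_lt1// ltr1n.
have dF (x : R) : n.+2%:R^-1 <= x <= 1 ->
    is_derive x 1 (fun r => (p + 1)^-1 * r `^ (p + 1)) (x `^ p).
  move=> /andP[nx _]; have x0 := lt_le_trans n0 nx.
  have h := is_derive1_powR (p + 1) x0.
  apply: is_derive_eq; rewrite /GRing.scale /= addrK mulrA mulVf ?mul1r//.
  by rewrite gt_eqF.
have cf (x : R) : n.+2%:R^-1 <= x <= 1 -> {for x, continuous (fun r => r `^ p)}.
  move=> /andP[nx _]; have x0 := lt_le_trans n0 nx.
  apply: differentiable_continuous; apply/derivable1_diffP.
  by have [] := is_derive1_powR p x0.
have -> : (\int[@lebesgue_measure R]_(x in F n) `|(x `^ p)%:E| =
    \int[@lebesgue_measure R]_(x in F n) (x `^ p)%:E)%E.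
  by apply: eq_integral => x _; rewrite gee0_abs// lee_fin powR_ge0.
rewrite (FTC2_is_derive_in n1 cf dF) lee_fin powR1 mulr1 lerBlDr lerDl.
by rewrite mulr_ge0 ?powR_ge0// invr_ge0 ltW.
Qed.

Lemma lebesgue_measure_reflection (R : realType) (a : R) (A : set R) :
  measurable A ->
  pushforward (@lebesgue_measure R) (fun x : measurableTypeR R => a - x : measurableTypeR R) A =
  @lebesgue_measure R A.
Proof.
move=> mA; apply/esym/lebesgue_measure_unique => //.
  by apply: measurable_funB.
move=> ? _ [[c e]] _ <- /=; rewrite /pushforward.
have -> : (fun x : R => a - x) @^-1` `]c, e] = `[a - e, a - c[%classic.
  apply/seteqP; split => x /=; rewrite !in_itv/= => /andP[h1 h2];
    apply/andP; split; lra.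
rewrite !lebesgue_measure_itv/= !lte_fin.
have -> : (a - e < a - c) = (c < e) by rewrite ltrD2l ltrN2.
by case: ifP => // _; rewrite -!EFinD; congr EFin; ring.
Qed.

Lemma ge0_integral_reflection (R : realType) (u : R) (h : R -> \bar R) :
    measurable_fun setT h -> (forall x, 0 <= h x)%E ->
  (\int[@lebesgue_measure R]_(v in `[0%R, u]) h (u - v)%R =
   \int[@lebesgue_measure R]_(v in `[0%R, u]) h v)%E.
Proof.
move=> mh h0.
pose phi : measurableTypeR R -> measurableTypeR R := fun x => u - x.
have mphi : measurable_fun setT phi by exact: measurable_funB.
have {1}-> : `[0, u]%classic = phi @^-1` `[0, u]%classic.
  apply/seteqP; split => x /=; rewrite /phi !in_itv/= => /andP[h1 h2];
    apply/andP; split; lra.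
have := @ge0_integral_pushforward _ _ _ _ R phi mphi (@lebesgue_measure R)
  `[0, u]%classic h (measurable_itv _) (measurable_funTS mh) (fun x _ => h0 x).
move=> E; transitivity (\int[pushforward (@lebesgue_measure R) phi]_(y in `[0%R, u]) h y)%E.
  by rewrite E.
by apply: eq_measure_integral => /= A mA _; exact: lebesgue_measure_reflection.
Qed.

Lemma le_Rintegral_subset (R : realType) (d : measure_display)
    (T : measurableType d) (m : {measure set T -> \bar R}) (A B : set T)
    (f : T -> R) : measurable A -> measurable B -> A `<=` B ->
    m.-integrable B (EFin \o f) -> (forall x, B x -> 0 <= f x) ->
  \int[m]_(x in A) f x <= \int[m]_(x in B) f x.
Proof.
move=> mA mB AB iB f0; have iA : m.-integrable A (EFin \o f) by exact: integrableS iB.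
rewrite /Rintegral fine_le//; [exact: integrable_fin_num|exact: integrable_fin_num|].
by apply: ge0_subset_integral => //; exact: measurable_int iB.
Qed.

Lemma Rintegral_fine (R : realType) (d : measure_display) (T : measurableType d)
    (m : {measure set T -> \bar R}) (D : set T) (F : T -> \bar R) :
    measurable D -> m.-integrable D F ->
  \int[m]_(x in D) fine (F x) = fine (\int[m]_(x in D) F x)%E.
Proof.
move=> mD iF; congr fine; have mF := measurable_int _ iF.
apply: ae_eq_integral => //.
  by apply/measurable_EFinP; exact: measurableT_comp.
by apply: filterS (integrable_ae mD iF) => x /= Fx Dx; rewrite fineK// Fx.
Qed.

Lemma Rintegral_gt0 (R : realType) (f : R -> R) (a b x : R) :
    a < x < b -> {for x, continuous f} -> 0 < f x ->
    (forall y, y \in `[a, b] -> 0 <= f y) ->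
    (@lebesgue_measure R).-integrable `[a, b] (EFin \o f) ->
  0 < \int[@lebesgue_measure R]_(y in `[a, b]) f y.
Proof.
move=> /andP[ax xb] cf fx0 f0 if_.
have fx20 : 0 < f x / 2 by rewrite divr_gt0.
have [e /= e0 fe] : \forall y \near x, `|f x - f y| < f x / 2.
  by have /cvgrPdist_lt/(_ _ fx20) := cf.
pose d := Num.min (e / 2) (Num.min (x - a) (b - x)).
have d0 : 0 < d by rewrite !lt_min !subr_gt0 ax xb divr_gt0.
have [de dxa dbx] : [/\ d <= e / 2, d <= x - a & d <= b - x].
  by rewrite /d; split; rewrite !ge_min lexx ?orbT.
pose I : set R := `[x - d, x + d]%classic.
have sI : I `<=` `[a, b].
  move=> y; rewrite /I /= !in_itv/= => /andP[h1 h2].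
  apply/andP; split; lra.
have mI : measurable I by exact: measurable_itv.
have iI : (@lebesgue_measure R).-integrable I (EFin \o f) by exact: integrableS if_.
have ic : (@lebesgue_measure R).-integrable I (EFin \o fun=> f x / 2).
  by apply: continuous_itv_integrable => ?; exact: cst_continuous.
have xdd : x - d < x + d by lra.
apply: (@lt_le_trans _ _ (\int[@lebesgue_measure R]_(y in I) f y)).
  apply: (@lt_le_trans _ _ (\int[@lebesgue_measure R]_(y in I) (f x / 2))).
    rewrite Rintegral_cst//.
    rewrite [X in fine X](_ : _ = (2 * d)%:E).
      by rewrite mulr_gt0// mulr_gt0.
    rewrite [LHS]lebesgue_measure_itv/= lte_fin xdd -EFinD; congr EFin; ring.
  apply: le_Rintegral => // y; rewrite /I /= in_itv/= => /andP[h1 h2].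
  have /fe : ball_ Num.norm x e y by rewrite /= ltr_norml; apply/andP; split; lra.
  by rewrite ltr_norml => /andP[? ?]; lra.
by apply: le_Rintegral_subset => // y yab; exact: f0.
Qed.

Lemma continuous_powR_gt0 (R : realType) (p x : R) : 0 < x ->
  {for x, continuous (fun r => r `^ p)}.
Proof.
move=> x0; apply: differentiable_continuous; apply/derivable1_diffP.
by have [] := is_derive1_powR p x0.
Qed.

Lemma is_derive_Rintegral (R : realType) (f : R -> R) (t T : R) :
    0 < t -> t < T -> (@lebesgue_measure R).-integrable `[0, T] (EFin \o f) ->
    {for t, continuous f} ->
  is_derive t 1 (fun x => \int[@lebesgue_measure R]_(s in `[0, x]) f s) (f t).
Proof.
move=> t0 tT if_ cf; have [d1 d2] := continuous_FTC1_closed tT if_ t0 cf.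
by apply: DeriveDef; [exact: d1|rewrite -derive1E; exact: d2].
Qed.

(** By symmetry the double integral is twice an integral over the triangle v <= u.
    The substitution r = u - v then gives, with c = 1 / theta,
    V t = 2 H (2 H - 1) exp (- (2 c t)) E t, where E t is the integral over [0, t]
    of exp (2 c u) J u and J is fou_primitive. Hence
    V' t = 2 H (2 H - 1) (J t - 2 c exp (- (2 c t)) E t). *)
Section variance.
Context {R : realType}.
Variables (H theta : R).
Hypotheses (HH : 1 / 2 < H < 1) (theta0 : 0 < theta).
Notation mu := (@lebesgue_measure R).

Let b : R := 2 * H - 2.
Let c : R := theta^-1.
Let c0 : 0 < c. Proof. by rewrite invr_gt0. Qed.

Let b1 : -1 < b. Proof. by move: HH => /andP[? ?]; rewrite /b; lra. Qed.

Let b0 : b < 0. Proof. by move: HH => /andP[? ?]; rewrite /b; lra. Qed.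

Definition fou_kernel (r : R) : R := expR (- (c * r)) * r `^ b.
Definition fou_primitive (t : R) : R := \int[mu]_(r in `[0, t]) fou_kernel r.
Local Notation h := fou_kernel.
Local Notation J := fou_primitive.

Let mh : measurable_fun setT h.
Proof.
apply: measurable_funM; first exact: (continuous_measurable_fun (@continuous_expRNM R c)).
exact: measurable_powR.
Qed.

Let h0 r : 0 <= h r. Proof. by rewrite mulr_ge0 ?expR_ge0 ?powR_ge0. Qed.

Let B0 : R := \int[mu]_(r in `[0, 1]) (r `^ b).
Let C : R := B0 + theta.

Let powR_le1 (r : R) : 1 <= r -> r `^ b <= 1.
Proof. by move=> r1; rewrite -(powRr0 r) ler_powR// ltW. Qed.

Let hle (u r : R) : 0 <= u -> u <= r ->
  expR (c * u) * h r <= ((fun r => r `^ b) \_ `[0, 1]) r + expR (c * u) * expR (- (c * r)).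
Proof.
move=> u0 ur; rewrite patchE mem_setE in_itv/= (le_trans u0 ur)/=.
have r0 : 0 <= r by exact: le_trans ur.
have [r1|r1] := leP r 1.
  rewrite -[leLHS]addr0 lerD// ?mulr_ge0 ?expR_ge0//.
  rewrite /h mulrA -expRD ler_piMl ?powR_ge0// -expR0 ler_expR.
  by rewrite -mulrN -mulrDr mulr_ge0_le0 ?(ltW c0)// subr_le0.
rewrite [point](_ : _ = 0)// add0r ler_wpM2l ?expR_ge0// /h ler_piMr ?expR_ge0//.
by apply: powR_le1; exact: ltW.
Qed.

Let iP : mu.-integrable `[0, +oo[ (EFin \o ((fun r => r `^ b) \_ `[0, 1])).
Proof.
rewrite -restrict_EFin; apply/integrable_restrict => //=.
have -> : `[0, +oo[ `&` `[0, 1] = (`[0, 1]%classic : set R).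
  apply/seteqP; split => s; rewrite /= !in_itv/=; first by case.
  by move=> /andP[-> ->].
exact: integrable_powR b1.
Qed.

Let ih : mu.-integrable `[0, +oo[ (EFin \o h).
Proof.
have [ie _] := integral_expR c0.
have [] // := @Rintegral_le_bound _ _ _ mu `[0%R, +oo[%classic h
  (fun r => ((fun r => r `^ b) \_ `[0, 1]) r + expR (- (c * r))).
- exact: measurable_funTS.
- exact: integrable_add.
- move=> r /=; rewrite in_itv/= andbT => r0; rewrite ger0_norm//.
  by have := hle (lexx 0) r0; rewrite mulr0 expR0 !mul1r.
Qed.

Let ihS (A : set R) : measurable A -> A `<=` `[0, +oo[ -> mu.-integrable A (EFin \o h).
Proof. by move=> mA AS; exact: integrableS ih. Qed.

Let ih0 t : mu.-integrable `[0, t] (EFin \o h).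
Proof.
by apply: ihS => // s /=; rewrite !in_itv/= => /andP[->].
Qed.

Let JB u t : 0 <= u -> u <= t -> 0 <= J t - J u <= C * expR (- (c * u)).
Proof.
move=> u0 ut.
have sut : `]u, t] `<=` (`[0, +oo[ : set R).
  by move=> s; rewrite /= !in_itv/= => /andP[/ltW us _]; rewrite (le_trans u0 us).
rewrite /J Rintegral_itvB; [|exact: ih0|by []|by []].
rewrite Rintegral_ge0//= -[leLHS]mulr1 -(expR0 R) -(subrr (c * u)) expRD mulrA.
rewrite ler_wpM2r ?expR_ge0//.
have iut : mu.-integrable `]u, t] (EFin \o h) by exact: ihS.
rewrite mulrC -RintegralZl//.
have [ie ee] := integral_expR c0.
have iPu : mu.-integrable `]u, t] (EFin \o ((fun r => r `^ b) \_ `[0, 1])).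
  exact: integrableS iP.
have ieu : mu.-integrable `]u, t] (EFin \o (fun r => expR (c * u) * expR (- (c * r)))).
  by apply: integrable_scale => //; exact: integrableS ie.
apply: (@le_trans _ _ (\int[mu]_(r in `]u, t])
   (((fun r => r `^ b) \_ `[0, 1]) r + expR (c * u) * expR (- (c * r))))).
  apply: le_Rintegral => //.
  - exact: integrable_scale.
  - exact: integrable_add.
  - by move=> r /=; rewrite in_itv/= => /andP[/ltW ur _]; exact: hle.
rewrite RintegralD// /C lerD//.
  have -> : B0 = \int[mu]_(r in `[0, +oo[) ((fun r => r `^ b) \_ `[0, 1]) r.
    rewrite -Rintegral_mkcondr (_ : _ `&` _ = `[0, 1]%classic)//.
    apply/seteqP; split => s; rewrite /= !in_itv/=; first by case.
    by move=> /andP[-> ->].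
  apply: le_Rintegral_subset => // r _; rewrite patchE; case: ifP => // _.
  exact: powR_ge0.
rewrite RintegralZl//; last exact: integrableS ie.
have [iu eu] := integral_expR_tail u c0.
apply: (@le_trans _ _ (expR (c * u) * \int[mu]_(r in `[u, +oo[) expR (- (c * r)))).
  rewrite ler_wpM2l ?expR_ge0//; apply: le_Rintegral_subset => //.
    by move=> r /=; rewrite !in_itv/= andbT => /andP[/ltW].
rewrite eu mulrCA -expRD subrr expR0 mulr1 /c invrK//.
Qed.

Let J0 : J 0 = 0. Proof. by rewrite /J set_itv1 Rintegral_set1. Qed.

Let cont_h (t : R) : 0 < t -> {for t, continuous h}.
Proof.
move=> t0; apply: cvgM; first exact: continuous_expRNM.
exact: continuous_powR_gt0.
Qed.

Let cont_J (t : R) : 0 < t -> {for t, continuous J}.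
Proof.
move=> t0; apply: differentiable_continuous; apply/derivable1_diffP.
have tt1 : t < t + 1 by rewrite ltrDl.
by have [] := continuous_FTC1_closed tt1 (ih0 (t + 1)) t0 (cont_h t0).
Qed.

Let J_gt0 (t : R) : 0 < t -> 0 < J t.
Proof.
move=> t0; have t20 : 0 < t / 2 by rewrite divr_gt0.
apply: (@Rintegral_gt0 _ _ _ _ (t / 2)) => //.
- by rewrite t20/= ltr_pdivrMr// ltr_pMr// ltr1n.
- exact: cont_h.
- by rewrite mulr_gt0 ?expR_gt0// powR_gt0.
Qed.

Let J_le (t : R) : 0 <= t -> 0 <= J t <= C.
Proof. by move=> t0; have := JB (lexx 0) t0; rewrite J0 subr0 mulr0 oppr0 expR0 mulr1. Qed.

Let f (u : R) : R := expR (2 * c * u) * J u.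
Let E (t : R) : R := \int[mu]_(u in `[0, t]) f u.

Let cexp2 : continuous (fun u => expR (2 * c * u)).
Proof.
have := @continuous_expRNM R (- (2 * c)).
by under eq_fun do rewrite mulNr opprK.
Qed.

Let cont_f (t : R) : 0 < t -> {for t, continuous f}.
Proof. by move=> t0; apply: cvgM; [exact: cexp2|exact: cont_J]. Qed.

Let mf : measurable_fun (`[0, +oo[ : set R) f.
Proof.
apply/measurable_fun_itv_obnd_cbndP.
apply: open_continuous_measurable_fun; first exact: interval_open.
by move=> t; rewrite inE /= in_itv/= andbT; exact: cont_f.
Qed.

Let if0 t : mu.-integrable `[0, t] (EFin \o f).
Proof.
have ie : mu.-integrable `[0, t] (EFin \o (fun u => C * expR (2 * c * u))).
  by apply: integrable_scale => //; exact: continuous_itv_integrable.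
have [] // := @Rintegral_le_bound _ _ _ mu `[0%R, t]%classic f _ _ _ ie.
- by apply: measurable_funS mf => // s /=; rewrite !in_itv/= => /andP[->].
- move=> u /=; rewrite in_itv/= => /andP[u0 _].
  have /andP[j0 jC] := J_le u0.
  by rewrite normrM !ger0_norm ?expR_ge0// mulrC ler_wpM2r ?expR_ge0.
Qed.

Let dE (t : R) : 0 < t -> is_derive t 1 E (f t).
Proof.
move=> t0; apply: (@is_derive_Rintegral _ _ _ (t + 1)) => //; first by rewrite ltrDl.
exact: cont_f.
Qed.

Let integrand (u v : R) : R := expR ((u + v) / theta) * `|u - v| `^ b.

Let mintegrand : measurable_fun setT (fun p : R * R => integrand p.1 p.2).
Proof.
have m1 : measurable_fun setT (fun p : R * R => p.1) by exact: measurable_fst.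
have m2 : measurable_fun setT (fun p : R * R => p.2) by exact: measurable_snd.
apply: measurable_funM.
  apply: measurableT_comp => //; apply: measurable_funM => //.
  exact: measurable_funD.
apply: (measurableT_comp (@measurable_powR R b)).
by apply: measurableT_comp => //; exact: measurable_funB.
Qed.

Let integrand_ge0 u v : 0 <= integrand u v.
Proof. by rewrite mulr_ge0 ?expR_ge0 ?powR_ge0. Qed.

Let integrandC u v : integrand u v = integrand v u.
Proof. by rewrite /integrand addrC distrC. Qed.

Let inner_integral (u : R) : 0 <= u ->
  (\int[mu]_(v in `[0%R, u]) (integrand u v)%:E = (f u)%:E)%E.
Proof.
move=> u0.
transitivity (\int[mu]_(v in `[0%R, u]) ((expR (2 * c * u))%:E * (h (u - v))%:E))%E.
  apply: eq_integral => v /set_mem/=; rewrite in_itv/= => /andP[v0 vu].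
  rewrite -EFinM /integrand /h mulrA -expRD ger0_norm ?subr_ge0//.
  by congr ((expR _) * _)%:E; rewrite /c; ring.
rewrite ge0_integralZl//=; last 2 first.
- apply/measurable_EFinP; apply: measurable_funTS; apply: measurableT_comp => //.
  exact: measurable_funB.
- by move=> v _; rewrite lee_fin.
rewrite (ge0_integral_reflection _ (h := EFin \o h)); last 2 first.
- exact/measurable_EFinP.
- by move=> x; rewrite lee_fin.
rewrite /f EFinM /J /Rintegral fineK//.
exact: integrable_fin_num (ih0 u).
Qed.

Let double_integral (t : R) :
  \int[mu]_(u in `[0, t]) \int[mu]_(v in `[0, t]) integrand u v = 2 * E t.
Proof.
(* The diagonal belongs to the first triangle only. *)
pose in1 (p : R * R) := [&& 0 <= p.2, p.2 <= p.1 & p.1 <= t].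
pose in2 (p : R * R) := [&& 0 <= p.1, p.1 < p.2 & p.2 <= t].
pose g1 p := if in1 p then integrand p.1 p.2 else 0.
pose g2 p := if in2 p then integrand p.1 p.2 else 0.
have m1 : measurable_fun setT (fun p : R * R => p.1) by exact: measurable_fst.
have m2 : measurable_fun setT (fun p : R * R => p.2) by exact: measurable_snd.
have mc (k : R) : measurable_fun setT (fun p : R * R => k) by exact: measurable_cst.
have mg1 : measurable_fun setT g1.
  apply: measurable_fun_ifT => //; apply: measurable_and.
    exact: measurable_fun_ler.
  by apply: measurable_and; exact: measurable_fun_ler.
have mg2 : measurable_fun setT g2.
  apply: measurable_fun_ifT => //; apply: measurable_and.
    exact: measurable_fun_ler.
  by apply: measurable_and; [exact: measurable_fun_ltr|exact: measurable_fun_ler].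
have g10 p : 0 <= g1 p by rewrite /g1; case: ifP.
have g20 p : 0 <= g2 p by rewrite /g2; case: ifP.
have EE : (\int[mu]_(u in `[0%R, t]) (f u)%:E = (E t)%:E)%E.
  by rewrite /E /Rintegral fineK//; exact: integrable_fin_num (if0 t).
have E1 : (\int[mu]_u \int[mu]_v (g1 (u, v))%:E = (E t)%:E)%E.
  rewrite -EE [RHS]integral_mkcond; apply: eq_integral => u _.
  rewrite patchE mem_setE in_itv/=; case: ifPn => [/andP[u0 ut]|ut].
    rewrite -inner_integral// [RHS]integral_mkcond; apply: eq_integral => v _.
    by rewrite patchE mem_setE in_itv/= /g1 /in1/= ut andbT; case: ifP.
  apply: integral0_eq => v _; rewrite /g1 /in1/=; case: ifPn => // /and3P[v0 vu u_t].
  by rewrite (le_trans v0 vu) u_t in ut.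
have E2 : (\int[mu]_u \int[mu]_v (g2 (u, v))%:E = (E t)%:E)%E.
  have -> : (\int[mu]_u \int[mu]_v (g2 (u, v))%:E =
             \int[mu]_v \int[mu]_u (g2 (u, v))%:E)%E.
    apply: (@fubini_tonelli _ _ _ _ _ mu mu (EFin \o g2)).
      exact/measurable_EFinP.
    by move=> p; rewrite lee_fin.
  rewrite -EE [RHS]integral_mkcond; apply: eq_integral => v _.
  rewrite patchE mem_setE in_itv/=; case: ifPn => [/andP[v0 vt]|vt].
    rewrite -inner_integral// -integral_itv_bndo_bndc; last first.
      apply/measurable_EFinP; apply: measurable_funTS.
      exact: (measurable_fun_pair2 v mintegrand).
    rewrite [RHS]integral_mkcond; apply: eq_integral => u _.
    rewrite patchE mem_setE in_itv/= /g2 /in2/= vt andbT integrandC.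
    by case: ifP.
  apply: integral0_eq => u _; rewrite /g2 /in2/=; case: ifPn => // /and3P[u0 uv v_t].
  by rewrite (le_trans u0 (ltW uv)) v_t in vt.
pose I (u : R) := (\int[mu]_(v in `[0%R, t]) (integrand u v)%:E)%E.
have mF (g : R * R -> R) : measurable_fun setT g -> (forall p, 0 <= g p) ->
    measurable_fun setT (fun u : R => \int[mu]_v (g (u, v))%:E)%E.
  move=> mg g0; apply: (@measurable_fun_fubini_tonelli_F _ _ _ _ _ mu (EFin \o g)).
    exact/measurable_EFinP.
  by move=> p; rewrite lee_fin.
have IE : I \_ `[0, t] = (fun u => \int[mu]_v (g1 (u, v))%:E + \int[mu]_v (g2 (u, v))%:E)%E.
  apply/funext => u; rewrite -ge0_integralD//; last 4 first.
  - by move=> v _; rewrite lee_fin.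
  - by apply/measurable_EFinP; exact: (measurable_fun_pair2 u mg1).
  - by move=> v _; rewrite lee_fin.
  - by apply/measurable_EFinP; exact: (measurable_fun_pair2 u mg2).
  rewrite patchE mem_setE in_itv/=; case: ifPn => [/andP[u0 ut]|ut].
    rewrite /I integral_mkcond; apply: eq_integral => v _.
    rewrite patchE mem_setE in_itv/= /g1 /g2 /in1 /in2/= u0 ut andbT/=.
    have [vu|uv] := leP v u.
      by rewrite (le_trans vu ut) andbT/= -EFinD addr0; case: ifP.
    by rewrite andbF (le_trans u0 (ltW uv))/= -EFinD add0r; case: ifP.
  apply/esym/integral0_eq => v _; rewrite /g1 /g2 /in1 /in2/=.
  case: ifPn => [/and3P[v0 vu u_t]|_]; first by rewrite (le_trans v0 vu) u_t in ut.
  case: ifPn => [/and3P[u0 uv v_t]|_]; last by rewrite adde0.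
  by rewrite u0 (le_trans (ltW uv) v_t) in ut.
have intI : (\int[mu]_(u in `[0%R, t]) I u = (2 * E t)%:E)%E.
  rewrite integral_mkcond IE ge0_integralD//; last 4 first.
  - by move=> u _; apply: integral_ge0 => v _; rewrite lee_fin.
  - exact: mF.
  - by move=> u _; apply: integral_ge0 => v _; rewrite lee_fin.
  - exact: mF.
  by rewrite E1 E2 -EFinD; congr EFin; ring.
have mI : measurable_fun `[0, t] I.
  apply/measurable_restrictT => //; rewrite IE.
  by apply: emeasurable_funD; exact: mF.
have iI : mu.-integrable `[0, t] I.
  apply/integrableP; split => //.
  rewrite (_ : (\int[mu]_(x in _) _)%E = (2 * E t)%:E) ?ltry//.
  rewrite -intI; apply: eq_integral => u _; rewrite gee0_abs//.
  by apply: integral_ge0 => v _; rewrite lee_fin.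
by rewrite (Rintegral_fine _ iI)// intI.
Qed.

Let alpha : R := H * (2 * H - 1).
Let alpha0 : 0 < alpha.
Proof. by move: HH => /andP[? ?]; rewrite /alpha mulr_gt0//; lra. Qed.

Let dV (t : R) : R := 2 * alpha * (J t - 2 * c * expR (- (2 * c * t)) * E t).

Let varianceE : variance_fOU H theta =
  (fun t => alpha * expR (- (2 * c * t)) * (2 * E t)).
Proof.
apply/funext => t; rewrite /variance_fOU -double_integral.
by congr (_ * expR (- _) * _); rewrite /c; ring.
Qed.

Let variance_derive (t : R) : 0 < t ->
  derive1 (variance_fOU H theta) t = dV t.
Proof.
move=> t0; have h1 := is_derive_expRNM (2 * c) t; have h2 := dE t0.
have : is_derive t 1 (variance_fOU H theta) (dV t).
  rewrite varianceE; apply: is_derive_eq; rewrite /GRing.scale /= /dV /f.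
  have : expR (- (2 * c * t)) * expR (2 * c * t) = 1.
    by rewrite -expRD addNr expR0.
  set x := expR (- _); set y := expR _ => xy.
  transitivity (2 * alpha * ((x * y) * J t - 2 * c * x * E t)); last by rewrite xy mul1r.
  by ring.
by move=> [_]; rewrite derive1E.
Qed.

Lemma variance_derive_continuous (t : R) : 0 < t ->
  {for t, continuous (derive1 (variance_fOU H theta))}.
Proof.
move=> t0; rewrite /prop_for /continuous_at variance_derive//.
have cdV : dV s @[s --> t] --> dV t.
  apply: cvgM; first exact: cvg_cst.
  apply: cvgB; first exact: cont_J.
  apply: cvgM; last first.
    apply: differentiable_continuous; apply/derivable1_diffP.
    by have [] := dE t0.
  apply: cvgM; first exact: cvg_cst.
  exact: continuous_expRNM.
apply: cvg_trans cdV; apply: near_eq_cvg; near=> s.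
rewrite variance_derive//; near: s.
exact: lt_nbhsr.
Unshelve. all: by end_near. Qed.

Let integral_exp (k t : R) : 0 < k -> 0 <= t ->
  \int[mu]_(u in `[0, t]) expR (k * u) = k^-1 * (expR (k * t) - 1).
Proof.
move=> k0 t0.
have dF (x : R) : is_derive x 1 (fun s => k^-1 * expR (k * s)) (expR (k * x)).
  have := is_derive_expRNM (- k) x; under eq_fun do rewrite mulNr opprK.
  rewrite !mulNr !opprK => hd; apply: is_derive_eq.
  by rewrite /GRing.scale /= mulrA mulVf ?mul1r// gt_eqF.
have cexp : continuous (fun x => expR (k * x)).
  have := @continuous_expRNM R (- k).
  by under eq_fun do rewrite mulNr opprK.
by rewrite (FTC2_is_derive t0 cexp dF) mulr0 expR0 mulrBr.
Qed.

Let int_exp (k t : R) : mu.-integrable `[0, t] (EFin \o fun u => expR (k * u)).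
Proof.
apply: continuous_itv_integrable.
have := @continuous_expRNM R (- k).
by under eq_fun do rewrite mulNr opprK.
Qed.

(** J is nondecreasing, so E t is at most J t times the integral of
    exp (2 c u), which makes the difference at least J t exp (- (2 c t)). *)
Lemma variance_derive_gt0 (t : R) : 0 < t ->
  0 < derive1 (variance_fOU H theta) t.
Proof.
move=> t0; rewrite variance_derive//; apply: mulr_gt0; first by rewrite mulr_gt0.
rewrite subr_gt0.
have c20 : 0 < 2 * c by rewrite mulr_gt0.
have EJ : E t <= J t * ((2 * c)^-1 * (expR (2 * c * t) - 1)).
  rewrite -integral_exp ?(ltW t0)// -(RintegralZl _ _ (int_exp _ _))//.
  apply: le_Rintegral => //.
  - by apply: integrable_scale => //; exact: int_exp.
  - move=> u /=; rewrite in_itv/= => /andP[u0 ut].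
    rewrite /f mulrC ler_wpM2r ?expR_ge0//.
    by have /andP[] := JB u0 ut; rewrite subr_ge0.
have e1 : expR (- (2 * c * t)) * expR (2 * c * t) = 1.
  by rewrite -expRD addNr expR0.
apply: (@le_lt_trans _ _ (2 * c * expR (- (2 * c * t)) *
    (J t * ((2 * c)^-1 * (expR (2 * c * t) - 1))))).
  by rewrite ler_wpM2l// mulr_ge0 ?expR_ge0// ltW.
have -> : 2 * c * expR (- (2 * c * t)) * (J t * ((2 * c)^-1 * (expR (2 * c * t) - 1))) =
  J t * (expR (- (2 * c * t)) * expR (2 * c * t)) - J t * expR (- (2 * c * t)).
  by field; rewrite gt_eqF.
by rewrite e1 mulr1 gtrBl mulr_gt0 ?expR_gt0// J_gt0.
Qed.

(** With J u replaced by J t in E t the difference in V' would be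
    J t exp (- (2 c t)); the error of this replacement is governed by
    J t - J u <= C exp (- (c u)). *)
Lemma variance_derive_le : exists2 K : R, 0 <= K & forall t, 0 < t ->
  derive1 (variance_fOU H theta) t <= K * expR (- (theta^-1 * t)).
Proof.
have C0 : 0 <= C by have := J_le (lexx 0); rewrite J0 lexx.
exists (2 * alpha * (3 * C)).
  by apply: mulr_ge0; [rewrite mulr_ge0// ltW|exact: mulr_ge0].
move=> t t0; rewrite variance_derive// -[leRHS]mulrA; apply: ler_wpM2l.
  by rewrite mulr_ge0// ltW.
have c20 : 0 < 2 * c by rewrite mulr_gt0.
have /andP[_ JC] := J_le (ltW t0).
have EJ : J t * ((2 * c)^-1 * (expR (2 * c * t) - 1)) - E t <=
    C * (c^-1 * (expR (c * t) - 1)).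
  rewrite -!integral_exp ?(ltW t0)// -!(RintegralZl _ _ (int_exp _ _))//.
  have iJ : mu.-integrable `[0, t] (EFin \o (fun u => J t * expR (2 * c * u))).
    by apply: integrable_scale => //; exact: int_exp.
  rewrite /E -(RintegralB _ iJ (if0 t))//.
  apply: le_Rintegral => //.
  - by apply: eq_integrable (integrableB _ iJ (if0 t)).
  - by apply: integrable_scale => //; exact: int_exp.
  - move=> u /=; rewrite in_itv/= => /andP[u0 ut].
    rewrite /f [expR _ * J u]mulrC -mulrBl.
    have /andP[_ jc] := JB u0 ut.
    apply: (@le_trans _ _ (C * expR (- (c * u)) * expR (2 * c * u))).
      by rewrite ler_wpM2r ?expR_ge0.
    by rewrite -mulrA -expRD; apply: ler_wpM2l => //; rewrite ler_expR; lra.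
set x := expR (- (2 * c * t)); set y := expR (c * t); set z := expR (2 * c * t) in EJ.
have xz : x * z = 1 by rewrite -expRD addNr expR0.
have xy : x * y = expR (- (c * t)) by rewrite -expRD; congr expR; ring.
have x0 : 0 <= x by exact: expR_ge0.
(* The first summand vanishes, as x z = 1. *)
have -> : J t - 2 * c * x * E t = J t * (1 - x * z) + J t * x +
   2 * c * x * (J t * ((2 * c)^-1 * (z - 1)) - E t).
  by field; rewrite gt_eqF.
rewrite xz subrr mulr0 add0r -/c -xy.
apply: (@le_trans _ _ (C * x + 2 * c * x * (C * (c^-1 * (y - 1))))).
  by apply: lerD; [rewrite ler_wpM2r|rewrite ler_wpM2l// mulr_ge0// ltW].
have -> : C * x + 2 * c * x * (C * (c^-1 * (y - 1))) = 2 * C * (x * y) - C * x.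
  by field; rewrite gt_eqF.
have Cx : 0 <= C * x by rewrite mulr_ge0.
have Cxy : 0 <= C * (x * y) by rewrite !mulr_ge0// expR_ge0.
lra.
Qed.

End variance.

(** * The Bernstein function at real arguments *)

Section bernstein_function.
Context {R : realType}.
Variable nu : {measure set R -> \bar R}.
Hypothesis levy : levy_measure nu.
Local Notation Rpos := (`]0, +oo[%classic : set R).

Let psi (l s : R) : R := 1 - expR (- (l * s)).
Definition laplace_exponent (l : R) : R := \int[nu]_(s in `]0, +oo[) psi l s.
Local Notation phi := laplace_exponent.

Let mpsi l : measurable_fun Rpos (psi l).
Proof.
apply: measurable_funB => //; apply: measurable_funTS.
exact: (continuous_measurable_fun (@continuous_expRNM R l)).
Qed.

Lemma bernstein_real (l : R) : bernstein nu l%:C = (phi l)%:C.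
Proof.
rewrite /bernstein /cintegral.
have E s : cexp (- (s%:C * l%:C)) = (expR (- (l * s)))%:C.
  by rewrite cexp_real mulrC.
congr (_ +i* _).
  by apply: eq_Rintegral => s _; rewrite E.
under eq_Rintegral do rewrite E /= subr0.
by rewrite /Rintegral integral0.
Qed.

Let psi_ge0 l s : 0 <= l -> Rpos s -> 0 <= psi l s.
Proof.
move=> l0; rewrite /= in_itv/= andbT => s0.
by rewrite subr_ge0 -expR0 ler_expR oppr_le0 mulr_ge0// ltW.
Qed.

Let ipsi l : 0 <= l -> nu.-integrable `]0, +oo[ (EFin \o psi l).
Proof.
move=> l0.
have im : nu.-integrable `]0, +oo[ (EFin \o fun s => Num.max l 1 * minr s 1).
  apply: integrable_scale => //; apply/integrableP; split.
    by apply/measurable_EFinP; apply: measurable_minr.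
  case: levy => + _; congr (_ < _)%E; apply: eq_integral => s /set_mem/=.
  rewrite in_itv/= andbT => s0.
  by rewrite ger0_norm// le_min ltW//=.
have [] // := @Rintegral_le_bound _ _ _ nu Rpos (psi l) _ _ (mpsi l) im.
move=> s sp; rewrite ger0_norm ?psi_ge0//.
move: sp; rewrite /= in_itv/= andbT => s0.
rewrite minEle; case: ifP => s1.
  rewrite (@le_trans _ _ (l * s))//.
    by rewrite lerBlDl -lerBlDr (le_trans _ (expR_ge1Dx _))// addrC.
  by rewrite ler_wpM2r ?(ltW s0)// le_max lexx.
rewrite mulr1 (@le_trans _ _ 1)//; first by rewrite lerBlDl lerDr expR_ge0.
by rewrite le_max lexx orbT.
Qed.

(** The upper bound says that phi l / l is nonincreasing, as phi is concave and
    vanishes at 0. It gives continuity without differentiating under the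
    integral. *)
Lemma laplace_exponent_le (l l' : R) : 0 < l -> l <= l' ->
  phi l <= phi l' <= l' / l * phi l.
Proof.
move=> l0 ll'; have l'0 : 0 < l' by exact: lt_le_trans ll'.
apply/andP; split.
  apply: le_Rintegral => //; [exact/ipsi/ltW|exact/ipsi/ltW|].
  move=> s /=; rewrite in_itv/= andbT => s0; rewrite lerD2l lerN2 ler_expR lerN2.
  by rewrite ler_wpM2r// ltW.
rewrite /phi -RintegralZl//; last exact/ipsi/ltW.
apply: le_Rintegral => //; [exact/ipsi/ltW|apply: integrable_scale => //; exact/ipsi/ltW|].
(* From 1 + y <= exp y at y = - ((l' - l) s) and at y = l s. *)
move=> s _; rewrite /psi mulrAC ler_pdivlMr//.
have e0 := expR_gt0 (- (l * s)).
have h1 : 1 - (l' - l) * s <= expR (- ((l' - l) * s)).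
  by rewrite (le_trans _ (expR_ge1Dx _)).
have h2 : expR (- (l' * s)) = expR (- (l * s)) * expR (- ((l' - l) * s)).
  by rewrite -expRD; congr expR; ring.
have h3 : expR (- (l * s)) * (1 + l * s) <= 1.
  by rewrite -[leRHS]expR0 -(addNr (l * s)) expRD ler_pM2l// expR_ge1Dx.
rewrite h2.
have h4 : expR (- (l * s)) * (1 - (l' - l) * s) <=
    expR (- (l * s)) * expR (- ((l' - l) * s)) by rewrite ler_pM2l.
nra.
Qed.

(** By monotone convergence phi tends to the total mass of nu, which is
    infinite. *)
Lemma laplace_exponent_unbounded (B : R) : exists2 l : R, 1 <= l & B < phi l.
Proof.
apply: contrapT => hB.
have phiB n : phi n.+1%:R <= B.
  rewrite leNgt; apply/negP => Bl; apply: hB; exists n.+1%:R => //.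
  by rewrite ler1n.
have cv : (\int[nu]_(s in Rpos) (psi n.+1%:R s)%:E @[n --> \oo] -->
    \int[nu]_(s in Rpos) 1)%E.
  pose g n s : \bar R := (psi n.+1%:R s)%:E.
  have -> : (\int[nu]_(s in Rpos) 1 = \int[nu]_(s in Rpos) limn (g ^~ s))%E.
    apply: eq_integral => s /set_mem sp; apply/esym/cvg_lim => //; move: sp.
    rewrite /= in_itv/= andbT => s0; apply: cvg_EFin; first exact: nearW.
    rewrite -[X in _ --> X]subr0; apply: cvgB; first exact: cvg_cst.
    have E : (fun n => expR (- (n.+1%:R * s))) =
        (fun z => expR (- (s * z))) \o (fun n => n.+1%:R : R).
      by apply/funext => n /=; rewrite mulrC.
    rewrite E; apply: (@cvg_comp _ _ _ (fun n => n.+1%:R : R) _ _ +oo).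
      by have := @cvgr_idn R; rewrite -cvg_shiftS.
    exact: cvg_expR_Ny.
  apply: (@cvg_monotone_convergence _ _ _ nu Rpos _ g) => //.
  - by move=> n; apply/measurable_EFinP; exact: mpsi.
  - by move=> n s sp; rewrite lee_fin psi_ge0.
  - move=> s sp m n mn; rewrite lee_fin lerD2l lerN2 ler_expR lerN2.
    move: sp; rewrite /= in_itv/= andbT => s0.
    by rewrite ler_wpM2r ?(ltW s0)// ler_nat.
have : (\int[nu]_(s in Rpos) 1 <= B%:E)%E.
  rewrite -(cvg_lim _ cv)//; apply: lime_le; first by apply/cvg_ex; eexists; exact: cv.
  apply: nearW => n; have := phiB n; rewrite -lee_fin; apply: le_trans.
  rewrite /phi /Rintegral fineK//; exact: integrable_fin_num (ipsi _).
by rewrite integral_cst// mul1e; case: levy => _ ->.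
Qed.

(** If phi l were 0, then phi would vanish at all larger points by the upper
    bound of laplace_exponent_le, and it is unbounded. *)
Lemma laplace_exponent_gt0 (l : R) : 0 < l -> 0 < phi l.
Proof.
move=> l0; have [l' l'1 l'0] := laplace_exponent_unbounded (phi l).
have ll' : l <= l'.
  rewrite leNgt; apply/negP => l'l; have l'gt0 : 0 < l' by exact: lt_le_trans l'1.
  have /andP[h _] := laplace_exponent_le l'gt0 (ltW l'l).
  by have := lt_le_trans l'0 h; rewrite ltxx.
have /andP[_] := laplace_exponent_le l0 ll'.
have : 0 <= phi l by apply: Rintegral_ge0 => s sp; apply: psi_ge0 => //; exact: ltW.
rewrite le_eqVlt => /predU1P[p0|//]; move: l'0; rewrite -p0 mulr0 => l'0.
by rewrite leNgt l'0.
Qed.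

Lemma laplace_exponent_continuous (x : R) : 0 < x -> {for x, continuous phi}.
Proof.
move=> x0; apply/cvgrPdist_le => e e0.
have phi0 y : 0 < y -> 0 <= phi y.
  by move=> y0; apply: Rintegral_ge0 => s sp; apply: psi_ge0 => //; exact: ltW.
pose d := Num.min (x / 2) (e * x / (2 * (phi x + 1))).
have p1 : 0 < phi x + 1 by rewrite ltr_wpDl ?phi0.
have d0 : 0 < d by rewrite lt_min !divr_gt0 ?mulr_gt0.
have bound u v : 0 < u -> u <= v -> `|phi v - phi u| <= (v - u) / u * phi u.
  move=> u0 uv; have /andP[h1 h2] := laplace_exponent_le u0 uv.
  rewrite ger0_norm ?subr_ge0// lerBlDr (le_trans h2)// le_eqVlt.
  by apply/orP; left; apply/eqP; field; rewrite gt_eqF.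
near=> y.
have yd : `|x - y| < d by near: y; exists d => //.
have [dx de] : d <= x / 2 /\ d <= e * x / (2 * (phi x + 1)).
  by rewrite /d !ge_min !lexx orbT.
have yx2 : x / 2 < y by move: yd; rewrite ltr_norml => /andP[? ?]; lra.
have y0 : 0 < y by rewrite (lt_trans _ yx2)// divr_gt0.
have key : `|x - y| * (2 * phi x) <= e * x.
  apply: (@le_trans _ _ (d * (2 * (phi x + 1)))).
    by apply: ler_pM; [by []|rewrite mulr_ge0// phi0|exact: ltW|rewrite ler_pM2l// lerDl].
  by rewrite -ler_pdivlMr// mulr_gt0.
have [xy|yx] := leP x y.
  rewrite distrC (le_trans (bound _ _ x0 xy))// mulrAC ler_pdivrMr//.
  rewrite -(ger0_norm (_ : 0 <= y - x)) ?subr_ge0// distrC.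
  apply: le_trans key; by rewrite ler_wpM2l// ler_peMl ?phi0// ler1n.
rewrite (le_trans (bound _ _ y0 (ltW yx)))// mulrAC ler_pdivrMr//.
have /andP[yxle _] := laplace_exponent_le y0 (ltW yx).
rewrite -(ger0_norm (_ : 0 <= x - y)) ?subr_ge0 ?(ltW yx)//.
apply: (@le_trans _ _ (`|x - y| * phi x)); first by rewrite ler_wpM2l.
apply: (@le_trans _ _ (e * (x / 2))); first by rewrite mulrA ler_pdivlMr// -mulrA [phi x * 2]mulrC.
by rewrite ler_wpM2l// ltW.
Unshelve. all: by end_near. Qed.

Lemma laplace_exponent_surj (m : R) : phi 1 <= m -> exists2 l : R, 0 < l & phi l = m.
Proof.
move=> m1; have [L L1 Lm] := laplace_exponent_unbounded m.
have cphi : {within `[1, L], continuous phi}.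
  apply: continuous_in_subspaceT => x; rewrite inE /= in_itv/= => /andP[x1 _].
  by apply: laplace_exponent_continuous; exact: lt_le_trans x1.
have [|l] := IVT L1 cphi (v := m).
  apply/andP; split; first by apply: le_trans m1; rewrite ge_min lexx.
  by apply: le_trans (ltW Lm) _; rewrite le_max lexx orbT.
rewrite in_itv/= => /andP[l1 _] lm; exists l => //.
exact: lt_le_trans l1.
Qed.

End bernstein_function.

(** * Pointwise values of Bochner integrals *)

Lemma Rintegral_eq0 (R : realType) (d : measure_display) (T : measurableType d)
    (m : {measure set T -> \bar R}) (D : set T) (h : T -> R) :
  (forall x, h x = 0) -> \int[m]_(x in D) h x = 0.
Proof.
move=> h0; rewrite (_ : h = cst 0); last exact/funext.
by rewrite /Rintegral integral0_eq.
Qed.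

Section continuous_valued.
Context {R : realType} {a b : R}.
Local Notation mu := (@lebesgue_measure R).
Implicit Types (D : set R) (s g v : R -> contI a b).

Lemma contI_measurable (c : contI a b) : measurable_fun (`[a, b] : set R) (c : R -> R).
Proof.
by apply: subspace_continuous_measurable_fun => //; exact: contI_continuous.
Qed.

Lemma normr_contI_le (c : contI a b) (x : R) : `|c x| <= `|c|.
Proof.
have [xab|xab] := boolP (x \in `[a, b]); first exact: sup_norm_ub.
by rewrite contI_out// normr0.
Qed.

Lemma cvg_contI_eval (T : Type) (F : set_system T) (FF : Filter F) (h : T -> contI a b)
    (c : contI a b) (x : R) : h @ F --> c -> h n x @[n --> F] --> c x.
Proof.
move=> hc; apply/cvgrPdist_le => e e0.
have /cvgrPdist_le/(_ _ e0) := hc.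
by apply: filterS => n; apply: le_trans; exact: (normr_contI_le (c - h n) x).
Qed.

Lemma simple_fun_measurable D s : measurable D -> simple_fun D s ->
  measurable_fun (`[a, b] `*` D : set (R * R)) (fun xt : R * R => s xt.2 xt.1).
Proof.
move=> mD [sf ms] _ Y mY.
rewrite (_ : _ `&` _ = \bigcup_(c in range s)
    ((`[a, b] `&` ((c : contI a b) : R -> R) @^-1` Y) `*` (D `&` s @^-1` [set c]))).
  apply: fin_bigcup_measurable => // c _; apply: measurableX; last exact: ms.
  by apply: (contI_measurable c).
apply/seteqP; split => [[x t] [[xab Dt] /= Yst]|[x t] [c _ [[xab /= Yc] [Dt sc]]]].
  by exists (s t) => //.
by split => //=; rewrite sc.
Qed.

(** Rectangles suffice for simple functions, because their values are
    continuous on [a, b]; the general case follows by passing to the limit. *)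
Lemma strongly_measurable_joint D v : measurable D -> strongly_measurable D v ->
  measurable_fun (`[a, b] `*` D : set (R * R)) (fun xt : R * R => v xt.2 xt.1).
Proof.
move=> mD [s [ss sv]].
apply: (@measurable_fun_cvg _ _ _ _ (fun n (xt : R * R) => s n xt.2 xt.1)).
  by move=> n; exact: simple_fun_measurable (ss n).
by move=> [x t] [_ Dt]; exact: cvg_contI_eval (sv _ Dt).
Qed.

Lemma strongly_measurable_eval D v (x : R) : measurable D -> strongly_measurable D v ->
  measurable_fun D (fun t => v t x).
Proof.
move=> mD mv; have [xab|xab] := boolP (x \in `[a, b]); last first.
  by under eq_fun do rewrite contI_out//; exact: measurable_cst.
exact: (@measurable_fun_section _ _ _ _ _ _ _ _
  (fun xt : R * R => v xt.2 xt.1) x _ _ (strongly_measurable_joint mD mv)).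
Qed.

Lemma simple_integral_eval D s (x : R) : measurable D -> simple_integrable D s ->
  mu.-integrable D (EFin \o (fun t => s t x)) /\
  \int[mu]_(t in D) s t x = simple_integral D s x.
Proof.
move=> mD [[sf ms] fs].
pose A (y : contI a b) := D `&` s @^-1` [set y].
pose term (y : contI a b) (t : R) : R := y x * \1_(A y) t.
have it y : mu.-integrable D (EFin \o term y) /\
    \int[mu]_(t in D) term y t = (fine (mu (A y)) *: y) x.
  have [->|y0] := eqVneq y 0.
    have E t : term 0 t = 0 by rewrite /term mul0r.
    split; first by apply: eq_integrable (integrable0 mu D) => // t _; rewrite /= E.
    rewrite scaler0; exact: Rintegral_eq0.
  have iA : mu.-integrable D (EFin \o \1_(A y)).
    apply/integrableP; split.
      by apply/measurable_EFinP; apply: measurable_indic; exact: ms.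
    under eq_integral do rewrite /= ger0_norm//.
    rewrite integral_indic//; last exact: ms.
    by rewrite /A setIAC setIid; exact: fs.
  split; first exact: integrable_scale.
  rewrite RintegralZl// mulrC /Rintegral integral_indic//; last exact: ms.
  by rewrite /A setIAC setIid.
have sumE l : mu.-integrable D (EFin \o (fun t => \sum_(y <- l) term y t)) /\
    \int[mu]_(t in D) (\sum_(y <- l) term y t) = (\sum_(y <- l) fine (mu (A y)) *: y) x.
  elim: l => [|y l [il El]].
    have E t : \sum_(y <- [::]) term y t = 0 by rewrite big_nil.
    split; first by apply: eq_integrable (integrable0 mu D) => // t _; rewrite /= E.
    rewrite big_nil; exact: Rintegral_eq0.
  have [iy Ey] := it y.
  have E t : \sum_(z <- y :: l) term z t = term y t + \sum_(z <- l) term z t.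
    by rewrite big_cons.
  split.
    by rewrite (funext E); exact: integrable_add.
  rewrite big_cons (@eq_Rintegral _ _ _ mu _ (fun t => term y t + \sum_(z <- l) term z t)).
    by rewrite RintegralD// Ey El.
  by move=> t _; rewrite E.
pose values := finmap.enum_fset (fset_set (range s)).
have sE t : D t -> \sum_(y <- values) term y t = s t x.
  move=> Dt; rewrite (bigD1_seq (s t)) ?finmap.fset_uniq//=; last first.
    by rewrite in_fset_set// inE; exists t.
  rewrite big1 ?addr0; first by rewrite /term indicE mem_set ?mulr1//.
  move=> y yst; rewrite /term indicE memNset ?mulr0//.
  by move=> [_ /= /esym/eqP]; exact/negP.
have [i1 i2] := sumE values.
split; first by apply: eq_integrable i1 => // t /set_mem Dt /=; rewrite sE.
rewrite /simple_integral fsbig_finite// -i2.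
by apply: eq_Rintegral => t /set_mem Dt; rewrite sE.
Qed.

End continuous_valued.

Section bochner.
Context {R : realType} {a b : R}.
Local Notation mu := (@lebesgue_measure R).

(** The integral of a nonnegative function is a supremum over the simple
    functions below it, hence monotone for arbitrary functions. The lemma is
    applied to the norm of a function with values in C([a, b]), whose
    measurability is not at hand. *)
Lemma ge0_le_integral_nonmeasurable (D : set R) (f g : R -> \bar R) :
  (forall x, D x -> (0 <= f x)%E) -> (forall x, D x -> (f x <= g x)%E) ->
  (\int[mu]_(x in D) f x <= \int[mu]_(x in D) g x)%E.
Proof.
move=> f0 fg; rewrite !ge0_integralE//; last first.
  by move=> x Dx; exact: le_trans (f0 _ Dx) (fg _ Dx).
apply: ereal_sup_le => _ [h /= hf <-]; exists h => // x.
apply: le_trans (hf x) _; rewrite /patch; case: ifPn => // /set_mem; exact: fg.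
Qed.

(** Evaluation at x is linear and decreases norms, so it commutes with the limit
    that defines the Bochner integral. *)
Lemma is_bochner_eval (D : set R) (g : R -> contI a b) (J : contI a b) (x : R) :
  measurable D -> is_bochner D g J ->
  mu.-integrable D (EFin \o (fun t => g t x)) /\ J x = \int[mu]_(t in D) g t x.
Proof.
move=> mD [mg [s [ss s0 sJ]]].
have mgx : measurable_fun D (fun t => g t x) by exact: strongly_measurable_eval.
have isx n := (simple_integral_eval x mD (ss n)).1.
have msx n : measurable_fun D (fun t => s n t x).
  by have /integrableP[/measurable_EFinP ? _] := isx n.
pose E n : \bar R := (\int[mu]_(t in D) (`|g t - s n t|)%:E)%E.
have ltE (e : R) : 0 < e -> \forall n \near \oo, (E n < e%:E)%E.
  move=> e0; apply: (s0 [set y : \bar R | (y < e%:E)%E]).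
  apply: open_nbhs_nbhs; split; first exact: open_ereal_lt_ereal.
  by rewrite /= lte_fin.
have dE n : (\int[mu]_(t in D) `|g t x - s n t x|%:E <= E n)%E.
  apply: ge0_le_integral_nonmeasurable => t _; rewrite lee_fin//.
  exact: (normr_contI_le (g t - s n t)).
have id n : (E n < +oo)%E -> mu.-integrable D (EFin \o (fun t => g t x - s n t x)).
  move=> En; apply/integrableP; split; last exact: le_lt_trans (dE n) En.
  by apply/measurable_EFinP; exact: measurable_funB mgx (msx n).
have igx : mu.-integrable D (EFin \o (fun t => g t x)).
  have [n En] := filter_ex (ltE 1 ltr01).
  have Eg : (fun t => g t x) = (fun t => (g t x - s n t x) + s n t x).
    by apply/funext => t; rewrite subrK.
  rewrite Eg; apply: integrable_add => //; apply: id; exact: lt_trans En (ltry _).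
split => //; apply: (@cvg_unique _ _ (simple_integral D (s n) x @[n --> \oo])).
- exact: norm_hausdorff.
- exact: cvg_contI_eval sJ.
apply/cvgrPdist_le => e e0; apply: filterS (ltE _ e0) => n En.
rewrite -(simple_integral_eval x mD (ss n)).2 -RintegralB//.
have idn := id n (lt_trans En (ltry _)).
have L : `|\int[mu]_(t in D) (g t x - s n t x)| <= \int[mu]_(t in D) `|g t x - s n t x|.
  exact: le_normr_Rintegral.
apply: le_trans L _.
rewrite -lee_fin; apply: le_trans (ltW En); apply: le_trans (dE n).
rewrite /Rintegral fineK// integrable_fin_num//; exact: (integrable_norm idn).
Qed.

End bochner.

(** * The Laplace transform of a subordinated function *)

Lemma integrable_obnd_cbnd (R : realType) (r : R) (b : itv_bound R) (h : R -> R) :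
  (@lebesgue_measure R).-integrable [set` Interval (BRight r) b] (EFin \o h) ->
  (@lebesgue_measure R).-integrable [set` Interval (BLeft r) b] (EFin \o h).
Proof.
move=> /integrableP[/measurable_EFinP mh ih]; apply/integrableP.
have mh' : measurable_fun [set` Interval (BLeft r) b] h.
  exact/measurable_fun_itv_obnd_cbndP.
split; first exact/measurable_EFinP.
rewrite -integral_itv_obnd_cbnd//.
by apply/measurable_EFinP; apply: measurableT_comp.
Qed.

Section subordination.
Context {R : realType}.
Variable nu : {measure set R -> \bar R}.
Hypothesis levy : levy_measure nu.
Context {d : measure_display} {T : measurableType d} {P : probability T R}.
Variables (sigma : R -> T -> R) (f : R -> R -> R).
Hypothesis Hf : inverse_density P (bernstein nu) sigma f.
Local Notation mu := (@lebesgue_measure R).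
Local Notation phi := (laplace_exponent nu).
Local Notation Rpos := (`]0, +oo[%classic : set R).

Let pos (x : R) : Rpos x -> 0 < x.
Proof. by rewrite /= in_itv/= andbT. Qed.

Lemma density_laplace_real (s lam : R) : 0 < s -> 0 < lam ->
  mu.-integrable Rpos (EFin \o (fun t => expR (- (lam * t)) * f s t)) /\
  \int[mu]_(t in Rpos) (expR (- (lam * t)) * f s t) =
  phi lam / lam * expR (- (phi lam * s)).
Proof.
move=> s0 lam0.
have E1 : (fun t : R => cexp (- (lam%:C * t%:C)) * (f s t)%:C) =
    (fun t => (expR (- (lam * t)) * f s t)%:C).
  apply/funext => t.
  by rewrite cexp_real -rmorphM.
have : cintegrable mu Rpos (fun t => cexp (- (lam%:C * t%:C)) * (f s t)%:C) /\
    cintegral mu Rpos (fun t => cexp (- (lam%:C * t%:C)) * (f s t)%:C) =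
    bernstein nu lam%:C / lam%:C * cexp (- (s%:C * bernstein nu lam%:C)).
  exact: (density_laplace Hf).
have E2 : bernstein nu lam%:C / lam%:C * cexp (- (s%:C * bernstein nu lam%:C)) =
    (phi lam / lam * expR (- (phi lam * s)))%:C.
  rewrite bernstein_real.
  by rewrite cexp_real -fmorph_div -rmorphM (mulrC s).
rewrite E2 E1 => -[[i1 _] [E _]]; split; [exact: i1|exact: E].
Qed.

(** The bound on c leaves the Laplace transform of the density at the real point
    lam, which is known and decays exponentially in s. *)
Lemma subordination_fubini (c h : R -> R) (lam M : R) : 0 < lam ->
    measurable_fun Rpos c -> (forall t, 0 < t -> `|c t| <= expR (- (lam * t))) ->
    measurable_fun Rpos h -> {ae mu, forall s, 0 <= s -> `|h s| <= M} ->
  [/\ mu.-integrable Rpos (EFin \o (fun s => \int[mu]_(t in Rpos) (c t * f s t * h s))),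
      mu.-integrable Rpos (EFin \o (fun t => \int[mu]_(s in Rpos) (c t * f s t * h s))) &
      \int[mu]_(s in Rpos) \int[mu]_(t in Rpos) (c t * f s t * h s) =
      \int[mu]_(t in Rpos) \int[mu]_(s in Rpos) (c t * f s t * h s)].
Proof.
move=> lam0 mc cb mh hM.
have phi0 := laplace_exponent_gt0 levy lam0.
pose F (st : R * R) : R := c st.2 * f st.1 st.2 * h st.1.
have mRpos : measurable Rpos by [].
have mF : measurable_fun (Rpos `*` Rpos) F.
  apply: measurable_funM; first apply: measurable_funM.
  - exact: measurable_fun_snd_setX.
  - exact: (density_measurable Hf).
  - exact: measurable_fun_fst_setX.
apply: (@Rintegral_fubini _ _ _ _ _ mu mu _ _ F) => //.
have mnF : measurable_fun (Rpos `*` Rpos) (fun z => `|F z|) by exact: measurableT_comp.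
pose M' := Num.max M 0.
have [ie Ee] := integral_expR phi0.
have iE : mu.-integrable Rpos (EFin \o (fun s => M' * (phi lam / lam * expR (- (phi lam * s))))).
  do 2 apply: integrable_scale => //.
  by apply: integrableS ie => //; apply: subset_itvr; rewrite bnd_simp.
have b0 s : 0 <= M' * (phi lam / lam * expR (- (phi lam * s))).
  by rewrite mulr_ge0// ?le_max ?lexx ?orbT// mulr_ge0 ?expR_ge0// divr_ge0// ltW.
apply: (@le_lt_trans _ _
    (\int[mu]_(s in Rpos) (M' * (phi lam / lam * expR (- (phi lam * s))))%:E)%E); last first.
  have /integrableP[_] := iE; apply: le_lt_trans.
  by apply: ge0_le_integral_nonmeasurable => // s _; rewrite ?lee_fin ?ler_norm.
apply: ae_ge0_le_integral => //.
- by move=> s _; exact: integral_ge0.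
- exact: (@measurable_inner_integral _ _ _ _ _ mu Rpos Rpos (fun z => `|F z|)).
- by move=> s _; rewrite lee_fin.
- by case/integrableP : iE.
apply: (@filterS _ _ (ae_filter_ringOfSetsType mu) _ _ _ hM) => s hs sp; have s0 := pos sp.
have [ifs Ef] := density_laplace_real s0 lam0.
have /(_ (ltW s0)) {}hs := hs.
apply: (@le_trans _ _ (\int[mu]_(t in Rpos) (M' * (expR (- (lam * t)) * f s t))%:E)%E).
  apply: ge0_le_integral_nonmeasurable => // t tp; have t0 := pos tp.
  have f0 := density_ge0 Hf s0 t0.
  rewrite lee_fin /F /= normrM mulrC ler_pM//; first by rewrite le_max hs.
  by rewrite normrM (ger0_norm f0) ler_wpM2r// cb.
rewrite (_ : (fun t => _) = EFin \o (fun t => M' * (expR (- (lam * t)) * f s t)))//.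
have im : mu.-integrable Rpos (EFin \o (fun t => M' * (expR (- (lam * t)) * f s t))).
  exact: integrable_scale.
rewrite -Ef -RintegralZl// /Rintegral fineK//.
exact: integrable_fin_num im.
Qed.

Lemma subordination_swap (c k h hPhi : R -> R) (lam M : R) : 0 < lam ->
    measurable_fun Rpos c -> (forall t, 0 < t -> `|c t| <= expR (- (lam * t))) ->
    (forall s, 0 < s -> mu.-integrable Rpos (EFin \o (fun t => c t * f s t)) /\
      \int[mu]_(t in Rpos) (c t * f s t) = k s) ->
    measurable_fun Rpos h -> {ae mu, forall s, 0 <= s -> `|h s| <= M} ->
    (forall t, 0 < t -> mu.-integrable Rpos (EFin \o (fun s => f s t * h s)) /\
      hPhi t = \int[mu]_(s in Rpos) (f s t * h s)) ->
  mu.-integrable Rpos (EFin \o (fun s => k s * h s)) /\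
  \int[mu]_(t in `[0, +oo[) (c t * hPhi t) = \int[mu]_(s in `[0, +oo[) (k s * h s).
Proof.
move=> lam0 mc cb ck mh hM hh; have mRpos : measurable Rpos by [].
have [i1 i2 E] := subordination_fubini lam0 mc cb mh hM.
have E1 s : Rpos s -> \int[mu]_(t in Rpos) (c t * f s t * h s) = k s * h s.
  move=> /pos s0; have [i e] := ck _ s0.
  by rewrite RintegralZr; [rewrite e|exact: measurable_itv|exact: i].
have E2 t : Rpos t -> \int[mu]_(s in Rpos) (c t * f s t * h s) = c t * hPhi t.
  move=> /pos t0; have [i e] := hh _ t0; rewrite e -RintegralZl; [|exact: measurable_itv|exact: i].
  by apply: eq_Rintegral => s _; rewrite mulrA.
have j1 : mu.-integrable Rpos (EFin \o (fun s => k s * h s)).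
  apply: eq_integrable i1 => [|s]; first exact: measurable_itv.
  by move=> /set_mem sp /=; rewrite E1.
have j2 : mu.-integrable Rpos (EFin \o (fun s => c s * hPhi s)).
  apply: eq_integrable i2 => [|s]; first exact: measurable_itv.
  by move=> /set_mem sp /=; rewrite E2.
split; first exact: j1.
rewrite -(Rintegral_itv_obnd_cbnd j1) -(Rintegral_itv_obnd_cbnd j2).
transitivity (\int[mu]_(t in Rpos) \int[mu]_(s in Rpos) (c t * f s t * h s)).
  by apply: eq_Rintegral => t /set_mem tp; rewrite E2.
by rewrite -E; apply: eq_Rintegral => t /set_mem tp; rewrite E1.
Qed.

(** Exchange the integrals in s and t: the integral in t is the Laplace
    transform of the density, which is the Laplace kernel at Phi l up to the
    factor Phi l / l. *)
Lemma subordination_laplace (h hPhi : R -> R) (l : R[i]) (M : R) : 0 < complex.Re l ->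
    measurable_fun Rpos h -> {ae mu, forall s, 0 <= s -> `|h s| <= M} ->
    (forall t, 0 < t -> mu.-integrable Rpos (EFin \o (fun s => f s t * h s)) /\
      hPhi t = \int[mu]_(s in Rpos) (f s t * h s)) ->
  claplace hPhi l = bernstein nu l / l * claplace h (bernstein nu l).
Proof.
move=> l0 mh hM hh; have mRpos : measurable Rpos by [].
pose C (t : R) := cexp (- (l * t%:C)).
pose K (s : R) := bernstein nu l / l * cexp (- (s%:C * bernstein nu l)).
have mC : cmeasurable Rpos C.
  apply: cmeasurable_cexp; have := @measurable_id _ R Rpos => mid.
  case: (l) => x y; split => /=.
    apply: (@eq_measurable_fun _ _ _ _ _ (fun t => - (x * t))).
      by move=> t _; rewrite mulr0 subr0.
    by apply: measurableT_comp => //; exact: measurable_funM.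
  apply: (@eq_measurable_fun _ _ _ _ _ (fun t => - (y * t))).
    by move=> t _; rewrite mulr0 add0r.
  by apply: measurableT_comp => //; exact: measurable_funM.
have nC t : Normc.normc (C t) = expR (- (complex.Re l * t)).
  by rewrite normc_cexp; congr expR; case: (l) => x y /=; rewrite mulr0 subr0.
have dl s : 0 < s -> cintegrable mu Rpos (fun t => C t * (f s t)%:C) /\
    cintegral mu Rpos (fun t => C t * (f s t)%:C) = K s.
  by move=> s0; exact: (density_laplace Hf).
have EF (c : R[i] -> R) (ct : forall z x, c (z * x%:C) = c z * x) (g : R -> R[i]) (u : R -> R) :
    (fun t => c (g t) * u t) = (fun t => c (g t * (u t)%:C)).
  by apply/funext => t; rewrite ct.
have [iR ER] : mu.-integrable Rpos (EFin \o (fun s => complex.Re (K s) * h s)) /\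
    \int[mu]_(t in `[0, +oo[) (complex.Re (C t) * hPhi t) =
    \int[mu]_(s in `[0, +oo[) (complex.Re (K s) * h s).
  apply: (subordination_swap l0 mC.1 _ _ mh hM hh).
    by move=> t _; rewrite -nC; exact: normc_Re.
  move=> s /dl[[i1 _] /(congr1 (@complex.Re R)) e1]; rewrite (EF _ (@ReM_real R) C (f s)).
  by split; [exact: i1|exact: e1].
have [iI EI] : mu.-integrable Rpos (EFin \o (fun s => complex.Im (K s) * h s)) /\
    \int[mu]_(t in `[0, +oo[) (complex.Im (C t) * hPhi t) =
    \int[mu]_(s in `[0, +oo[) (complex.Im (K s) * h s).
  apply: (subordination_swap l0 mC.2 _ _ mh hM hh).
    by move=> t _; rewrite -nC; exact: normc_Im.
  move=> s /dl[[_ i1] /(congr1 (@complex.Im R)) e1]; rewrite (EF _ (@ImM_real R) C (f s)).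
  by split; [exact: i1|exact: e1].
move: iR ER iI EI; rewrite (EF _ (@ReM_real R) K h) (EF _ (@ReM_real R) C hPhi)
  (EF _ (@ImM_real R) K h) (EF _ (@ImM_real R) C hPhi) => iR ER iI EI.
have -> : claplace hPhi l = cintegral mu `[0, +oo[ (fun s => K s * (h s)%:C).
  by rewrite /claplace /cintegral -ER -EI.
(* If the factor is 0 then both sides are; otherwise divide by it. *)
have [c0|c0] := eqVneq (bernstein nu l / l) 0.
  rewrite c0 mul0r /cintegral.
  by rewrite !Rintegral_eq0// => s; rewrite /K c0 !mul0r.
have ci : cintegrable mu `[0, +oo[ (fun s => K s * (h s)%:C).
  by split; exact: integrable_obnd_cbnd.
have [_ E] : cintegrable mu `[0, +oo[
      (fun s => (bernstein nu l / l)^-1 * (K s * (h s)%:C)) /\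
    cintegral mu `[0, +oo[ (fun s => (bernstein nu l / l)^-1 * (K s * (h s)%:C)) =
    (bernstein nu l / l)^-1 * cintegral mu `[0, +oo[ (fun s => K s * (h s)%:C).
  by apply: cintegralZl; [exact: measurable_itv|exact: ci].
rewrite (_ : claplace h _ =
    cintegral mu `[0, +oo[ (fun s => (bernstein nu l / l)^-1 * (K s * (h s)%:C))).
  by rewrite E mulrA divff// mul1r.
apply: eq_cintegral => s _; rewrite /K -(mulrA (bernstein nu l / l)) mulKf//.
by rewrite (mulrC (bernstein nu l)).
Qed.

Lemma is_SPhi_laplace (a b : R) (v vPhi : R -> contI a b) (x : R) (l : R[i]) :
    Linfty v -> is_SPhi f v vPhi -> 0 < complex.Re l ->
  claplace (fun t => vPhi t x) l =
  bernstein nu l / l * claplace (fun t => v t x) (bernstein nu l).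
Proof.
move=> [mv [M vM]] [_ Sv] l0; have mRpos : measurable Rpos by [].
apply: (@subordination_laplace _ _ _ M) => //.
- apply/measurable_fun_itv_obnd_cbndP.
  exact: strongly_measurable_eval.
- apply: (@filterS _ _ (ae_filter_ringOfSetsType mu) _ _ _ vM) => s vs s0.
  exact: le_trans (normr_contI_le _ _) (vs s0).
- by move=> t /Sv /(is_bochner_eval x mRpos).
Qed.

End subordination.

Lemma claplace_real (R : realType) (h : R -> R) (m : R) :
  claplace h m%:C =
  (\int[@lebesgue_measure R]_(t in `[0, +oo[) (expR (- (m * t)) * h t))%:C.
Proof.
have E t : cexp (- (m%:C * t%:C)) * (h t)%:C = (expR (- (m * t)) * h t)%:C.
  by rewrite cexp_real -rmorphM.
rewrite /claplace (_ : (fun t => _) = (fun t => (expR (- (m * t)) * h t)%:C)).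
  by rewrite /cintegral /= [X in _ +i* X]Rintegral_eq0.
by apply/funext => t; rewrite E.
Qed.

(** * Products of Fourier transforms on the half-line *)

Lemma cintegralZl_itv (R : realType) (i : interval R) (g : R -> R[i]) (c : R[i]) :
    cintegrable (@lebesgue_measure R) [set` i] g ->
  cintegrable (@lebesgue_measure R) [set` i] (fun x => c * g x) /\
  cintegral (@lebesgue_measure R) [set` i] (fun x => c * g x) =
  c * cintegral (@lebesgue_measure R) [set` i] g.
Proof. by move=> ig; apply: cintegralZl; [exact: measurable_itv|exact: ig]. Qed.

Section half_line_fourier.
Context {R : realType}.
Local Notation mu := (@lebesgue_measure R).
Local Notation D := (`[0, +oo[%classic : set R).
Implicit Types (g h : R -> R).

Definition half_fourier g (z : R) : R[i] :=
  cintegral mu D (fun s => (g s)%:C * cexp (0 +i* (- (z * s)))).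

Lemma claplace_fourier h (c z : R) :
  claplace h (c +i* z) = half_fourier (fun s => expR (- (c * s)) * h s) z.
Proof.
apply: eq_cintegral => s _; rewrite /cexp /=; simpc.
by rewrite expR0 !mul1r; congr (_ +i* _); ring.
Qed.

Lemma normc_character (c y : R) : Normc.normc (c%:C * cexp (0 +i* y)) = `|c|.
Proof. by rewrite Normc.normcM normc_real normc_cexp/= expR0 mulr1. Qed.

Lemma cmeasurable_character (d : measure_display) (T : measurableType d) (A : set T)
    (c y : T -> R) : measurable_fun A c -> measurable_fun A y ->
  cmeasurable A (fun s => (c s)%:C * cexp (0 +i* (y s))).
Proof.
move=> mc my; apply: cmeasurableM; first exact: cmeasurable_real.
by apply: cmeasurable_cexp; split => //=; exact: measurable_cst.
Qed.

Lemma cintegrable_character (d : measure_display) (T : measurableType d)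
    (m : {measure set T -> \bar R}) (A : set T) (c y : T -> R) : measurable A ->
    m.-integrable A (EFin \o c) -> measurable_fun A y ->
  cintegrable m A (fun s => (c s)%:C * cexp (0 +i* (y s))).
Proof.
move=> mA ic my; have /integrableP[/measurable_EFinP mc _] := ic.
apply: (@cintegrable_bound _ _ _ m A _ (fun s => `|c s|)) => //.
- exact: cmeasurable_character.
- exact: integrable_norm.
- by move=> s _; rewrite normc_character.
Qed.

Lemma measurable_opp_mul (c : R) : measurable_fun D (fun s => - (c * s)).
Proof. by apply: measurableT_comp => //; exact: measurable_funM. Qed.

(** Exchanging the two integrals leaves the integral over [- r, r] of
    exp (i z (t - s)). *)
Lemma half_fourier_truncated g (r t : R) : 0 <= r ->
    mu.-integrable D (EFin \o g) ->
  cintegrable mu `[- r, r] (fun z => cexp (0 +i* (z * t)) * half_fourier g z) /\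
  cintegral mu `[- r, r] (fun z => cexp (0 +i* (z * t)) * half_fourier g z) =
  (\int[mu]_(s in D) (g s * dirichlet r (t - s)))%:C.
Proof.
move=> r0 ig; have rr : - r <= r by rewrite (le_trans _ r0)// oppr_le0.
have mg : measurable_fun D g by case/integrableP : ig => /measurable_EFinP.
have mD : measurable D by [].
have mI : measurable (`[- r, r]%classic : set R) by [].
have iI : mu.-integrable `[- r, r] (EFin \o (fun=> 1)).
  by apply: continuous_itv_integrable => x; exact: cst_continuous.
pose f (zs : R * R) : R[i] := (g zs.2)%:C * cexp (0 +i* (zs.1 * (t - zs.2))).
have mf : cmeasurable (`[- r, r] `*` D) f.
  apply: cmeasurable_character; first exact: measurable_fun_snd_setX.
  apply: measurable_funTS; apply: measurable_funM; first exact: measurable_fst.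
  by apply: measurable_funB => //; exact: measurable_snd.
have inner z : cintegral mu D (fun s => f (z, s)) = cexp (0 +i* (z * t)) * half_fourier g z.
  have iz : cintegrable mu D (fun s => (g s)%:C * cexp (0 +i* (- (z * s)))).
    by apply: cintegrable_character => //; exact: measurable_opp_mul.
  have [_ <-] := cintegralZl_itv (cexp (0 +i* (z * t))) iz.
  apply: eq_cintegral => s _; rewrite /f /= [RHS]mulrCA -cexpD.
  by congr (_ * cexp _); simpc; congr (_ +i* _); ring.
have ign : mu.-integrable D (EFin \o (fun s => `|g s|)) by exact: (integrable_norm ig).
have [||||||i1 _ E] := @cintegral_fubini_bound _ _ _ _ _ mu mu `[- r, r] D f
  (fun=> 1) (fun s => `|g s|).
- exact: measurable_itv.
- exact: measurable_itv.
- exact: mf.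
- by move=> z s _ _; rewrite /f normc_character mul1r.
- exact: iI.
- exact: ign.
move: i1 E; rewrite (funext inner) => i1 ->; split => //.
have -> : (fun s => cintegral mu `[- r, r] (fun z => f (z, s))) =
    (fun s => (g s * dirichlet r (t - s))%:C).
  apply/funext => s; rewrite [RHS]rmorphM /= -dirichletE//.
  have ie : cintegrable mu `[- r, r] (fun z : R => cexp (0 +i* (z * (t - s)))).
    rewrite (_ : (fun z => _) = (fun z : R => 1%:C * cexp (0 +i* (z * (t - s))))).
      by apply: cintegrable_character => //; exact: measurable_funM.
    by apply/funext => z; rewrite mul1r.
  have [_ <-] := cintegralZl_itv (g s)%:C ie.
  by [].
by rewrite /cintegral /= [X in _ +i* X]Rintegral_eq0.
Qed.

Lemma normc_half_fourier_le g z : mu.-integrable D (EFin \o g) ->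
  Normc.normc (half_fourier g z) <= 2 * \int[mu]_(s in D) `|g s|.
Proof.
move=> ig; have ign : mu.-integrable D (EFin \o (fun s => `|g s|)) by exact: (integrable_norm ig).
have [mr mi] : cmeasurable D (fun s => (g s)%:C * cexp (0 +i* (- (z * s)))).
  apply: cmeasurable_character; last exact: measurable_opp_mul.
  by case/integrableP : ig => /measurable_EFinP.
have [|||_ br] := @Rintegral_le_bound _ _ _ mu D
  (fun s => complex.Re ((g s)%:C * cexp (0 +i* (- (z * s))))) (fun s => `|g s|) _ _ ign.
- exact: measurable_itv.
- exact: mr.
- by move=> s _; apply: le_trans (normc_Re _) _; rewrite normc_character.
have [|||_ bi] := @Rintegral_le_bound _ _ _ mu D
  (fun s => complex.Im ((g s)%:C * cexp (0 +i* (- (z * s))))) (fun s => `|g s|) _ _ ign.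
- exact: measurable_itv.
- exact: mi.
- by move=> s _; apply: le_trans (normc_Im _) _; rewrite normc_character.
have normc_le (u : R[i]) : Normc.normc u <= `|complex.Re u| + `|complex.Im u|.
  case: u => x y /=; have s0 : 0 <= `|x| + `|y| by rewrite addr_ge0.
  rewrite -[leRHS](ger0_norm s0) -sqrtr_sqr ler_wsqrtr// sqrrD.
  by rewrite !real_normK ?num_real// addrAC lerDl mulrn_wge0// mulr_ge0.
by apply: le_trans (normc_le _) _; rewrite mulr2n mulrDl mul1r lerD.
Qed.

Lemma ler_dist_cos (x y : R) : `|cos x - cos y| <= `|x - y|.
Proof.
wlog xy : x y / x <= y.
  by move=> h; case: (leP x y) => [/h //|/ltW /h]; rewrite distrC [leRHS]distrC.
have [c _ E] := @MVT_segment R cos (fun x => - sin x) x y xy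
  (fun x _ => is_derive_cos x) (continuous_subspaceT (@continuous_cos R)).
rewrite distrC E (distrC x) normrM normrN ler_piMl// sin_max//.
Qed.

(** The kernel is an integral of cosines, and cos (z x) is r-Lipschitz in x for
    z in [- r, r]. *)
Lemma dirichlet_lipschitz (r x y : R) : 0 <= r ->
  `|dirichlet r x - dirichlet r y| <= 2 * r ^+ 2 * `|x - y|.
Proof.
move=> r0; have rr : - r <= r by rewrite (le_trans _ r0)// oppr_le0.
have ic (u : R) : mu.-integrable `[- r, r] (EFin \o (fun z => cos (z * u))).
  by apply: continuous_itv_integrable; exact: continuous_cosM.
have E (u : R) : dirichlet r u = \int[mu]_(z in `[- r, r]) cos (z * u).
  have /(congr1 (@complex.Re R)) /= <- := dirichletE u r0.
  by apply: eq_Rintegral => z _; rewrite expR0 mul1r.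
rewrite !E -RintegralB//.
have icst : mu.-integrable `[- r, r] (EFin \o (fun=> r * `|x - y|)).
  by apply: continuous_itv_integrable => u; exact: cst_continuous.
have [|||_] := @Rintegral_le_bound _ _ _ mu `[- r, r]
  (fun z => cos (z * x) - cos (z * y)) (fun=> r * `|x - y|) _ _ icst.
- exact: measurable_itv.
- have /integrableP[/measurable_EFinP mx _] := ic x.
  have /integrableP[/measurable_EFinP my _] := ic y.
  exact: measurable_funB.
- move=> z /=; rewrite in_itv/= -ler_norml => zr.
  by apply: le_trans (ler_dist_cos _ _) _; rewrite -mulrBr normrM ler_wpM2r.
move=> h; apply: le_trans h _; rewrite Rintegral_cst//.
rewrite [X in fine X]lebesgue_measure_itv/= lte_fin.
case: ltP => _ /=; last by rewrite mulr0 !mulr_ge0// sqr_ge0.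
by rewrite le_eqVlt; apply/orP; left; apply/eqP; ring.
Qed.

Section truncated_convolution.
Variables (p q : R -> R) (r : R).
Hypotheses (ip : mu.-integrable D (EFin \o p)) (iq : mu.-integrable D (EFin \o q)).
Hypothesis r0 : 0 <= r.

Definition dirichlet_mean (t : R) : R := \int[mu]_(s in D) (q s * dirichlet r (t - s)).

Lemma dirichlet_mean_integrable t :
  mu.-integrable D (EFin \o (fun s => q s * dirichlet r (t - s))) /\
  `|dirichlet_mean t| <= 2 * r * \int[mu]_(s in D) `|q s|.
Proof.
have mq : measurable_fun D q by case/integrableP : iq => /measurable_EFinP.
have iqn : mu.-integrable D (EFin \o (fun s => 2 * r * `|q s|)).
  by apply: integrable_scale => //; exact: (integrable_norm iq).
have [|||i b] := @Rintegral_le_bound _ _ _ mu D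
  (fun s => q s * dirichlet r (t - s)) (fun s => 2 * r * `|q s|) _ _ iqn.
- exact: measurable_itv.
- apply: measurable_funM => //; apply: measurable_funTS.
  have mp : measurable_fun setT (fun s : R => (r, t - s)).
    by apply: measurable_fun_pair; [exact: measurable_cst|exact: measurable_funB].
  exact: (measurableT_comp (@dirichlet_measurable R) mp).
- by move=> s _; rewrite normrM mulrC ler_wpM2r// dirichlet_le.
split => //; apply: le_trans b _.
by rewrite RintegralZl//; exact: (integrable_norm iq).
Qed.

Lemma dirichlet_mean_continuous : continuous dirichlet_mean.
Proof.
have ign : mu.-integrable D (EFin \o (fun s => `|q s|)) by exact: (integrable_norm iq).
pose L := 2 * r ^+ 2 * \int[mu]_(s in D) `|q s|.
have L0 : 0 <= L by rewrite !mulr_ge0 ?sqr_ge0//; exact: Rintegral_ge0.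
have lip t u : `|dirichlet_mean t - dirichlet_mean u| <= L * `|t - u|.
  have [it _] := dirichlet_mean_integrable t.
  have [iu _] := dirichlet_mean_integrable u.
  rewrite /dirichlet_mean -RintegralB//.
  have iB : mu.-integrable D (EFin \o (fun s => 2 * r ^+ 2 * `|t - u| * `|q s|)).
    exact: integrable_scale.
  have [|||_] := @Rintegral_le_bound _ _ _ mu D
    (fun s => q s * dirichlet r (t - s) - q s * dirichlet r (u - s)) _ _ _ iB.
  - exact: measurable_itv.
  - have /integrableP[/measurable_EFinP mt _] := it.
    have /integrableP[/measurable_EFinP mu' _] := iu.
    exact: measurable_funB.
  - move=> s _; rewrite -mulrBr normrM mulrC ler_wpM2r//.
    apply: le_trans (dirichlet_lipschitz _ _ r0) _.
    by rewrite (_ : t - s - (u - s) = t - u)//; ring.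
  move=> h; apply: le_trans h _; rewrite RintegralZl//.
  by rewrite le_eqVlt; apply/orP; left; apply/eqP; rewrite /L; ring.
have L1 : 0 < L + 1 by rewrite ltr_wpDl.
move=> t; apply/cvgrPdist_le => e e0; near=> u.
apply: le_trans (lip t u) _; apply: (@le_trans _ _ ((L + 1) * `|t - u|)).
  by rewrite ler_wpM2r// lerDl.
rewrite -ler_pdivlMl// mulrC; apply: ltW; near: u.
by exists (e / (L + 1)) => //=; rewrite divr_gt0.
Unshelve. all: by end_near. Qed.

(** A truncated convolution of transforms is the transform of a product: the
    integral in z meets p only through exp (i z s) p s, and turns q into its
    Dirichlet mean at s. *)
Lemma half_fourier_product w :
  mu.-integrable D (EFin \o (fun s => p s * dirichlet_mean s)) /\
  cintegral mu `[- r, r] (fun z => half_fourier p (w - z) * half_fourier q z) =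
  half_fourier (fun s => p s * dirichlet_mean s) w.
Proof.
have ipn : mu.-integrable D (EFin \o (fun s => `|p s|)) by exact: (integrable_norm ip).
have mp : measurable_fun D p by case/integrableP : ip => /measurable_EFinP.
pose B := 2 * \int[mu]_(s in D) `|q s|.
pose f (zs : R * R) : R[i] :=
  half_fourier q zs.1 * ((p zs.2)%:C * cexp (0 +i* (- ((w - zs.1) * zs.2)))).
have mq : cmeasurable `[- r, r] (half_fourier q).
  have [/cintegrable_cmeasurable + _] := half_fourier_truncated 0 r0 iq.
  rewrite (_ : (fun z => _) = half_fourier q)//; apply/funext => z.
  by rewrite mulr0 cexp_im cos0 sin0 mul1r.
have mI : measurable (`[- r, r]%classic : set R) by [].
have mD : measurable D by [].
have mf : cmeasurable (`[- r, r] `*` D) f.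
  apply: cmeasurableM.
    case: mq => m1 m2; split.
      exact: (@measurable_fun_fst_setX _ _ _ _ _ _ _ _ (fun z => complex.Re (half_fourier q z))).
    exact: (@measurable_fun_fst_setX _ _ _ _ _ _ _ _ (fun z => complex.Im (half_fourier q z))).
  apply: cmeasurable_character; first exact: measurable_fun_snd_setX.
  apply: measurable_funTS; apply: measurableT_comp => //.
  apply: measurable_funM; last exact: measurable_snd.
  by apply: measurable_funB => //; exact: measurable_fst.
have iB : mu.-integrable `[- r, r] (EFin \o (fun=> B)).
  by apply: continuous_itv_integrable => u; exact: cst_continuous.
have [||||||_ _ E] := @cintegral_fubini_bound _ _ _ _ _ mu mu `[- r, r] D f
  (fun=> B) (fun s => `|p s|).
- exact: measurable_itv.
- exact: measurable_itv.
- exact: mf.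
- move=> z s _ _; rewrite /f Normc.normcM normc_character ler_wpM2r//.
  exact: normc_half_fourier_le.
- exact: iB.
- exact: ipn.
have E1 z : cintegral mu D (fun s => f (z, s)) = half_fourier p (w - z) * half_fourier q z.
  have iz : cintegrable mu D (fun s => (p s)%:C * cexp (0 +i* (- ((w - z) * s)))).
    by apply: cintegrable_character; [exact: measurable_itv|exact: ip|exact: measurable_opp_mul].
  by have [_ E1] := cintegralZl_itv (half_fourier q z) iz; rewrite [RHS]mulrC -E1.
have E2 s : cintegral mu `[- r, r] (fun z => f (z, s)) =
    (p s * dirichlet_mean s)%:C * cexp (0 +i* (- (w * s))).
  have [ic ec] := half_fourier_truncated s r0 iq.
  have [_ E2] := cintegralZl_itv ((p s)%:C * cexp (0 +i* (- (w * s)))) ic.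
  rewrite [(p s * _)%:C]rmorphM /= mulrAC -ec -E2.
  apply: eq_cintegral => z _; rewrite /f /= [LHS]mulrC mulrA; congr (_ * _).
  by rewrite -[RHS]mulrA -cexpD; congr (_ * cexp _); simpc; congr (_ +i* _); ring.
split; last by move: E; rewrite (funext E1) (funext E2).
have iM : mu.-integrable D (EFin \o (fun s => 2 * r * (\int[mu]_(s in D) `|q s|) * `|p s|)).
  exact: integrable_scale.
have [|||iM' _] := @Rintegral_le_bound _ _ _ mu D (fun s => p s * dirichlet_mean s) _ _ _ iM.
- exact: measurable_itv.
- apply: measurable_funM; first exact: mp.
  by apply: measurable_funTS; exact: continuous_measurable_fun dirichlet_mean_continuous.
- move=> s _; rewrite normrM mulrC; apply: ler_wpM2r; first exact: normr_ge0.
  by have [] := dirichlet_mean_integrable s.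
- exact: iM'.
Qed.

End truncated_convolution.

End half_line_fourier.

(** * The value of the operator *)

Lemma integrable_sub (R : realType) (d : measure_display)
    (T : measurableType d) (m : {measure set T -> \bar R}) (D : set T)
    (g h : T -> R) : measurable D -> m.-integrable D (EFin \o g) ->
    m.-integrable D (EFin \o h) ->
  m.-integrable D (EFin \o (fun x => g x - h x)).
Proof.
move=> mD ig ih.
by apply: eq_integrable (integrableB mD ig ih) => // x _; rewrite /= EFinB.
Qed.

Lemma cvg_Rintegral_symmetric (R : realType) (F : R -> R) :
    (@lebesgue_measure R).-integrable setT (EFin \o F) ->
  \int[@lebesgue_measure R]_(x in `[- r, r]) F x @[r --> +oo] -->
  \int[@lebesgue_measure R]_x F x.
Proof.
set mu := @lebesgue_measure R => iF.
have mF : measurable_fun setT F by case/integrableP : iF => /measurable_EFinP.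
have inF : mu.-integrable setT (EFin \o (fun x => `|F x|)) by exact: (integrable_norm iF).
pose f_ (n : nat) : R -> R := (fun x => `|F x|) \_ `[- n%:R, n%:R].
have mf_ n : measurable_fun setT (f_ n).
  by apply/(measurable_restrictT _ _).1 => //; apply: measurable_funTS; exact: measurableT_comp.
have f_F n x : 0 <= f_ n x <= `|F x|.
  by rewrite /f_ patchE; case: ifP; rewrite ?lexx ?normr_ge0.
have [|||||_ cf] := @Rintegral_dominated_cvg _ _ _ mu setT f_ (fun x => `|F x|) (fun x => `|F x|).
- exact: measurableT.
- exact: mf_.
- move=> x _; apply: cvg_near_cst; near=> n; rewrite /f_ patchE mem_set//=.
  rewrite in_itv/= -ler_norml; near: n; exact: nbhs_infty_ger.
- exact: inF.
- by move=> n x _; have /andP[f0 f1] := f_F n x; rewrite ger0_norm.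
apply/cvgrPdist_le => e e0.
have /cvgrPdist_le/(_ _ e0) [n _ /(_ n (leqnn n)) en] := cf.
near=> r.
have nr : n%:R <= r by near: r; apply: nbhs_pinfty_ge; rewrite num_real.
rewrite [X in _ - X]Rintegral_mkcond.
have ir : mu.-integrable setT (EFin \o (F \_ `[- r, r])).
  by rewrite -restrict_EFin; apply/(integrable_mkcond _ _).1 => //; exact: integrableS iF.
have in_ : mu.-integrable setT (EFin \o f_ n).
  have [] := @Rintegral_le_bound _ _ _ mu setT (f_ n) (fun x => `|F x|) measurableT (mf_ n) inF.
    by move=> x _; have /andP[f0 f1] := f_F n x; rewrite ger0_norm.
  by [].
rewrite -RintegralB//.
have iB : mu.-integrable setT (EFin \o (fun x => `|F x| - f_ n x)) by exact: integrable_sub.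
have [|||_ b] := @Rintegral_le_bound _ _ _ mu setT (fun x => F x - (F \_ `[- r, r]) x) _ _ _ iB.
- exact: measurableT.
- by apply: measurable_funB => //; case/integrableP : ir => /measurable_EFinP.
- move=> x _; rewrite /f_ !patchE; case: ifPn => xr; case: ifPn => xn.
  + by rewrite !subrr normr0.
  + by rewrite subrr normr0 subr0.
  + have := set_mem xn; rewrite /= in_itv/= => /andP[x1 x2].
    by move: xr; rewrite notin_setE /= in_itv/= (le_trans _ x1) ?lerN2// (le_trans x2).
  + by rewrite !subr0.
apply: le_trans b _; rewrite RintegralB//.
by apply: le_trans en; exact: ler_norm.
Unshelve. all: by end_near. Qed.

(** Damping dV and h turns their Laplace transforms on vertical lines into
    Fourier transforms. The two weights and the factor exp (c1 t) of the operator
    cancel. *)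
Section operator_value.
Context {R : realType}.
Local Notation mu := (@lebesgue_measure R).
Local Notation D := (`[0, +oo[%classic : set R).
Variables (Phi : R[i] -> R[i]) (dV : R -> R) (c1 c2 : R) (psi hb : R[i] -> R[i]).
Variables (l : R[i]) (h : R -> R).
Let p (s : R) := expR (- ((c1 - c2) * s)) * dV s.
Let q (s : R) := expR (- (c2 * s)) * h s.
Hypotheses (ip : mu.-integrable D (EFin \o p)) (iq : mu.-integrable D (EFin \o q)).
Hypothesis dV_continuous : forall t : R, 0 < t -> {for t, continuous dV}.
Hypothesis dV_neq0 : forall t : R, 0 < t -> dV t != 0.
Hypothesis h_continuous : forall t : R, 0 < t -> {for t, continuous h}.
Hypothesis pull : forall z, Lhat_pullback c2 psi hb z = claplace h (c2 +i* z).
Hypothesis dom : Lhat_domain Phi dV c1 c2 psi hb l.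

Let kappa := dirichlet_mean q.

Let weight_continuous (g : R -> R) (c t : R) : {for t, continuous g} ->
  {for t, continuous (fun s => expR (- (c * s)) * g s)}.
Proof.
by move=> ct; apply: (@cvgM _ _ _ _ (fun s => expR (- (c * s)))) => //; exact: continuous_expRNM.
Qed.

Lemma Lhat_wE (t r w : R) : 0 < r ->
  Lhat_w dV c1 c2 psi hb t r w =
  (expR (c1 * t))%:C * (cexp (0 +i* (w * t)) * half_fourier (fun s => p s * kappa r s) w).
Proof.
move=> r0; rewrite /Lhat_w mulrA; congr (_ * _).
  by rewrite /cexp; simpc => /=; rewrite expR0 !mul1r [t * c1]mulrC [t * w]mulrC.
rewrite -(half_fourier_product ip iq (ltW r0) w).2.
by apply: eq_cintegral => z _; rewrite /Lhat_z pull !claplace_fourier.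
Qed.

(** The integral over the line is the limit of the integrals over [- r', r'],
    to which Fourier inversion applies. *)
Lemma Lhat_rE (t r : R) : 0 < t -> 0 < r ->
  Lhat_r dV c1 c2 psi hb t r = (expR (c1 * t) * (2 * pi * (p t * kappa r t)))%:C.
Proof.
move=> t0 r0; pose g s := p s * kappa r s.
have ig : mu.-integrable D (EFin \o g) := (half_fourier_product ip iq (ltW r0) 0).1.
have gt : {for t, continuous g}.
  apply: (@cvgM _ _ _ _ p (kappa r)); last exact: (dirichlet_mean_continuous iq (ltW r0)).
  exact/weight_continuous/dV_continuous.
have [iR iI] := Lhat_w_integrable dom t0 r0.
have E (r' : R) : 0 <= r' -> cintegral mu `[- r', r'] (Lhat_w dV c1 c2 psi hb t r) =
    (expR (c1 * t) * \int[mu]_(s in D) (g s * dirichlet r' (t - s)))%:C.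
  move=> r'0; have [ic ec] := half_fourier_truncated t r'0 ig.
  rewrite [RHS]rmorphM /= -ec; have [_ <-] := cintegralZl_itv (expR (c1 * t))%:C ic.
  by apply: eq_cintegral => w _; rewrite Lhat_wE.
rewrite /Lhat_r /cintegral; congr (_ +i* _).
- have cR := cvg_Rintegral_symmetric iR.
  have cJ : \int[mu]_(s in D) (g s * dirichlet r' (t - s)) @[r' --> +oo] -->
      expR (- (c1 * t)) * \int[mu]_w complex.Re (Lhat_w dV c1 c2 psi hb t r w).
    apply: cvg_trans; last exact: (@cvgMl_tmp _ _ _ _ _ (expR (- (c1 * t))) _ cR).
    apply: near_eq_cvg; near=> r'.
    have r'0 : 0 <= r' by near: r'; apply: nbhs_pinfty_ge; rewrite num_real.
    have /(congr1 (@complex.Re R)) /= -> := E r' r'0.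
    by rewrite mulrA -expRD addNr expR0 mul1r.
  have <- := dirichlet_inversion ig t0 gt cJ.
  by rewrite mulrA -expRD addrN expR0 mul1r.
have cI := cvg_Rintegral_symmetric iI.
have c0 : \int[mu]_(w in `[- r', r']) complex.Im (Lhat_w dV c1 c2 psi hb t r w)
    @[r' --> +oo] --> (0 : R).
  apply: cvg_near_cst; near=> r'.
  have r'0 : 0 <= r' by near: r'; apply: nbhs_pinfty_ge; rewrite num_real.
  by have /(congr1 (@complex.Im R)) /= -> := E r' r'0.
exact: (cvg_unique (@norm_hausdorff _ _) cI c0).
Unshelve. all: by end_near. Qed.

Lemma cvg_complex_parts (T : Type) (F : set_system T) (FF : Filter F) (u : T -> R[i])
    (L : R[i]) : (u x : R[i]^o) @[x --> F] --> (L : R[i]^o) ->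
  complex.Re (u x) @[x --> F] --> complex.Re L /\
  complex.Im (u x) @[x --> F] --> complex.Im L.
Proof.
move=> uL.
have key (e : R) : 0 < e -> \forall x \near F, Normc.normc (L - u x) <= e.
  move=> e0; have e0' : 0 < e%:C by rewrite ltcR.
  have /cvgrPdist_le/(_ _ e0') := uL.
  by apply: filterS => x ux; rewrite -lecR; exact: ux.
split; apply/cvgrPdist_le => e /key; apply: filterS => x; apply: le_trans.
  by rewrite -raddfB; exact: normc_Re.
by rewrite -raddfB; exact: normc_Im.
Qed.

(** The factor exp (c1 t) p t is nonzero, so the Dirichlet means of q converge
    at t, and Fourier inversion applies a second time. *)
Lemma lim_Lhat_rE (t : R) : 0 < t ->
  lim (Lhat_r dV c1 c2 psi hb t r @[r --> +oo]) = (4 * pi ^+ 2 * (dV t * h t))%:C.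
Proof.
move=> t0; set L := lim _.
have cL : Lhat_r dV c1 c2 psi hb t r @[r --> +oo] --> L := Lhat_r_cvg dom t0.
have [cR cI] := cvg_complex_parts _ cL.
have pt0 : expR (c1 * t) * (2 * pi * p t) != 0.
  have e0 (x : R) : expR x != 0 by rewrite gt_eqF ?expR_gt0.
  have pi0 : pi != 0 :> R by rewrite gt_eqF ?pi_gt0.
  by rewrite !mulf_neq0 ?pnatr_eq0 ?e0 ?dV_neq0.
have cK : kappa r t @[r --> +oo] -->
    (expR (c1 * t) * (2 * pi * p t))^-1 * complex.Re L.
  apply: cvg_trans; last first.
    exact: (@cvgMl_tmp _ _ _ _ _ (expR (c1 * t) * (2 * pi * p t))^-1 _ cR).
  apply: near_eq_cvg; near=> r.
  have r0 : 0 < r by near: r; apply: nbhs_pinfty_gt; rewrite num_real.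
  rewrite Lhat_rE//=; apply: (mulfI pt0); rewrite mulVKf//; ring.
have eq2 := dirichlet_inversion iq t0 (weight_continuous (c := c2) (h_continuous t0)) cK.
have eR : complex.Re L = 4 * pi ^+ 2 * (dV t * h t).
  rewrite -[LHS](mulVKf pt0) eq2 /p /q.
  have e1 : expR (c1 * t) * expR (- ((c1 - c2) * t)) * expR (- (c2 * t)) = 1.
    by rewrite -!expRD -[RHS]expR0; congr expR; ring.
  rewrite [LHS](_ : _ = expR (c1 * t) * expR (- ((c1 - c2) * t)) * expR (- (c2 * t)) *
    (4 * pi ^+ 2 * (dV t * h t))); last by ring.
  by rewrite e1 mul1r.
have eI : complex.Im L = 0.
  have c0 : complex.Im (Lhat_r dV c1 c2 psi hb t r) @[r --> +oo] --> (0 : R).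
    apply: cvg_near_cst; near=> r.
    have r0 : 0 < r by near: r; apply: nbhs_pinfty_gt; rewrite num_real.
    by rewrite Lhat_rE.
  exact: (cvg_unique (@norm_hausdorff _ _) cI c0).
by rewrite -eR; move: eI; case: (L) => x y /= ->.
Unshelve. all: by end_near. Qed.

Lemma LhatE : Lhat Phi dV c1 c2 psi hb l = claplace (fun t => dV t * h t) (Phi l).
Proof.
have E t : 0 < t -> Lhat_t Phi dV c1 c2 psi hb l t =
    (4 * pi ^+ 2)%:C * (cexp (- (Phi l * t%:C)) * (dV t * h t)%:C).
  by move=> t0; rewrite /Lhat_t lim_Lhat_rE// rmorphM /= mulrCA.
have c0 : (4 * pi ^+ 2 : R)%:C != 0.
  by rewrite (inj_eq (@complexI R)) mulf_neq0 ?sqrf_eq0 ?gt_eqF ?pi_gt0.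
pose G (t : R) : R[i] := cexp (- (Phi l * t%:C)) * (dV t * h t)%:C.
have pos (t : R) : t \in `]0, +oo[%classic -> 0 < t by rewrite inE /= in_itv/= andbT.
have GE : (fun t => (4 * pi ^+ 2)%:C^-1 * ((4 * pi ^+ 2)%:C * G t)) = G.
  by apply/funext => t; rewrite mulKf.
have [iR iI] : cintegrable mu `]0, +oo[ G.
  rewrite -GE.
  have [iR iI] := Lhat_t_integrable dom.
  apply: (cintegralZl_itv _ _).1; split.
    by apply: eq_integrable iR => [|t /pos t0]; [exact: measurable_itv|rewrite E].
  by apply: eq_integrable iI => [|t /pos t0]; [exact: measurable_itv|rewrite E].
have -> : claplace (fun t => dV t * h t) (Phi l) = cintegral mu `]0, +oo[ G.
  rewrite /claplace /cintegral -(Rintegral_itv_obnd_cbnd iR).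
  by rewrite -(Rintegral_itv_obnd_cbnd iI).
have [_ EZ] := cintegralZl_itv (4 * pi ^+ 2)%:C (conj iR iI : cintegrable mu _ G).
rewrite /Lhat (_ : cintegral mu `]0, +oo[ _ =
    cintegral mu `]0, +oo[ (fun t => (4 * pi ^+ 2)%:C * G t)).
  by rewrite EZ fmorphV mulKf.
by apply: eq_cintegral => t /= ; rewrite in_itv/= andbT => t0; rewrite E.
Qed.

End operator_value.

(** * Twofold integration of derivatives along a segment *)

Lemma ae_dense (R : realType) (Q : R -> Prop) (a b : R) : a < b ->
  {ae @lebesgue_measure R, forall t, Q t} -> exists2 t, a < t < b & Q t.
Proof.
move=> ab [N [mN N0 QN]]; apply: contrapT => nQ.
have abN : `]a, b[ `<=` N.
  move=> t /=; rewrite in_itv/= => tab; apply: QN => Qt; apply: nQ; exists t => //.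

have : (@lebesgue_measure R `]a, b[ <= @lebesgue_measure R N)%E.
  by apply: le_measure => //; rewrite inE.
by rewrite N0 lebesgue_measure_itv/= lte_fin ab -EFinB lee_fin leNgt subr_gt0 ab.
Qed.

Lemma integrable_ae_bounded (R : realType) (g h : R -> R) (M : R) :
    (@lebesgue_measure R).-integrable `[0, +oo[ (EFin \o g) ->
    measurable_fun (`[0, +oo[ : set R) h ->
    {ae @lebesgue_measure R, forall t, 0 <= t -> `|h t| <= M} ->
  (@lebesgue_measure R).-integrable `[0, +oo[ (EFin \o (fun t => g t * h t)).
Proof.
move=> ig mh hM; pose M' := Num.max M 0.
have /integrableP[/measurable_EFinP mg _] := ig.
have mD : measurable (`[0, +oo[%classic : set R) by [].
have : (@lebesgue_measure R).-integrable `[0, +oo[ (EFin \o (fun t => M' * `|g t|)).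
  by apply: integrable_scale => //; exact: (integrable_norm ig).
move=> iM; have /integrableP[/measurable_EFinP mM Moo] := iM.
apply/integrableP; split; first by apply/measurable_EFinP; exact: measurable_funM.
apply: le_lt_trans Moo; apply: ae_ge0_le_integral => //.
- by apply/measurable_EFinP; apply: measurableT_comp => //; exact: measurable_funM.
- by apply/measurable_EFinP; apply: measurableT_comp.
apply: (@filterS _ _ (ae_filter_ringOfSetsType _) _ _ _ hM) => t ht /=.
rewrite in_itv/= andbT => /ht {}ht.
rewrite lee_fin normrM normrM normr_id mulrC ler_wpM2r//.
rewrite (@ger0_norm _ M') /M'; last by rewrite le_max lexx orbT.
by rewrite le_max ht.
Qed.

Section derivative_on_segment.
Context {R : realType}.
Implicit Types (a b : R) (F : R -> R).

(** The real counterpart of is_derive_seg. *)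
Definition seg_derivative a b F (x D : R) : Prop :=
  (F y - F x) / (y - x) @[y --> within [set` `[a, b]] x^'] --> D.

Lemma seg_derivative_eps a b F (x D e : R) : seg_derivative a b F x D -> 0 < e ->
  exists2 d : R, 0 < d & forall y, y \in `[a, b] -> `|x - y| < d ->
    `|F y - F x - D * (y - x)| <= e * `|y - x|.
Proof.
move=> FD e0; have /cvgrPdist_le/(_ _ e0) := FD.
rewrite near_withinE => -[d /= d0 Fd]; exists d => // y yab xy.
have [->|yx] := eqVneq y x; first by rewrite !subrr mulr0 subr0 normr0 mulr0.
have yx0 : y - x != 0 by rewrite subr_eq0.
have := Fd y xy yx yab.
rewrite -(ler_pM2r (_ : 0 < `|y - x|)) ?normr_gt0// -normrM.
by rewrite mulrBl divfK// distrC.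
Qed.

Lemma seg_derivative_continuous a b F (D : R -> R) :
    (forall x, x \in `[a, b] -> seg_derivative a b F x (D x)) ->
  {within `[a, b], continuous F}.
Proof.
move=> dF; apply/subspace_continuousP => x xab.
apply/cvgrPdist_le => e e0.
have [d d0 Fd] := seg_derivative_eps (dF _ xab) ltr01.
pose d' := Num.min d (e / (1 + `|D x|)).
have D1 : 0 < 1 + `|D x| by rewrite ltr_wpDr.
have d'0 : 0 < d' by rewrite lt_min d0 divr_gt0.
rewrite near_withinE; exists d' => // y xy yab.
have /andP[yd ye] : (`|x - y| < d) && (`|x - y| < e / (1 + `|D x|)) by rewrite -lt_min.
change (`|F x - F y| <= e).
have h := Fd _ yab yd.
apply: (@le_trans _ _ ((1 + `|D x|) * `|x - y|)); last first.
  by rewrite -ler_pdivlMl// mulrC ltW.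
rewrite distrC (_ : F y - F x = (F y - F x - D x * (y - x)) + D x * (y - x)); last by ring.
apply: le_trans (ler_normD _ _) _.
by rewrite normrM mulrDl distrC [`|x - y|]distrC lerD// distrC.
Qed.

Lemma seg_derivative_is_derive a b F (x D : R) : a < x < b ->
  seg_derivative a b F x D -> is_derive x 1 F D.
Proof.
move=> /andP[ax xb] dF.
suff cq : h^-1 *: (F (h *: 1 + x) - F x) @[h --> 0^'] --> D.
  by apply: DeriveDef; [apply/cvg_ex; exists D; exact: cq|apply/cvg_lim => //; exact: cq].
apply/cvgrPdist_le => e e0; have [d d0 Fd] := seg_derivative_eps dF e0.
have m0 : 0 < Num.min d (Num.min (x - a) (b - x)) by rewrite !lt_min d0 !subr_gt0 ax xb.
exists (Num.min d (Num.min (x - a) (b - x))) => //= h.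
rewrite /ball_ /= sub0r normrN !lt_min => /andP[hd /andP[h1 h2]] h0.
rewrite /GRing.scale /= mulr1.
have hab : h + x \in `[a, b].
  by rewrite in_itv/=; move: h1 h2; rewrite !ltr_norml => /andP[? ?] /andP[? ?];
    apply/andP; split; lra.
have := Fd (h + x) hab; rewrite addrK opprD addrCA subrr addr0 normrN => /(_ hd).
rewrite -(ler_pM2l (_ : 0 < `|h^-1|)) ?normr_gt0 ?invr_neq0// -normrM mulrCA -normrM.
by rewrite mulVf// normr1 mulr1 mulrBr mulrCA mulVf// mulr1 distrC.
Qed.

(** Taylor's formula at a with integral remainder: A y + (x - y) B y has
    derivative (x - y) C y. It takes the values A x at x and 0 at a. *)
Lemma seg_double_integral a b (A B C : R -> R) :
    (forall x, x \in `[a, b] -> seg_derivative a b A x (B x)) ->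
    (forall x, x \in `[a, b] -> seg_derivative a b B x (C x)) ->
    {within `[a, b], continuous C} -> A a = 0 -> B a = 0 ->
  forall x, x \in `[a, b] -> A x = \int[@lebesgue_measure R]_(y in `[a, x]) ((x - y) * C y).
Proof.
move=> dA dB cC A0 B0 x; rewrite in_itv/= le_eqVlt => /andP[/predU1P[<- _|ax xb]].
  by rewrite set_itv1 Rintegral_set1.
have sub : `[a, x] `<=` `[a, b] by apply: subset_itvl; rewrite bnd_simp.
have cl : {within `[a, x], continuous (fun y => x - y)}.
  by apply: continuous_subspaceT => z; apply: cvgB; [exact: cvg_cst|exact: cvg_id].
have wcont (g : R -> R) : {within `[a, b], continuous g} ->
    {within `[a, x], continuous (fun y => (x - y) * g y)}.
  move=> /(continuous_subspaceW sub) cg y; apply: (@cvgM _ _ _ _ (fun y => x - y) g).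
    exact: cl.
  exact: cg.
pose F y := A y + (x - y) * B y.
have cF : {within `[a, x], continuous F}.
  have cA := continuous_subspaceW sub (seg_derivative_continuous dA).
  have cB := wcont _ (seg_derivative_continuous dB).
  by move=> y; exact: cvgD (cA y) (cB y).
have dF y : y \in `]a, x[ -> is_derive y 1 F ((x - y) * C y).
  rewrite in_itv/= => /andP[ay yx]; have yb := lt_le_trans yx xb.
  have yab : y \in `[a, b] by rewrite in_itv/= !ltW.
  have dAy : is_derive y 1 A (B y).
    by apply: (@seg_derivative_is_derive a b); rewrite ?ay//; exact: dA.
  have dBy : is_derive y 1 B (C y).
    by apply: (@seg_derivative_is_derive a b); rewrite ?ay//; exact: dB.
  apply: is_derive_eq; rewrite /GRing.scale /=; ring.
have [_ Fa Fx] := (continuous_within_itvP F ax).1 cF.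
have LR : derivable_oo_LRcontinuous F a x by split => // y /dF[].
have dE : {in `]a, x[, F^`()%classic =1 (fun y => (x - y) * C y)}.
  by move=> y yax; rewrite derive1E; have [] := dF _ yax.
rewrite /Rintegral (continuous_FTC2 ax (wcont _ cC) LR dE) -EFinB /=.
by rewrite /F A0 B0 subrr mul0r mulr0 !addr0 subr0.
Qed.

End derivative_on_segment.

(** * The damped equation *)

(** Exchange the integrals over the region s <= t: the integral in t over
    [s, +oo[ is m^-1 exp (- (m s)). *)
Lemma laplace_primitive (R : realType) (k : R -> R) (m : R) : 0 < m ->
    (@lebesgue_measure R).-integrable `[0, +oo[ (EFin \o k) ->
  (@lebesgue_measure R).-integrable `[0, +oo[ (EFin \o (fun t =>
    expR (- (m * t)) * \int[@lebesgue_measure R]_(s in `[0, t]) k s)) /\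
  \int[@lebesgue_measure R]_(t in `[0, +oo[)
    (expR (- (m * t)) * \int[@lebesgue_measure R]_(s in `[0, t]) k s) =
  m^-1 * \int[@lebesgue_measure R]_(s in `[0, +oo[) (expR (- (m * s)) * k s).
Proof.
move=> m0 ik; pose mu := @lebesgue_measure R; pose D : set R := `[0, +oo[%classic.
have mk : measurable_fun D k by case/integrableP : ik => /measurable_EFinP.
have [ie _] := integral_expR m0.
have T1 s : 0 <= s -> \int[@lebesgue_measure R]_(t in `[s, +oo[) (k s * expR (- (m * t))) =
    m^-1 * (expR (- (m * s)) * k s).
  move=> s0; rewrite RintegralZl//; first by rewrite (integral_expR_tail s m0).2; ring.
  by apply: integrableS ie => //; apply: subset_itvr; rewrite bnd_simp.
have T2 (t : R) : \int[@lebesgue_measure R]_(s in `[0, t]) (expR (- (m * t)) * k s) =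
    expR (- (m * t)) * \int[@lebesgue_measure R]_(s in `[0, t]) k s.
  by rewrite RintegralZl//; apply: integrableS ik => //; apply: subset_itvl; rewrite bnd_simp.
have T3 : \int[@lebesgue_measure R]_(s in `[0, +oo[) (m^-1 * (expR (- (m * s)) * k s)) =
    m^-1 * \int[@lebesgue_measure R]_(s in `[0, +oo[) (expR (- (m * s)) * k s).
  have ikn : (@lebesgue_measure R).-integrable `[0, +oo[ (EFin \o (fun s => `|k s|)).
    exact: (integrable_norm ik).
  rewrite RintegralZl//; apply: (le_integrable _ _ _ ikn) => //.
  - apply/measurable_EFinP; apply: measurable_funM => //; apply: measurable_funTS.
    by apply: continuous_measurable_fun; exact: continuous_expRNM.
  - move=> s; rewrite /= in_itv/= andbT => s0; rewrite lee_fin normr_id normrM ler_piMl//.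
    by rewrite ger0_norm ?expR_ge0// -expR0 ler_expR oppr_le0 mulr_ge0// ltW.
pose f (st : R * R) : R := if st.1 <= st.2 then expR (- (m * st.2)) * k st.1 else 0.
have mD : measurable D by exact: measurable_itv.
have mDD : measurable (D `*` D) by exact: measurableX.
have mf : measurable_fun (D `*` D) f.
  apply: measurable_fun_if.
  - exact: mDD.
  - by apply: measurable_funTS; apply: measurable_fun_ler;
      [exact: measurable_fst|exact: measurable_snd].
  - apply: (@measurable_funS _ _ _ _ (D `*` D)); first exact: mDD.
      by move=> ? [].
    apply: measurable_funM; last exact: measurable_fun_fst_setX.
    apply: (@measurable_fun_snd_setX _ _ _ _ _ _ D D (fun t => expR (- (m * t)))) => //.
    apply: measurable_funTS.
    by apply: continuous_measurable_fun; exact: continuous_expRNM.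
  - exact: measurable_cst.
have ikn : mu.-integrable D (EFin \o (fun s => `|k s|)) by exact: (integrable_norm ik).
have [||||||_ i2 E] := @Rintegral_fubini_bound _ _ _ _ _ mu mu D D f
  (fun s => `|k s|) (fun t => expR (- (m * t))).
- exact: measurable_itv.
- exact: measurable_itv.
- exact: mf.
- move=> s t _ _; rewrite /f /=; case: ifP => _; last by rewrite normr0 mulr_ge0 ?expR_ge0.
  by rewrite normrM (ger0_norm (expR_ge0 _)) mulrC.
- exact: ikn.
- exact: ie.
have E1 s : D s -> \int[mu]_(t in D) f (s, t) = m^-1 * (expR (- (m * s)) * k s).
  rewrite /D /= in_itv/= andbT => s0.
  have -> : (fun t => f (s, t)) = (fun t => k s * expR (- (m * t))) \_ `[s, +oo[.
    apply/funext => t; rewrite /f patchE /= mem_setE in_itv/= andbT.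
    by case: ifP => //; rewrite mulrC.
  rewrite -Rintegral_mkcondr (_ : D `&` _ = `[s, +oo[%classic); last first.
    apply/seteqP; split => t; rewrite /D /= !in_itv/= !andbT; first by case.
    by move=> st; split => //; exact: le_trans st.
  exact: T1.
have E2 t : D t -> \int[mu]_(s in D) f (s, t) = expR (- (m * t)) * \int[mu]_(s in `[0, t]) k s.
  rewrite /D /= in_itv/= andbT => t0.
  have -> : (fun s => f (s, t)) = (fun s => expR (- (m * t)) * k s) \_ `]-oo, t].
    by apply/funext => s; rewrite /f patchE /= mem_setE in_itv/=; case: ifP.
  rewrite -Rintegral_mkcondr (_ : D `&` _ = `[0, t]%classic); last first.
    apply/seteqP; split => s; rewrite /D /= !in_itv/= andbT; first by case=> -> ->.
    by case/andP.
  exact: T2.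
split.
  by apply: eq_integrable i2 => [|t /set_mem tD]; [exact: measurable_itv|rewrite /= E2].
transitivity (\int[mu]_(t in D) \int[mu]_(s in D) f (s, t)).
  by apply: eq_Rintegral => t /set_mem tD; rewrite E2.
rewrite -E -T3; apply: eq_Rintegral => s /set_mem sD; exact: E1.
Qed.

Lemma laplace_integrable_itv (R : realType) (k : R -> R) (m t : R) : 0 <= m ->
    (@lebesgue_measure R).-integrable `[0, +oo[ (EFin \o (fun s => expR (- (m * s)) * k s)) ->
  (@lebesgue_measure R).-integrable `[0, t] (EFin \o k).
Proof.
move=> m0 i; set mu := @lebesgue_measure R.
have it : mu.-integrable `[0, t] (EFin \o (fun s => expR (- (m * s)) * k s)).
  by apply: integrableS i => //; apply: subset_itvl; rewrite bnd_simp.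
have itn : mu.-integrable `[0, t] (EFin \o (fun s => expR (m * t) *
    `|expR (- (m * s)) * k s|)).
  by apply: integrable_scale => //; exact: (integrable_norm it).
have /integrableP[/measurable_EFinP mt _] := it.
apply: le_integrable itn => //.
- have -> : k = (fun s => expR (m * s) * (expR (- (m * s)) * k s)).
    by apply/funext => s; rewrite mulrA -expRD addrN expR0 mul1r.
  apply/measurable_EFinP; apply: measurable_funM => //; apply: measurable_funTS.
  by apply: continuous_measurable_fun => y; apply: continuous_comp;
    [exact: mulrl_continuous|exact: continuous_expR].
- move=> s; rewrite /= in_itv/= => /andP[s0 st]; rewrite lee_fin.
  rewrite [leRHS]ger0_norm ?mulr_ge0 ?expR_ge0//.
  rewrite normrM (ger0_norm (expR_ge0 _)) mulrA -expRD ler_peMl//.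
  by rewrite -expR0 ler_expR subr_ge0 ler_wpM2l.
Qed.

Lemma cvg_within_seq (R : realType) (A : set R) (f : R -> R) (x l : R) :
    (forall s : nat -> R, (forall n, A (s n)) -> s n @[n --> \oo] --> x ->
      f (s n) @[n --> \oo] --> l) ->
  f y @[y --> within A (nbhs x)] --> l.
Proof.
move=> fs; apply/cvgrPdist_le => e e0; apply: contrapT => nP.
have bad (n : nat) : exists y, [/\ A y, `|x - y| < n.+1%:R^-1 & ~ `|l - f y| <= e].
  apply: contrapT => nex; apply: nP; rewrite near_withinE.
  exists n.+1%:R^-1; first by rewrite /= invr_gt0.
  by move=> y xy Ay; apply: contrapT => ny; apply: nex; exists y.
have [s sP] := choice bad.
have sx : s n @[n --> \oo] --> x.
  apply/cvgrPdist_le => d d0; near=> n.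
  have [_ /ltW xs _] := sP n; apply: le_trans xs _.
  apply: ltW; near: n; exact: (near_infty_natSinv_lt (PosNum d0)).
have /cvgrPdist_le/(_ _ e0)[n _ /(_ n (leqnn n))] : f (s n) @[n --> \oo] --> l.
  by apply: fs => // n; have [] := sP n.
by have [_ _] := sP n.
Unshelve. all: by end_near. Qed.

Section damped_uniqueness.
Context {R : realType}.
Local Notation mu := (@lebesgue_measure R).
Local Notation D := (`[0, +oo[%classic : set R).
Variables (a b : R) (dV : R -> R) (u : R -> R -> R) (M : R).
Hypothesis dV_int : mu.-integrable D (EFin \o dV).
Hypothesis u_joint : measurable_fun (`[a, b] `*` D : set (R * R)) (fun xt : R * R => u xt.2 xt.1).
Hypothesis u_le : forall t x, 0 <= t -> `|u t x| <= M.
Hypothesis u_continuous_x : forall t, {within `[a, b], continuous (u t)}.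

Let mD : measurable D. Proof. exact: measurable_itv. Qed.

Let M0 : 0 <= M. Proof. exact: le_trans (u_le 0 (lexx 0)). Qed.

Let mux x : x \in `[a, b] -> measurable_fun D (u^~ x).
Proof.
move=> xab.
exact: (@measurable_fun_section _ _ _ _ _ _ `[a, b] D (fun xt : R * R => u xt.2 xt.1) x).
Qed.

Lemma weighted_integrable (g : R -> R) (x : R) : x \in `[a, b] ->
  mu.-integrable D (EFin \o g) -> mu.-integrable D (EFin \o (fun t => g t * u t x)).
Proof.
move=> xab ig; apply: (@integrable_ae_bounded _ g (u^~ x) M) => //; first exact: mux.
by apply: aeW => t; exact: u_le.
Qed.

Definition weighted_primitive (x t : R) : R := \int[mu]_(s in `[0, t]) (dV s * u s x).

(** The function of x with second derivative u t that vanishes at a together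
    with its first derivative. *)
Definition double_primitive (x t : R) : R := \int[mu]_(y in `[a, x]) ((x - y) * u t y).

Lemma laplace_continuous_x (m : R) : 0 < m ->
  {within `[a, b], continuous (fun x => \int[mu]_(t in D) (expR (- (m * t)) * u t x))}.
Proof.
move=> m0; have [ie _] := integral_expR m0.
have ieM : mu.-integrable D (EFin \o (fun t => M * expR (- (m * t)))) by exact: integrable_scale.
have me : measurable_fun D (fun t => expR (- (m * t))).
  by apply: measurable_funTS; apply: continuous_measurable_fun; exact: continuous_expRNM.
apply/subspace_continuousP => x xab.
apply: cvg_within_seq => s sab sx.
have sab' n : s n \in `[a, b] := sab n.
have [|||||_ cv] := @Rintegral_dominated_cvg _ _ _ mu D
  (fun n t => expR (- (m * t)) * u t (s n)) (fun t => expR (- (m * t)) * u t x)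
  (fun t => M * expR (- (m * t))).
- exact: mD.
- by move=> n; apply: measurable_funM => //; exact: mux (sab' n).
- move=> t _; apply: cvgMl_tmp.
  have /subspace_continuousP/(_ x xab) := @u_continuous_x t.
  apply: (cvg_comp s) => P wP.
  have sP : \forall n \near \oo, `[a, b]%classic (s n) -> P (s n) := sx _ wP.
  change (\forall n \near \oo, P (s n)).
  by apply: filterS sP => n h; exact: h (sab n).
- exact: ieM.
- move=> n t; rewrite /= in_itv/= andbT => t0.
  by rewrite normrM ger0_norm ?expR_ge0// mulrC ler_wpM2r ?expR_ge0// u_le.
exact: cv.
Qed.

Lemma double_primitive_integrable (x t : R) : x \in `[a, b] ->
  mu.-integrable `[a, x] (EFin \o (fun y => (x - y) * u t y)).
Proof.
rewrite in_itv/= => /andP[ax xb].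
apply: continuous_compact_integrable; first exact: segment_compact.
have sub : `[a, x] `<=` `[a, b] by apply: subset_itvl; rewrite bnd_simp.
have cl : {within `[a, x], continuous (fun y => x - y)}.
  by apply: continuous_subspaceT => z; apply: cvgB; [exact: cvg_cst|exact: cvg_id].
have cu := continuous_subspaceW sub (@u_continuous_x t).
by move=> y; exact: cvgM (cl y) (cu y).
Qed.

Lemma laplace_double_primitive (x m : R) : x \in `[a, b] -> 0 < m ->
  mu.-integrable D (EFin \o (fun t => expR (- (m * t)) * double_primitive x t)) /\
  \int[mu]_(t in D) (expR (- (m * t)) * double_primitive x t) =
  \int[mu]_(y in `[a, x]) ((x - y) * \int[mu]_(t in D) (expR (- (m * t)) * u t y)).
Proof.
move=> xab m0; have := xab; rewrite in_itv/= => /andP[ax xb].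
have [ie _] := integral_expR m0.
have sub : `[a, x] `<=` `[a, b] by apply: subset_itvl; rewrite bnd_simp.
have T1 y : y \in `[a, b] -> \int[mu]_(t in D) ((x - y) * (expR (- (m * t)) * u t y)) =
    (x - y) * \int[mu]_(t in D) (expR (- (m * t)) * u t y).
  by move=> yab; rewrite RintegralZl//; exact: weighted_integrable.
have T2 t : \int[mu]_(y in `[a, x]) (expR (- (m * t)) * ((x - y) * u t y)) =
    expR (- (m * t)) * double_primitive x t.
  by rewrite RintegralZl//; exact: double_primitive_integrable.
have mI : measurable (`[a, x]%classic : set R) by exact: measurable_itv.
have mID : measurable (`[a, b] `*` D : set (R * R)).
  by apply: measurableX => //; exact: measurable_itv.
pose f (yt : R * R) : R := (x - yt.1) * (expR (- (m * yt.2)) * u yt.2 yt.1).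
have mf : measurable_fun (`[a, x] `*` D) f.
  apply: measurable_funM.
    by apply: measurable_funTS; apply: measurable_funB => //; exact: measurable_fst.
  apply: measurable_funM; last first.
    by apply: measurable_funS u_joint => // -[y t] [/= /sub].
  apply: (@measurable_fun_snd_setX _ _ _ _ _ _ `[a, x] D (fun t => expR (- (m * t)))) => //.
  by apply: measurable_funTS; apply: continuous_measurable_fun; exact: continuous_expRNM.
have ic : mu.-integrable `[a, x] (EFin \o (fun=> (b - a) * M)).
  by apply: continuous_itv_integrable => ?; exact: cst_continuous.
have [||||||_ i2 E] := @Rintegral_fubini_bound _ _ _ _ _ mu mu `[a, x] D f
  (fun=> (b - a) * M) (fun t => expR (- (m * t))).
- exact: mI.
- exact: mD.
- exact: mf.
- move=> y t; rewrite /= !in_itv/= andbT => /andP[ay yx] t0; rewrite /f /= normrM normrM.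
  rewrite (ger0_norm (expR_ge0 _)) mulrCA mulrC; apply: ler_wpM2r; first exact: expR_ge0.
  by apply: ler_pM => //; [rewrite ger0_norm; lra|exact: u_le].
- exact: ic.
- exact: ie.
have E2 t : \int[mu]_(y in `[a, x]) f (y, t) = expR (- (m * t)) * double_primitive x t.
  by rewrite -T2; apply: eq_Rintegral => y _; rewrite /f /= mulrCA.
split; first by move: i2; rewrite (funext E2).
move: E; rewrite (funext E2) => <-; apply: eq_Rintegral => y /set_mem yax.
by rewrite -T1//; exact: sub.
Qed.

Section with_equation.
Variable m0 : R.
Hypothesis m0_gt0 : 0 < m0.
Hypothesis equation : forall m, m0 <= m -> exists B : R -> R,
  [/\ forall x, x \in `[a, b] -> seg_derivative a b
        (fun y => \int[mu]_(t in D) (expR (- (m * t)) * (dV t * u t y))) x (B x),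
      forall x, x \in `[a, b] -> seg_derivative a b B x
        (2 * m * \int[mu]_(t in D) (expR (- (m * t)) * u t x)),
      \int[mu]_(t in D) (expR (- (m * t)) * (dV t * u t a)) = 0 &
      B a = 0].

Definition defect (x t : R) : R := 2 * double_primitive x t - weighted_primitive x t.

(** The equation integrated twice in x reads
    L[dV u](m) = 2 m L[double_primitive](m), and dividing by m turns the left side
    into the transform of weighted_primitive. *)
Lemma laplace_defect (x m : R) : x \in `[a, b] -> m0 <= m ->
  mu.-integrable D (EFin \o (fun s => expR (- (m * s)) * defect x s)) /\
  \int[mu]_(s in D) (expR (- (m * s)) * defect x s) = 0.
Proof.
move=> xab m0m.
have idVu : mu.-integrable D (EFin \o (fun t => dV t * u t x)) by exact: weighted_integrable.
have m_gt0 := lt_le_trans m0_gt0 m0m.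
have [i1 E1] := laplace_double_primitive xab m_gt0.
have [i2 E2] := laplace_primitive m_gt0 idVu.
have i1' : mu.-integrable D (EFin \o (fun s => 2 * (expR (- (m * s)) * double_primitive x s))).
  exact: integrable_scale.
have EE : (fun s => expR (- (m * s)) * defect x s) =
    (fun s => 2 * (expR (- (m * s)) * double_primitive x s) -
      expR (- (m * s)) * weighted_primitive x s).
  by apply/funext => s; rewrite /defect mulrBr mulrCA.
rewrite EE; split; first exact: integrable_sub.
rewrite RintegralB// RintegralZl// E1 E2.
have [B [dA dB A0 B0]] := equation m0m.
have cU : {within `[a, b], continuous
    (fun x => 2 * m * \int[mu]_(t in D) (expR (- (m * t)) * u t x))}.
  have cU := laplace_continuous_x m_gt0.
  by move=> y; apply: cvgMl_tmp; exact: cU.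
rewrite (seg_double_integral dA dB cU A0 B0 xab).
have iU : mu.-integrable `[a, x] (EFin \o (fun y =>
    (x - y) * \int[mu]_(t in D) (expR (- (m * t)) * u t y))).
  apply: continuous_compact_integrable; first exact: segment_compact.
  have sub : `[a, x] `<=` `[a, b].
    by move: xab; rewrite in_itv/= => /andP[ax xb]; apply: subset_itvl; rewrite bnd_simp.
  have cl : {within `[a, x], continuous (fun y => x - y)}.
    by apply: continuous_subspaceT => z; apply: cvgB; [exact: cvg_cst|exact: cvg_id].
  have cu := continuous_subspaceW sub (laplace_continuous_x m_gt0).
  by move=> y; exact: cvgM (cl y) (cu y).
have -> : (fun y => (x - y) * (2 * m * \int[mu]_(t in D) (expR (- (m * t)) * u t y))) =
    (fun y => 2 * m * ((x - y) * \int[mu]_(t in D) (expR (- (m * t)) * u t y))).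
  by apply/funext => y; rewrite mulrCA.
rewrite RintegralZl//.
by rewrite [2 * m]mulrC -mulrA mulKf ?subrr// gt_eqF.
Qed.

Lemma primitive_defect (x t : R) : x \in `[a, b] -> 0 <= t ->
  \int[mu]_(s in `[0, t]) defect x s = 0.
Proof.
move=> xab t0; apply: (@laplace_unique _ _ m0) => //; first exact: ltW.
- by have [] := laplace_defect xab (lexx m0).
- by move=> m /(laplace_defect xab)[].
Qed.

Lemma defect_integrable (x t : R) : x \in `[a, b] ->
  mu.-integrable `[0, t] (EFin \o defect x).
Proof.
move=> xab; apply: (@laplace_integrable_itv _ _ m0); first exact: ltW.
by have [] := laplace_defect xab (lexx m0).
Qed.

Section with_order.
Variable T : R.
Hypothesis T0 : 0 <= T.
Hypothesis u_ge0 : forall t x, x \in `[a, b] -> 0 <= t -> 0 <= u t x.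
Hypothesis u_nonincreasing : forall s t x, x \in `[a, b] -> T <= s -> s <= t ->
  u t x <= u s x.
Hypothesis dV_gt0 : forall t : R, 0 < t -> 0 < dV t.
Hypothesis dV_continuous : forall t : R, 0 < t -> {for t, continuous dV}.
Hypothesis u_continuous_t : forall t x : R, x \in `[a, b] -> 0 < t ->
  {for t, continuous (u^~ x)}.

Let dVu_itv (x t : R) : x \in `[a, b] ->
  mu.-integrable `[0, t] (EFin \o (fun s => dV s * u s x)).
Proof.
move=> xab; apply: integrableS (weighted_integrable xab dV_int) => //.
by apply: subset_itvl; rewrite bnd_simp.
Qed.

Lemma weighted_primitiveB (x s t : R) : x \in `[a, b] -> 0 <= s -> s <= t ->
  weighted_primitive x t - weighted_primitive x s =
  \int[mu]_(r in `]s, t]) (dV r * u r x).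
Proof.
by move=> xab s0 st; apply: Rintegral_itvB => //; exact: dVu_itv.
Qed.

Let dVu_ge0 (x s : R) : x \in `[a, b] -> 0 < s -> 0 <= dV s * u s x.
Proof. by move=> xab s0; rewrite mulr_ge0 ?u_ge0 ?ltW ?dV_gt0. Qed.

Lemma weighted_primitive_le (x s t : R) : x \in `[a, b] -> 0 <= s -> s <= t ->
  weighted_primitive x s <= weighted_primitive x t.
Proof.
move=> xab s0 st; rewrite -subr_ge0 weighted_primitiveB//.
apply: Rintegral_ge0 => r; rewrite /= in_itv/= => /andP[sr _].
by apply: dVu_ge0 => //; exact: le_lt_trans sr.
Qed.

(** The integrand is nonnegative, and positive near r unless u r x = 0. *)
Lemma weighted_primitive_flat (x s r t : R) : x \in `[a, b] -> 0 <= s -> s < r -> r < t ->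
  weighted_primitive x t <= weighted_primitive x s -> u r x = 0.
Proof.
move=> xab s0 sr rt; have st : s <= t by rewrite ltW// (lt_trans sr).
have r0 : 0 < r by exact: le_lt_trans sr.
rewrite -subr_le0 weighted_primitiveB// => I0.
apply/eqP; rewrite eq_le u_ge0 ?(ltW r0)// andbT leNgt; apply/negP => ur.
pose s' := (s + r) / 2.
have [ss' s'r] : s < s' /\ s' < r by rewrite /s'; split; lra.
have s't : `[s', t] `<=` `]s, t].
  by move=> z /=; rewrite !in_itv/= => /andP[s'z ->]; rewrite andbT (lt_le_trans ss').
have i1 : mu.-integrable `]s, t] (EFin \o (fun s => dV s * u s x)).
  apply: integrableS (dVu_itv t xab) => // z; rewrite /= !in_itv/= => /andP[sz ->].
  by rewrite andbT ltW// (le_lt_trans s0).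
have pos : 0 < \int[mu]_(z in `[s', t]) (dV z * u z x).
  apply: (@Rintegral_gt0 _ _ _ _ r); first by rewrite s'r.
  - apply: (@cvgM _ _ _ _ dV (u^~ x)); [exact: dV_continuous|exact: u_continuous_t].
  - by rewrite mulr_gt0// dV_gt0.
  - move=> z; rewrite in_itv/= => /andP[s'z _]; apply: dVu_ge0 => //.
    by apply: lt_le_trans s'z; exact: le_lt_trans ss'.
  - by apply: integrableS i1.
have le1 : \int[mu]_(z in `[s', t]) (dV z * u z x) <= \int[mu]_(z in `]s, t]) (dV z * u z x).
  apply: le_Rintegral_subset => // z; rewrite /= in_itv/= => /andP[sz _].
  by apply: dVu_ge0 => //; exact: le_lt_trans sz.
by have := lt_le_trans pos (le_trans le1 I0); rewrite ltxx.
Qed.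

Lemma double_primitive_le (x s t : R) : x \in `[a, b] -> T <= s -> s <= t ->
  double_primitive x t <= double_primitive x s.
Proof.
move=> xab Ts st; apply: le_Rintegral.
- exact: measurable_itv.
- exact: double_primitive_integrable.
- exact: double_primitive_integrable.
move=> y; rewrite /= in_itv/= => /andP[ay yx]; rewrite ler_wpM2l ?subr_ge0//.
apply: u_nonincreasing => //; rewrite in_itv/= ay (le_trans yx)//.
by move: xab; rewrite in_itv/= => /andP[].
Qed.

(** Beyond T the defect is nonincreasing in t, because double_primitive is
    nonincreasing and weighted_primitive nondecreasing. Its integrals over
    intervals vanish, so it is at most 0 at the right end of each interval and at
    least 0 at the left end. *)
Lemma defect_zero (x t : R) : x \in `[a, b] -> T < t -> defect x t = 0.
Proof.
move=> xab Tt.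
have mono s r : T <= s -> s <= r -> defect x r <= defect x s.
  move=> Ts sr; apply: lerB.
    by rewrite ler_pM2l// double_primitive_le.
  by apply: weighted_primitive_le => //; exact: le_trans Ts.
have zero s r : 0 <= s -> s <= r -> \int[mu]_(z in `]s, r]) defect x z = 0.
  move=> s0 sr; rewrite -(Rintegral_itvB (a := BLeft 0)) ?bnd_simp//.
    by rewrite !primitive_defect ?subrr// (le_trans s0).
  exact: defect_integrable.
have int s r : 0 <= s -> mu.-integrable `]s, r] (EFin \o defect x).
  move=> s0; apply: integrableS (defect_integrable r xab) => // z.
  by rewrite /= !in_itv/= => /andP[sz ->]; rewrite andbT ltW// (le_lt_trans s0).
have cst s r (c : R) : s < r -> \int[mu]_(z in `]s, r]) c = c * (r - s).
  by move=> sr; rewrite Rintegral_cst// [X in fine X]lebesgue_measure_itv/= lte_fin sr.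
have icst s r (c : R) : mu.-integrable `]s, r] (EFin \o (fun=> c)).
  apply: (@integrableS _ _ _ mu `[s, r]) => //; first exact: subset_itv_oc_cc.
  by apply: continuous_itv_integrable => ?; exact: cst_continuous.
apply/eqP; rewrite eq_le; apply/andP; split.
  have : \int[mu]_(z in `]T, t]) defect x t <= \int[mu]_(z in `]T, t]) defect x z.
    apply: le_Rintegral; [exact: measurable_itv|exact: icst|exact: int|].
    by move=> z; rewrite /= in_itv/= => /andP[Tz zt]; apply: mono => //; exact: ltW.
  by rewrite zero ?(ltW Tt)// cst// pmulr_lle0// subr_gt0.
have tt1 : t < t + 1 by rewrite ltrDl.
have t0 : 0 <= t by rewrite ltW// (le_lt_trans T0).
have : \int[mu]_(z in `]t, t + 1]) defect x z <= \int[mu]_(z in `]t, t + 1]) defect x t.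
  apply: le_Rintegral; [exact: measurable_itv|exact: int|exact: icst|].
  by move=> z; rewrite /= in_itv/= => /andP[tz _]; apply: mono => //; exact: ltW.
by rewrite zero ?(ltW tt1)// cst// pmulr_lge0// subr_gt0.
Qed.

(** Beyond T a nonincreasing function equals a nondecreasing one, so both are
    constant and u vanishes there. This makes double_primitive vanish beyond T,
    hence also weighted_primitive, and the latter at the point T + 1 controls u
    before T + 1. *)
Lemma damped_eq0 (x t : R) : x \in `[a, b] -> 0 < t -> u t x = 0.
Proof.
move=> xab t0.
have QG y s : y \in `[a, b] -> T < s -> weighted_primitive y s = 2 * double_primitive y s.
  by move=> yab Ts; have /eqP := defect_zero yab Ts; rewrite subr_eq0 => /eqP <-.
have late y r : y \in `[a, b] -> T < r -> u r y = 0.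
  move=> yab Tr; pose s := (T + r) / 2.
  have [Ts sr] : T < s /\ s < r by rewrite /s; split; lra.
  apply: (@weighted_primitive_flat y s r (r + 1)) => //.
  - by rewrite ltW// (le_lt_trans T0).
  - by rewrite ltrDl.
  - have Tr1 : T < r + 1 by rewrite (lt_trans Tr)// ltrDl.
    rewrite !QG// ler_pM2l// double_primitive_le//; first exact: ltW.
    by rewrite ltW// (lt_trans sr)// ltrDl.
have [Tt|tT] := ltP T t; first exact: late.
apply: (@weighted_primitive_flat x 0 t (T + 1)) => //; first by rewrite (le_lt_trans tT)// ltrDl.
have T1 : T < T + 1 by rewrite ltrDl.
rewrite QG// /weighted_primitive set_itv1 Rintegral_set1 /double_primitive.
rewrite (_ : Rintegral _ _ _ = 0) ?mulr0//.
rewrite /Rintegral integral0_eq// => y; rewrite /= in_itv/= => /andP[ay yx].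
rewrite late ?mulr0// in_itv/= ay (le_trans yx)//.
by move: xab; rewrite in_itv/= => /andP[].
Qed.

End with_order.
End with_equation.
End damped_uniqueness.

(** * Functions with the same primitive *)

Lemma lipschitz_half_line (R : realType) (g : R -> R) : [lipschitz g t | t in `[0, +oo[] ->
  exists2 L : R, 0 <= L & forall s t, 0 <= s -> 0 <= t -> `|g s - g t| <= L * `|s - t|.
Proof.
move=> lip; have : \forall L \near +oo, L.-lipschitz_`[0, +oo[ g /\ 0 <= L.
  by apply: filterI => //; apply: nbhs_pinfty_ge; rewrite num_real.
move=> /filter_ex[L [gL L0]]; exists L => // s t s0 t0.
by apply: (gL (s, t)); split; rewrite /= in_itv/= andbT.
Qed.

Section lipschitz_function.
Context {R : realType}.
Variables (g : R -> R) (L : R).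
Hypothesis L0 : 0 <= L.
Hypothesis gL : forall s t, 0 <= s -> 0 <= t -> `|g s - g t| <= L * `|s - t|.
Local Notation mu := (@lebesgue_measure R).

Let L1 : 0 < L + 1. Proof. by rewrite ltr_wpDl. Qed.

Let small (e : R) : 0 < e -> 0 < e / (L + 1) /\ L * (e / (L + 1)) <= e.
Proof.
move=> e0; split; first by rewrite divr_gt0.
by rewrite mulrCA ler_piMr ?(ltW e0)// ler_pdivrMr// mul1r lerDl.
Qed.

Lemma lipschitz_continuous_gt0 (t : R) : 0 < t -> {for t, continuous g}.
Proof.
move=> t0; apply/cvgrPdist_le => e e0; have [d0 de] := small e0.
have m0 : 0 < Num.min t (e / (L + 1)) by rewrite lt_min t0.
exists (Num.min t (e / (L + 1))) => // s.
rewrite /ball_ /= lt_min => /andP[st sd].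
have s0 : 0 <= s by move: st; rewrite ltr_norml => /andP[? ?]; lra.
apply: le_trans (gL (ltW t0) s0) _; apply: le_trans de.
by rewrite ler_wpM2l// ltW.
Qed.

Lemma lipschitz_ae_bound (M : R) : {ae mu, forall t, 0 <= t -> `|g t| <= M} ->
  forall t, 0 <= t -> `|g t| <= M.
Proof.
move=> gM t t0; apply/ler_addgt0Pr => e e0; have [d0 de] := small e0.
have te : t < t + e / (L + 1) by rewrite ltrDl.
have [s /andP[ts se] gs] := ae_dense te gM.
have s0 : 0 <= s by rewrite (le_trans t0)// ltW.
rewrite -(subrK (g s) (g t)) addrC (le_trans (ler_normD _ _))// lerD ?gs//.
apply: le_trans (gL t0 s0) _; apply: le_trans de; rewrite ler_wpM2l//.
by rewrite distrC ger0_norm ?subr_ge0 ?(ltW ts)// lerBlDl ltW.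
Qed.

Variables (d : R -> R) (T : R).
Hypothesis T0 : 0 <= T.
Hypothesis d_ge0 : forall t, 0 <= t -> 0 <= d t.
Hypothesis d_nonincreasing : forall s t, T <= s -> s <= t -> d t <= d s.
Hypothesis ig : forall t, mu.-integrable `[0, t] (EFin \o g).
Hypothesis id : forall t, mu.-integrable `[0, t] (EFin \o d).
Hypothesis same_primitive : forall t, 0 <= t ->
  \int[mu]_(s in `[0, t]) (d s - g s) = 0.

Let int_itv (h : R -> R) (s t : R) : 0 <= s -> mu.-integrable `[0, t] (EFin \o h) ->
  mu.-integrable `]s, t] (EFin \o h).
Proof.
move=> s0; apply: integrableS => // z; rewrite /= !in_itv/= => /andP[sz ->].
by rewrite andbT ltW// (le_lt_trans s0).
Qed.

Let primitive_itv (s t : R) : 0 <= s -> s <= t ->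
  \int[mu]_(z in `]s, t]) d z = \int[mu]_(z in `]s, t]) g z.
Proof.
move=> s0 st; apply/eqP; rewrite -subr_eq0 -RintegralB//; [|exact: int_itv..].
rewrite -(Rintegral_itvB (a := BLeft 0)) ?bnd_simp//; last exact: integrable_sub.
by rewrite !same_primitive ?subrr// (le_trans s0).
Qed.

Let cst_itv (s r c : R) : 0 < r -> \int[mu]_(z in `]s, s + r]) c = r * c /\
  mu.-integrable `]s, s + r] (EFin \o (fun=> c)).
Proof.
move=> r0; have sr : s < s + r by rewrite ltrDl.
split.
  rewrite Rintegral_cst// [X in fine X]lebesgue_measure_itv/= lte_fin sr/=.
  by rewrite addrAC subrr add0r mulrC.
apply: (@integrableS _ _ _ mu `[s, s + r]) => //; first exact: subset_itv_oc_cc.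
by apply: continuous_itv_integrable => ?; exact: cst_continuous.
Qed.

(** The means of d over short intervals are those of g, hence close to the
    values of g. This transfers pointwise properties of d to g although d is not
    known to be continuous. *)
Let mean_bounds (s r : R) : 0 <= s -> 0 < r ->
  r * (g s - L * r) <= \int[mu]_(z in `]s, s + r]) d z <= r * (g s + L * r).
Proof.
move=> s0 r0; have sr : s <= s + r by rewrite lerDl ltW.
have lip z : `]s, s + r]%classic z -> `|g z - g s| <= L * r.
  rewrite /= in_itv/= => /andP[sz zr]; apply: le_trans (gL _ s0) _.
    by rewrite ltW// (le_lt_trans s0).
  by rewrite ler_wpM2l// ger0_norm ?subr_ge0 ?(ltW sz)// lerBlDl.
have iI := int_itv s0 (ig (s + r)).
have [e1 i1] := cst_itv s (g s - L * r) r0.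
have [e2 i2] := cst_itv s (g s + L * r) r0.
rewrite primitive_itv// -e1 -e2; apply/andP; split.
  apply: le_Rintegral; [exact: measurable_itv|exact: i1|exact: iI|].
  by move=> z /lip; rewrite ler_distl => /andP[].
apply: le_Rintegral; [exact: measurable_itv|exact: iI|exact: i2|].
by move=> z /lip; rewrite ler_distl => /andP[].
Qed.

Lemma primitive_order_ge0 (t : R) : 0 <= t -> 0 <= g t.
Proof.
move=> t0; apply/ler_addgt0Pr => e e0; have [r0 re] := small e0.
have /andP[_] := mean_bounds t0 r0; set r := e / (L + 1) in r0 re *.
move=> h; have : 0 <= r * (g t + L * r).
  apply: le_trans h; apply: Rintegral_ge0 => z; rewrite /= in_itv/= => /andP[tz _].
  by apply: d_ge0; rewrite ltW// (le_lt_trans t0).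
by rewrite pmulr_rge0// => h'; apply: le_trans h' _; rewrite lerD2l.
Qed.

Lemma primitive_order_nonincreasing (s t : R) : T <= s -> s <= t -> g t <= g s.
Proof.
move=> Ts; rewrite le_eqVlt => /predU1P[->//|st].
have s0 : 0 <= s by exact: le_trans Ts.
have t0 : 0 <= t by rewrite ltW// (le_lt_trans s0).
apply/ler_addgt0Pr => e e0; have e20 : 0 < e / 2 by rewrite divr_gt0.
have [q0 qe] := small e20.
pose r := Num.min (t - s) (e / 2 / (L + 1)).
have r0 : 0 < r by rewrite lt_min subr_gt0 st.
have Lr : L * r <= e / 2 by apply: le_trans qe; rewrite ler_wpM2l// ge_min lexx orbT.
have srt : s + r <= t by rewrite -lerBrDl ge_min lexx.
have /andP[lt _] := mean_bounds t0 r0.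
have /andP[_ us] := mean_bounds s0 r0.
have [e1 i1] := cst_itv t (d t) r0.
have [e2 i2] := cst_itv s (d t) r0.
have h : r * (g t - L * r) <= r * (g s + L * r).
  apply: le_trans lt _; apply: le_trans us.
  apply: (@le_trans _ _ (r * d t)).
    rewrite -e1; apply: le_Rintegral; [exact: measurable_itv|exact: int_itv|exact: i1|].
    move=> z; rewrite /= in_itv/= => /andP[tz _]; apply: d_nonincreasing; last exact: ltW.
    by rewrite (le_trans Ts)// ltW.
  rewrite -e2; apply: le_Rintegral; [exact: measurable_itv|exact: i2|exact: int_itv|].
  move=> z; rewrite /= in_itv/= => /andP[sz zs]; apply: d_nonincreasing.
    by rewrite (le_trans Ts)// ltW.
  exact: le_trans zs srt.
move: h; rewrite ler_pM2l// lerBlDr => h; apply: le_trans h _.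
by rewrite -addrA lerD2l [leRHS]splitr lerD.
Qed.

End lipschitz_function.

(** * Two solutions of the Cauchy problem *)

Lemma is_derive_seg_Re (R : realType) (a b : R) (F G : R -> R[i]) (x : R) (DF DG : R[i])
    (f : R -> R) (D : R) : x \in `[a, b] ->
    is_derive_seg a b F x DF -> is_derive_seg a b G x DG ->
    (forall y, y \in `[a, b] -> complex.Re (F y) - complex.Re (G y) = f y) ->
    complex.Re DF - complex.Re DG = D ->
  seg_derivative a b f x D.
Proof.
move=> xab dF dG fE DE.
have [cF _] := cvg_complex_parts _ dF.
have [cG _] := cvg_complex_parts _ dG.
have FF : Filter (within [set` `[a, b]] x^') by exact: within_filter.
rewrite /seg_derivative -DE; apply: cvg_trans; last exact: cvgB cF cG.
apply: near_eq_cvg.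
rewrite near_withinE; near=> y => yab.
have quot (z : R[i]) (r : R) : complex.Re (z / r%:C) = complex.Re z / r.
  by rewrite -fmorphV ReM_real.
rewrite !fctE !quot -mulrBl !raddfB /= -!fE//; congr (_ / _); ring.
Unshelve. all: by end_near. Qed.

Section solutions.
Context {R : realType}.
Variable nu : {measure set R -> \bar R}.
Hypothesis levy : levy_measure nu.
Context {d : measure_display} {T : measurableType d} {P : probability T R}.
Variables (sigma : R -> T -> R) (f : R -> R -> R).
Hypothesis Hf : inverse_density P (bernstein nu) sigma f.
Variables (H theta : R).
Hypotheses (HH : 1 / 2 < H < 1) (theta0 : 0 < theta).
Variables (c1 c2 : R).
Hypotheses (c2_gt0 : 0 < c2) (c12 : - (1 / theta) < c1 - c2).
Variable psi : R[i] -> R[i].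
Hypothesis Hpsi : local_inverse (bernstein nu) c2 psi.
Variables (a b : R).
Local Notation mu := (@lebesgue_measure R).
Local Notation D := (`[0, +oo[%classic : set R).
Local Notation phi := (laplace_exponent nu).
Local Notation dV := (derive1 (variance_fOU H theta)).
Local Notation laplace g m := (\int[mu]_(t in D) (expR (- (m * t)) * g t)).
Implicit Types (v w : R -> contI a b).

Lemma variance_weight_integrable (c : R) : - theta^-1 < c ->
  mu.-integrable D (EFin \o (fun t => expR (- (c * t)) * dV t)).
Proof.
move=> ctheta; have [K K0 dVK] := variance_derive_le HH theta0.
have c0 : 0 < c + theta^-1 by rewrite -ltrBlDr sub0r.
have [ie _] := integral_expR c0.
have iK : mu.-integrable `]0, +oo[ (EFin \o (fun t => K * expR (- ((c + theta^-1) * t)))).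
  apply: integrable_scale => //; apply: integrableS ie => //.
  by apply: subset_itvr; rewrite bnd_simp.
apply: integrable_obnd_cbnd.
have pos (t : R) : `]0, +oo[%classic t -> 0 < t by rewrite /= in_itv/= andbT.
have [|||//] := @Rintegral_le_bound _ _ _ mu `]0, +oo[ (fun t => expR (- (c * t)) * dV t) _ _ _ iK.
- exact: measurable_itv.
- apply: measurable_funM.
    by apply: measurable_funTS; apply: continuous_measurable_fun; exact: continuous_expRNM.
  apply: open_continuous_measurable_fun; first exact: interval_open.
  by move=> t /set_mem/pos t0; exact: variance_derive_continuous.
- move=> t /pos t0; rewrite normrM !ger0_norm ?expR_ge0//; last first.
    by rewrite ltW// variance_derive_gt0.
  rewrite mulrDl opprD expRD mulrCA ler_wpM2l ?expR_ge0//.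
  exact: dVK.
Qed.

Lemma solution_laplace v vPhi (x l : R) : Linfty v -> is_SPhi f v vPhi -> 0 < l ->
  claplace (fun t => vPhi t x) l%:C = (phi l / l * laplace (fun t => v t x) (phi l))%:C.
Proof.
move=> Lv Sv l0; rewrite (is_SPhi_laplace levy Hf x Lv Sv)//.
by rewrite bernstein_real claplace_real rmorphM fmorph_div.
Qed.

(** Two preimages of the same function under S_Phi have the same Laplace
    transform at all points Phi l with l > 0, and these include the half-line
    beyond phi 1. *)
Lemma SPhi_laplace_eq v w vPhi (x m : R) : Linfty v -> Linfty w ->
    is_SPhi f v vPhi -> is_SPhi f w vPhi -> phi 1 <= m ->
  laplace (fun t => v t x) m = laplace (fun t => w t x) m.
Proof.
move=> Lv Lw Sv Sw /(laplace_exponent_surj levy)[l l0 <-].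
have pl0 : phi l / l != 0 by rewrite gt_eqF// divr_gt0// laplace_exponent_gt0.
apply: (mulfI pl0); apply: (@complexI R).
by rewrite -(solution_laplace x Lv Sv l0) -(solution_laplace x Lw Sw l0).
Qed.

(** The pullback hypothesis of LhatE holds for any preimage psi (c2 + i z) of
    c2 + i z, since the factor Phi l / l of the Laplace transform cancels the factor
    psi / (c2 + i z) of the operator. *)
Lemma solution_Lhat v vPhi (x l : R) : Linfty v -> is_SPhi f v vPhi -> 0 < l ->
    [lipschitz v t x | t in `[0, +oo[] ->
    Lhat_domain (bernstein nu) dV c1 c2 psi (claplace (fun t => vPhi t x)) l%:C ->
  Lhat (bernstein nu) dV c1 c2 psi (claplace (fun t => vPhi t x)) l%:C =
  (laplace (fun t => dV t * v t x) (phi l))%:C.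
Proof.
move=> Lv Sv l0 lip dom; have [L L0 vL] := lipschitz_half_line lip.
have [mv [M vM]] := Lv; have [ie _] := integral_expR c2_gt0.
rewrite (@LhatE R _ _ _ _ _ _ _ (fun t => v t x)).
- by rewrite bernstein_real claplace_real.
- by apply: variance_weight_integrable; rewrite -div1r.
- apply: (integrable_ae_bounded (M := M)) => //; first exact: strongly_measurable_eval.
  apply: (@filterS _ _ (ae_filter_ringOfSetsType mu) _ _ _ vM) => s vs s0.
  exact: le_trans (normr_contI_le _ _) (vs s0).
- by move=> t t0; exact: variance_derive_continuous.
- by move=> t t0; rewrite gt_eqF// variance_derive_gt0.
- by move=> t t0; exact: lipschitz_continuous_gt0 L0 vL t t0.
- move=> z; have [psi0 psiE] := Hpsi z.
  have p0 : psi (c2 +i* z) != 0.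
    by apply: contraTneq psi0 => ->; rewrite /= ltxx.
  have z0 : c2 +i* z != 0 by rewrite eq_complex /= negb_and gt_eqF.
  rewrite /Lhat_pullback (is_SPhi_laplace levy Hf x Lv Sv)// psiE mulrA.
  by rewrite mulrA divfK// divff// mul1r.
- exact: dom.
Qed.

Lemma Linfty_eval v (x : R) : Linfty v ->
  measurable_fun D (fun t => v t x) /\
  exists M : R, {ae mu, forall t, 0 <= t -> `|v t x| <= M}.
Proof.
move=> [mv [M vM]]; split; first exact: strongly_measurable_eval.
exists M; apply: (@filterS _ _ (ae_filter_ringOfSetsType mu) _ _ _ vM) => s vs s0.
exact: le_trans (normr_contI_le _ _) (vs s0).
Qed.

Lemma Linfty_weighted v (g : R -> R) (x : R) : Linfty v ->
  mu.-integrable D (EFin \o g) -> mu.-integrable D (EFin \o (fun t => g t * v t x)).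
Proof.
move=> /(Linfty_eval x)[mv [M vM]] ig.
exact: integrable_ae_bounded vM.
Qed.

Lemma laplaceB v w (g : R -> R) (x m : R) : Linfty v -> Linfty w ->
    mu.-integrable D (EFin \o (fun t => expR (- (m * t)) * g t)) ->
  laplace (fun t => g t * (v t x - w t x)) m =
  laplace (fun t => g t * v t x) m - laplace (fun t => g t * w t x) m.
Proof.
move=> Lv Lw ig; have iv := Linfty_weighted x Lv ig; have iw := Linfty_weighted x Lw ig.
rewrite -RintegralB//.
- by apply: eq_Rintegral => t _; rewrite mulrBr mulrBr.
- by move: iv; congr (_.-integrable _ _); apply/funext => t; rewrite /= mulrA.
- by move: iw; congr (_.-integrable _ _); apply/funext => t; rewrite /= mulrA.
Qed.

Section two_solutions.
Variables (v w vPhi wPhi : R -> contI a b) (f0 : R -> R) (g1 g2 : R -> R[i]).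
Hypotheses (Lv : Linfty v) (Lw : Linfty w).
Hypothesis v_lip : forall x, x \in `[a, b] -> [lipschitz v t x | t in `[0, +oo[].
Hypothesis w_lip : forall x, x \in `[a, b] -> [lipschitz w t x | t in `[0, +oo[].
Hypotheses (Sv : is_SPhi f v vPhi) (Sw : is_SPhi f w wPhi).
Hypothesis v_sol : cauchy_solution (bernstein nu) dV c1 c2 psi f0 g1 g2 vPhi
  (fun x => claplace (fun t => vPhi t x)).
Hypothesis w_sol : cauchy_solution (bernstein nu) dV c1 c2 psi f0 g1 g2 wPhi
  (fun x => claplace (fun t => wPhi t x)).

(** The initial terms cancel. At m = phi l the equation divided by
    phi l / (2 l) reads D2 = 2 m L[u](m), because the transform of vPhi carries
    the factor phi l / l. *)
Lemma difference_equation (m : R) : a < b -> phi 1 <= m -> exists B : R -> R,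
  [/\ forall x, x \in `[a, b] -> seg_derivative a b
        (fun y => laplace (fun t => dV t * (v t y - w t y)) m) x (B x),
      forall x, x \in `[a, b] -> seg_derivative a b B x
        (2 * m * laplace (fun t => v t x - w t x) m),
      laplace (fun t => dV t * (v t a - w t a)) m = 0 &
      B a = 0].
Proof.
move=> ab /(laplace_exponent_surj levy)[l l0 lm].
have m0 : 0 < m by rewrite -lm laplace_exponent_gt0.
have aab : a \in `[a, b] by rewrite in_itv/= lexx ltW.
have [D1v [D2v [dv1 dv2 ev gv]]] := solution_equation v_sol.
have [D1w [D2w [dw1 dw2 ew gw]]] := solution_equation w_sol.
have Lhat_v x : x \in `[a, b] -> Lhat (bernstein nu) dV c1 c2 psi
    (claplace (fun t => vPhi t x)) l%:C = (laplace (fun t => dV t * v t x) m)%:C.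
  move=> xab; rewrite -lm; apply: solution_Lhat => //; first exact: v_lip.
  exact: (solution_domain v_sol).
have Lhat_w x : x \in `[a, b] -> Lhat (bernstein nu) dV c1 c2 psi
    (claplace (fun t => wPhi t x)) l%:C = (laplace (fun t => dV t * w t x) m)%:C.
  move=> xab; rewrite -lm; apply: solution_Lhat => //; first exact: w_lip.
  exact: (solution_domain w_sol).
have LB x : x \in `[a, b] -> laplace (fun t => dV t * (v t x - w t x)) m =
    laplace (fun t => dV t * v t x) m - laplace (fun t => dV t * w t x) m.
  move=> xab; apply: laplaceB => //; apply: variance_weight_integrable.
  by rewrite (lt_trans _ m0)// oppr_lt0 invr_gt0.
have UB x : laplace (fun t => v t x - w t x) m =
    laplace (fun t => v t x) m - laplace (fun t => w t x) m.
  have [ie _] := integral_expR m0.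
  rewrite -RintegralB//; [|exact: Linfty_weighted..].
  by apply: eq_Rintegral => t _; rewrite mulrBr.
exists (fun x => complex.Re (D1v x l) - complex.Re (D1w x l)); split.
- move=> x xab; apply: (is_derive_seg_Re xab (dv1 x l xab l0) (dw1 x l xab l0)) => //.
  by move=> y yab; rewrite Lhat_v// Lhat_w//= LB.
- move=> x xab; apply: (is_derive_seg_Re xab (dv2 x l xab l0) (dw2 x l xab l0)) => //.
  have solve (W : R) (z : R[i]) : m%:C * (m / l * W)%:C - m%:C / l%:C * (f0 x)%:C =
      m%:C / (2 * l%:C) * z -> complex.Re z = 2 * m * W - 2 * f0 x.
    have -> : m%:C / (2 * l%:C) = (m / (2 * l))%:C.
      by rewrite fmorph_div rmorphM /= rmorph_nat.
    rewrite -fmorph_div -!rmorphM -rmorphB [RHS]mulrC => /(congr1 (@complex.Re R)).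
    rewrite ReM_real /= => E; have c0 : m / (2 * l) != 0 by rewrite gt_eqF// divr_gt0// mulr_gt0.
    by apply: (mulIf c0); rewrite -E; field; rewrite gt_eqF.
  have := ev x l xab l0; have := ew x l xab l0.
  rewrite (solution_initial v_sol xab) (solution_initial w_sol xab).
  rewrite (solution_laplace x Lv Sv l0) (solution_laplace x Lw Sw l0).
  rewrite bernstein_real lm UB.
  by move=> /solve -> /solve ->; ring.
- rewrite LB//; apply: (@complexI R); rewrite rmorphB/= -Lhat_v// -Lhat_w//.
  by rewrite (solution_boundary v_sol l0) (solution_boundary w_sol l0) subrr.
- by rewrite gv// gw// subrr.
Qed.

Lemma difference_lipschitz x : x \in `[a, b] -> exists2 L : R, 0 <= L &
  forall s t, 0 <= s -> 0 <= t ->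
    `|(v s x - w s x) - (v t x - w t x)| <= L * `|s - t|.
Proof.
move=> xab; have [L1 L10 vL] := lipschitz_half_line (v_lip xab).
have [L2 L20 wL] := lipschitz_half_line (w_lip xab).
exists (L1 + L2); first exact: addr_ge0.
move=> s t s0 t0.
rewrite (_ : _ - _ = (v s x - v t x) - (w s x - w t x)); last by ring.
by apply: le_trans (ler_normB _ _) _; rewrite mulrDl lerD//; [exact: vL|exact: wL].
Qed.

(** The order compares the representatives p and q; their difference has the
    same Laplace transform as v - w. *)
Lemma solution_order : SPhi_le f wPhi vPhi -> exists2 T0 : R, 0 <= T0 &
  (forall t x, x \in `[a, b] -> 0 <= t -> 0 <= v t x - w t x) /\
  (forall s t x, x \in `[a, b] -> T0 <= s -> s <= t ->
    v t x - w t x <= v s x - w s x).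
Proof.
move=> [p [q [[Lp Sp] [Lq Sq] pq [e [T0 [/andP[e0 eT] mono]]]]]].
have T0_ge0 : 0 <= T0 by rewrite ltW// (lt_le_trans e0).
have phi0 : 0 < phi 1 by exact: laplace_exponent_gt0.
have [ie _] := integral_expR phi0.
have int v' w' x : Linfty v' -> Linfty w' ->
    mu.-integrable D (EFin \o (fun t => expR (- (phi 1 * t)) * (v' t x - w' t x))).
  move=> Lv' Lw'; rewrite (_ : (fun t => _) = (fun t =>
    expR (- (phi 1 * t)) * v' t x - expR (- (phi 1 * t)) * w' t x)); last first.
    by apply/funext => t; rewrite mulrBr.
  by apply: integrable_sub => //; exact: Linfty_weighted.
have laplace_sub v' w' x (m : R) : Linfty v' -> Linfty w' -> phi 1 <= m ->
    mu.-integrable D (EFin \o (fun t => expR (- (m * t)) * (v' t x - w' t x))) /\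
    laplace (fun t => v' t x - w' t x) m =
      laplace (fun t => v' t x) m - laplace (fun t => w' t x) m.
  move=> Lv' Lw' m1; have [im _] := integral_expR (lt_le_trans phi0 m1).
  split; first exact: (laplace_integrable_ge (int _ _ x Lv' Lw') m1).
  rewrite -RintegralB//; [|exact: Linfty_weighted..].
  by apply: eq_Rintegral => t _; rewrite mulrBr.
have same x t : 0 <= t ->
    \int[mu]_(s in `[0, t]) ((q s x - p s x) - (v s x - w s x)) = 0.
  move=> t0; apply: (@laplace_unique _ _ (phi 1)) => //; first exact: ltW.
    rewrite (_ : (fun t => _) = (fun t => expR (- (phi 1 * t)) * (q t x - p t x) -
      expR (- (phi 1 * t)) * (v t x - w t x))); last first.
      by apply/funext => s; rewrite mulrBr.
    by apply: integrable_sub => //; exact: int.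
  move=> m m1; have [i1 e1] := laplace_sub q p x m Lq Lp m1.
  have [i2 e2] := laplace_sub v w x m Lv Lw m1.
  rewrite (_ : (fun t => _) = (fun t => expR (- (m * t)) * (q t x - p t x) -
      expR (- (m * t)) * (v t x - w t x))); last first.
    by apply/funext => s; rewrite mulrBr.
  rewrite RintegralB// e1 e2 (SPhi_laplace_eq x Lv Lq Sv Sq m1).
  by rewrite (SPhi_laplace_eq x Lw Lp Sw Sp m1) subrr.
have d0 x t : x \in `[a, b] -> 0 <= t -> 0 <= q t x - p t x.
  by move=> xab t0; rewrite subr_ge0 pq.
have dn x s t : x \in `[a, b] -> T0 <= s -> s <= t -> q t x - p t x <= q s x - p s x.
  move=> xab Ts st; have [_ h] := mono x xab.
  by apply: h => //; rewrite in_itv/= andbT// (le_trans Ts).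
have itv v' w' x t : Linfty v' -> Linfty w' ->
    mu.-integrable `[0, t] (EFin \o (fun s => v' s x - w' s x)).
  move=> Lv' Lw'; apply: (@laplace_integrable_itv _ _ (phi 1)); first exact: ltW.
  exact: int.
exists T0 => //; split.
- move=> t x xab t0; have [L L0 uL] := difference_lipschitz xab.
  by apply: (primitive_order_ge0 L0 uL (d := fun t => q t x - p t x)) => //;
    move=> s; [exact: d0|exact: itv|exact: itv|exact: same].
- move=> s t x xab Ts st; have [L L0 uL] := difference_lipschitz xab.
  by apply: (primitive_order_nonincreasing L0 uL (d := fun t => q t x - p t x) T0_ge0) => //;
    move=> s'; [move=> t'; exact: dn|exact: itv|exact: itv|exact: same].
Qed.

Lemma solutions_equal : a < b -> SPhi_le f wPhi vPhi ->
  forall t x, x \in `[a, b] -> 0 <= t -> v t x = w t x.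
Proof.
move=> ab /solution_order[T0 T00 [u_ge0 u_noninc]].
have bound v' (v'_lip : forall x, x \in `[a, b] -> [lipschitz v' t x | t in `[0, +oo[]) :
    Linfty v' -> exists M : R, forall t x, 0 <= t -> `|v' t x| <= M.
  move=> [_ [M vM]]; exists (Num.max M 0) => t x t0.
  have [xab|xab] := boolP (x \in `[a, b]); last first.
    by rewrite contI_out// normr0 le_max lexx orbT.
  have [L L0 vL] := lipschitz_half_line (v'_lip x xab).
  rewrite le_max; apply/orP; left; apply: (lipschitz_ae_bound L0 vL) t0.
  apply: (@filterS _ _ (ae_filter_ringOfSetsType mu) _ _ _ vM) => s vs s0.
  exact: le_trans (normr_contI_le _ _) (vs s0).
have [Mv vM] := bound _ v_lip Lv.
have [Mw wM] := bound _ w_lip Lw.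
have cont v' x t (v'_lip : forall x, x \in `[a, b] -> [lipschitz v' t x | t in `[0, +oo[]) :
    x \in `[a, b] -> 0 < t -> {for t, continuous (fun s => v' s x)}.
  move=> xab t0; have [L L0 vL] := lipschitz_half_line (v'_lip x xab).
  exact: lipschitz_continuous_gt0 L0 vL t t0.
have dV_int : mu.-integrable D (EFin \o dV).
  have : mu.-integrable D (EFin \o (fun t => expR (- (0 * t)) * dV t)).
    by apply: variance_weight_integrable; rewrite oppr_lt0 invr_gt0.
  congr (_.-integrable _ _); apply/funext => t /=.
  by rewrite mul0r oppr0 expR0 mul1r.
have u0 x t : x \in `[a, b] -> 0 < t -> v t x - w t x = 0.
  apply: (@damped_eq0 R a b dV (fun t x => v t x - w t x) (Mv + Mw) _ _ _ _ (phi 1)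
    _ _ T0) => //.
  - apply: measurable_funB; apply: strongly_measurable_joint => //.
      by case: Lv.
    by case: Lw.
  - by move=> s y s0; apply: le_trans (ler_normB _ _) _; rewrite lerD ?vM ?wM.
  - by move=> s; exact: (@contI_continuous _ _ _ (v s - w s)).
  - exact: laplace_exponent_gt0.
  - by move=> m; exact: difference_equation.
  - by move=> s; exact: variance_derive_gt0.
  - by move=> s; exact: variance_derive_continuous.
  - by move=> s y yab s0; apply: (@cvgB _ _ _ _ _ (fun s => v s y) (fun s => w s y)); exact: cont.
move=> t x xab; rewrite le_eqVlt => /predU1P[<-|t0]; last first.
  by apply/eqP; rewrite -subr_eq0 u0.
have [L L0 uL] := difference_lipschitz xab.
apply/eqP; rewrite -subr_eq0 -normr_le0; apply/ler_addgt0Pr => e e0; rewrite add0r.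
have L1 : 0 < L + 1 by rewrite ltr_wpDl.
have d0 : 0 < e / (L + 1) by rewrite divr_gt0.
have := uL 0 _ (lexx 0) (ltW d0); rewrite (u0 x _ xab d0) subr0 sub0r normrN => h.
apply: le_trans h _; rewrite ger0_norm ?(ltW d0)// mulrCA ler_piMr ?(ltW e0)//.
by rewrite ler_pdivrMr// mul1r lerDl.
Qed.

End two_solutions.
End solutions.

Theorem theorem6p1 (R : realType)
    (nu : {measure set R -> \bar R}) (Hnu : levy_measure nu)
    (d : measure_display) (T : measurableType d) (P : probability T R)
    (sigma : R -> T -> R) (Hsigma : subordinator P (bernstein nu) sigma)
    (fPhi : R -> R -> R)
    (HfPhi : inverse_density P (bernstein nu) sigma fPhi)
    (H theta : R) (HH : 1 / 2 < H < 1) (Htheta : 0 < theta)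
    (c1 c2 : R) (Hc1 : c1 < 0) (Hc2 : 0 < c2) (Hc : - (1 / theta) < c1 - c2)
    (psi : R[i] -> R[i]) (Hpsi : local_inverse (bernstein nu) c2 psi)
    (a b : R) (Hab : a < b)
    (v w : R -> contI a b) (Hv : Linfty v) (Hw : Linfty w)
    (Hv_lip : forall x, x \in `[a, b] -> [lipschitz v t x | t in `[0, +oo[])
    (Hw_lip : forall x, x \in `[a, b] -> [lipschitz w t x | t in `[0, +oo[])
    (vPhi wPhi : R -> contI a b)
    (HvPhi : is_SPhi fPhi v vPhi) (HwPhi : is_SPhi fPhi w wPhi)
    (f : R -> R) (g1 g2 : R -> R[i])
    (Hv_sol : cauchy_solution (bernstein nu) (derive1 (variance_fOU H theta)) c1 c2 psi
                f g1 g2 vPhi (fun x => claplace (fun t => vPhi t x)))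
    (Hw_sol : cauchy_solution (bernstein nu) (derive1 (variance_fOU H theta)) c1 c2 psi
                f g1 g2 wPhi (fun x => claplace (fun t => wPhi t x)))
    (Hwv : SPhi_le fPhi wPhi vPhi) :
  forall t : R, 0 <= t -> wPhi t = vPhi t.
Proof.
have vw : forall t, 0 <= t -> v t = w t.
  move=> t t0; apply: val_inj; apply/funext => x /=.
  have [xab|xab] := boolP (x \in `[a, b]); last by rewrite !contI_out.
  exact: (solutions_equal Hnu HfPhi HH Htheta Hc2 Hc Hpsi Hv Hw Hv_lip Hw_lip
    HvPhi HwPhi Hv_sol Hw_sol Hab Hwv).
move=> t; have [v0 Sv] := HvPhi; have [w0 Sw] := HwPhi.
rewrite le_eqVlt => /predU1P[<-|t0]; first by rewrite v0 w0 vw.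
apply: val_inj; apply/funext => x /=.
have mpos : measurable (`]0, +oo[%classic : set R) by [].
have [_ ->] := is_bochner_eval x mpos (Sv _ t0).
have [_ ->] := is_bochner_eval x mpos (Sw _ t0).
apply: eq_Rintegral => s /set_mem; rewrite /= in_itv/= andbT => s0.
by rewrite vw// ltW.
Qed.
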